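(* Assume: (A1) $\mathbb E[\phi_i^4]<\infty$; (A2) $F$ is of class $C^2$ on $[-1,1]$; (A3) $f$ and $f'$ are bounded. Let $m=m_N$ satisfy $N^{1/2}\frac{\log m}{m^2}\to0$ as $N\to\infty$. Then, under the sequential asymptotic regime $n\to\infty$ followed by $N\to\infty$, for every fixed $x\in[-1,1]$, $$\sqrt N\big(\widehat F_{m,n,N}(x)-F(x)\big)\xrightarrow{d}\mathcal N\big(0,\sigma_F^2(x)\big),\qquad \sigma_F^2(x)=F(x)(1-F(x)).$$
   Context: Model. Fix $\sigma>0$, $\gamma>0$, $H\in(\frac12,1)$ and a time step $h>0$. For $i=1,2,\dots$ let $B^i$ be standard Brownian motions and $B^{H,i}$ fractional Brownian motions with Hurst index $H$ (centered Gaussian, covariance $\frac12(t^{2H}+s^{2H}-|t-s|^{2H})$), all mutually independent, and set $M^{H,i}_t=\sigma B^i_t+\gamma B^{H,i}_t$. The random effects $\phi_1,\phi_2,\dots$ are i.i.d. with distribution function $F$ supported on $[-1,1]$ and density $f$, independent of the family $\{M^{H,i}\}$. Put $\theta_i=\phi_i-\frac{\sigma^2}{2}$ and $Y^i_t=\theta_it+M^{H,i}_t$ (so $X^i_t=e^{Y^i_t}$ solves $dX^i_t=\phi_iX^i_t\,dt+X^i_t\,dM^{H,i}_t$, $X^i_0=1$). Statistics. $\Delta Y^i_k:=Y^i_{(k+1)h}-Y^i_{kh}$, $\widehat\theta_i=\frac1{nh}\sum_{k=0}^{n-1}\Delta Y^i_k$, and $\xi^i_n=\frac1n\sum_{k=0}^{n-1}(\Delta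 Y^i_k)^2$, $\eta^i_n=\frac1n\sum_{k=0}^{n-1}\Delta Y^i_k\Delta Y^i_{k+1}$, $\zeta^i_n=\frac1n\sum_{k=0}^{n-1}(Y^i_{(k+2)h}-Y^i_{kh})(Y^i_{(k+4)h}-Y^i_{(k+2)h})$. Averages over $N$ subjects: $\bar V_{n,N}=\frac1N\sum_{i=1}^N\widehat\theta_i^2$, $\bar\xi_{n,N}=\frac1N\sum_{i=1}^N\xi^i_n$, $\bar\eta_{n,N}=\frac1N\sum_{i=1}^N\eta^i_n$, $\bar\zeta_{n,N}=\frac1N\sum_{i=1}^N\zeta^i_n$. Estimators. With $\log_2^+(x):=\mathbf 1_{\{x>0\}}\log_2x$, $\widehat H=\frac12\log_2^+\!\Big(\frac{\bar\zeta_{n,N}-4h^2\bar V_{n,N}}{\bar\eta_{n,N}-h^2\bar V_{n,N}}\Big)$, $\ \widehat\gamma^2=\frac{\bar\eta_{n,N}-h^2\bar V_{n,N}}{h^{2\widehat H}(2^{2\widehat H-1}-1)}$, $\ \widehat\sigma^2=\frac{\bar\xi_{n,N}-h^2\bar V_{n,N}-\widehat\gamma^2h^{2\widehat H}}{h}$, and $\widehat\phi_i=\widehat\theta_i+\frac12\widehat\sigma^2$ for $i=1,\dots,N$. Lagrange estimator. For $m\ge1$ let $x_j=\cos\big(\frac{(2j-1)\pi}{2m}\big)$ for $j=1,\dots,m$ (Chebyshev-Gauss nodes), $\mathcal L_j(x)=\prod_{i=1,\,i\ne j}^m\frac{x-x_i}{x_j-x_i}$, $\widehat F_N(y)=\frac1N\sum_{i=1}^N\mathbf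 1_{\{\widehat\phi_i\le y\}}$, and $\widehat F_{m,n,N}(x)=\sum_{j=1}^m\widehat F_N(x_j)\mathcal L_j(x)$ for $x\in[-1,1]$. The sequential regime means: first $n\to\infty$ with $N$ fixed, then $N\to\infty$. Normal laws may be degenerate.
   Formalization: It is additionally assumed that m_N → ∞; given the rate condition this only excludes m_N = 1 for infinitely many N, where log m = 0 satisfies the condition but the estimator reduces to the empirical distribution function at 0 and the claim fails. *)

(* Defs.v *)
From HB Require Import structures.
From mathcomp Require Import all_boot all_order all_algebra.
From mathcomp Require Import all_classical all_reals all_analysis.
Set Implicit Arguments.
Unset Strict Implicit.
Unset Printing Implicit Defensive.
Import Order.TTheory GRing.Theory Num.Theory.
Import numFieldNormedType.Exports.
Local Open Scope classical_set_scope.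
Local Open Scope ring_scope.

(* Parametrized by the variance [v]; the library's [normal_prob m s] is not a
   Dirac mass at [s = 0], hence the separate degenerate case. *)
Definition normal_law (R : realType) (m v : R) :
    probability (measurableTypeR R) R :=
  if v == 0 then (@dirac _ (measurableTypeR R) m R : probability _ _)
  else (normal_prob m (Num.sqrt v) : probability _ _).

Section Convergence.
Context (R : realType) (d : measure_display) (T : measurableType d).
Variable P : probability T R.

Definition bounded_continuous (g : R -> R) :=
  continuous g /\ [bounded g y | y in [set: R]].

Definition cvg_in_law (X : nat -> T -> R)
    (nu : probability (measurableTypeR R) R) :=
  forall g : R -> R, bounded_continuous g ->
    'E_P[g \o X n]%E @[n --> \oo] --> (\int[nu]_y (g y)%:E)%E.

Definition weak_cvg (nu : nat -> probability (measurableTypeR R) R)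
    (mu : probability (measurableTypeR R) R) :=
  forall g : R -> R, bounded_continuous g ->
    (\int[nu N]_y (g y)%:E)%E @[N --> \oo] --> (\int[mu]_y (g y)%:E)%E.

(* Sequential asymptotics: for each fixed [N >= 1], [Z n N] converges in law as
   [n --> oo]; the limiting laws then converge weakly as [N --> oo]. *)
Definition seq_cvg_in_law (Z : nat -> nat -> T -> R)
    (mu : probability (measurableTypeR R) R) :=
  exists nu : nat -> probability (measurableTypeR R) R,
    (forall N, (0 < N)%N -> cvg_in_law (fun n => Z n N) (nu N)) /\
    weak_cvg nu mu.

End Convergence.

Section Processes.
Context (R : realType) (d : measure_display) (T : measurableType d).
Variable P : probability T R.

Definition mutually_independent (I : eqType) (G : I -> set (set T)) :=
  forall (s : seq I) (A : I -> set T), uniq s ->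
    (forall i, i \in s -> G i (A i)) ->
    P (\bigcap_(i in [set` s]) A i) = (\prod_(i <- s) P (A i))%E.

Definition independent_systems (G1 G2 : set (set T)) :=
  forall A1 A2, G1 A1 -> G2 A2 -> P (A1 `&` A2) = (P A1 * P A2)%E.

(* The sigma-algebra generated by the variables [X j], [j] in [D]. *)
Definition sigma_family (J : Type) (D : set J) (X : J -> T -> R) :
    set (set T) :=
  <<s \bigcup_(j in D) g_sigma_algebra_preimage (X j) >>.

Definition has_normal_law (X : T -> R) (m v : R) :=
  forall A : set R, measurable A -> P (X @^-1` A) = normal_law m v A.

(* Processes are families indexed by all of [R]; only times [t >= 0] matter. *)
Definition brownian_motion (W : R -> {RV P >-> R}) :=
  [/\ {ae P, forall w, W 0 w = 0},
      forall s t, 0 <= s -> s <= t ->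
        has_normal_law (fun w => W t w - W s w) 0 (t - s),
      forall (k : nat) (t : nat -> R), 0 <= t 0%N ->
        {homo t : i j / (i <= j)%N >-> i <= j} ->
        mutually_independent (fun i : 'I_k =>
          g_sigma_algebra_preimage (fun w => W (t i.+1) w - W (t i) w)) &
      {ae P, forall w, {within [set t | 0 <= t], continuous (W ^~ w)}}].

Definition gaussian_process (W : R -> {RV P >-> R}) :=
  forall (k : nat) (t c : 'I_k -> R), (forall j, 0 <= t j) ->
    exists m v : R, 0 <= v /\
      has_normal_law (fun w => \sum_(j < k) c j * W (t j) w) m v.

Definition fractional_brownian_motion (H : R) (W : R -> {RV P >-> R}) :=
  [/\ gaussian_process W,
      forall t, 0 <= t -> 'E_P[W t]%E = 0%E &
      forall s t, 0 <= s -> 0 <= t ->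
        covariance P (W s) (W t) =
        (2^-1 * (t `^ (2 * H) + s `^ (2 * H) - `|t - s| `^ (2 * H)))%:E].

Definition mutually_independent_processes (I : eqType)
    (W : I -> R -> {RV P >-> R}) :=
  mutually_independent (fun i => sigma_family [set t | 0 <= t] (W i)).

Definition iid_with_cdf (phi : nat -> {RV P >-> R}) (F : R -> R) :=
  (forall i y, cdf (phi i) y = (F y)%:E) /\
  mutually_independent (fun i => g_sigma_algebra_preimage (phi i)).

Definition has_density (X : {RV P >-> R}) (f : R -> R) :=
  [/\ measurable_fun [set: R] f, forall y, 0 <= f y &
      forall A : set R, measurable A ->
        P (X @^-1` A) = (\int[lebesgue_measure]_(y in A) (f y)%:E)%E].

End Processes.

(* [g'] is the derivative of [g] along [A] (one-sided at end points). *)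
Definition derivative_on (R : realType) (A : set R) (g g' : R -> R) :=
  forall x, A x -> (g y - g x) / (y - x) @[y --> within A x^'] --> g' x.

Definition class_C2_on (R : realType) (A : set R) (g : R -> R) :=
  exists g1 g2 : R -> R, [/\ derivative_on A g g1, derivative_on A g1 g2 &
    {within A, continuous g2}].

(* Statistics of observed paths: [y i t] is the log-process of subject [i] at
   time [t], subjects being numbered from 0 ([i < N]). *)
Section Estimators.
Context (R : realType).
Implicit Types (h : R) (n N m : nat) (p : R -> R) (y : nat -> R -> R).

Definition incr h p (k : nat) : R := p (k.+1%:R * h) - p (k%:R * h).

Definition theta_hat h n p : R :=
  (n%:R * h)^-1 * \sum_(k < n) incr h p k.

Definition xi h n p : R := n%:R^-1 * \sum_(k < n) incr h p k ^+ 2.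

Definition eta h n p : R :=
  n%:R^-1 * \sum_(k < n) incr h p k * incr h p k.+1.

Definition zeta h n p : R :=
  n%:R^-1 * \sum_(k < n)
    (p (k.+2%:R * h) - p (k%:R * h)) * (p (k.+4%:R * h) - p (k.+2%:R * h)).

Definition subject_mean N (a : nat -> R) : R := N%:R^-1 * \sum_(i < N) a i.

Definition V_bar h n N y : R :=
  subject_mean N (fun i => theta_hat h n (y i) ^+ 2).
Definition xi_bar h n N y : R := subject_mean N (fun i => xi h n (y i)).
Definition eta_bar h n N y : R := subject_mean N (fun i => eta h n (y i)).
Definition zeta_bar h n N y : R := subject_mean N (fun i => zeta h n (y i)).

Definition log2_plus (x : R) : R := if 0 < x then ln x / ln 2 else 0.

Definition H_hat h n N y : R :=
  2^-1 * log2_plus ((zeta_bar h n N y - 4 * h ^+ 2 * V_bar h n N y) /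
                    (eta_bar h n N y - h ^+ 2 * V_bar h n N y)).

Definition gamma2_hat h n N y : R :=
  (eta_bar h n N y - h ^+ 2 * V_bar h n N y) /
  (h `^ (2 * H_hat h n N y) * (2 `^ (2 * H_hat h n N y - 1) - 1)).

Definition sigma2_hat h n N y : R :=
  (xi_bar h n N y - h ^+ 2 * V_bar h n N y
   - gamma2_hat h n N y * h `^ (2 * H_hat h n N y)) / h.

Definition phi_hat h n N y (i : nat) : R :=
  theta_hat h n (y i) + 2^-1 * sigma2_hat h n N y.

Definition F_hat h n N y (z : R) : R :=
  subject_mean N (fun i => (phi_hat h n N y i <= z)%R%:R).

Definition cheb_node m (j : nat) : R :=
  cos ((2 * j%:R - 1) * pi / (2 * m%:R)).

Definition lagrange_basis m (j : nat) (x : R) : R :=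
  \prod_(1 <= i < m.+1 | i != j)
    ((x - cheb_node m i) / (cheb_node m j - cheb_node m i)).

Definition F_lagrange h m n N y (x : R) : R :=
  \sum_(1 <= j < m.+1) F_hat h n N y (cheb_node m j) * lagrange_basis m j x.

End Estimators.

Section Model.
Context (R : realType) (d : measure_display) (T : measurableType d).
Variable P : probability T R.

Definition mixed_fbm (sigma gamma : R) (B BH : nat -> R -> {RV P >-> R})
    (i : nat) (t : R) (w : T) : R :=
  sigma * B i t w + gamma * BH i t w.

Definition log_process (sigma gamma : R) (B BH : nat -> R -> {RV P >-> R})
    (phi : nat -> {RV P >-> R}) (w : T) (i : nat) (t : R) : R :=
  (phi i w - sigma ^+ 2 / 2) * t + mixed_fbm sigma gamma B BH i t w.

End Model.

(* Main.v *)
(* For fixed [N], the increments of [B] are independent and those of [B^H] are stationary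
   Gaussian with covariances tending to 0, so the increments, their squares and their cross
   products obey L^2 laws of large numbers. Along subsequences all statistics converge almost
   surely, the plug-in estimators are continuous at the limits, and because the [phi_i] have
   no atoms the empirical distribution function of the estimated effects converges, at the
   nodes, to that of the [phi_i].
   As [N] grows, write [sum_j 1{u <= x_j} L_j(x) = 1{u <= x} + H_m(u)], where [|H_m| <= 2] and
   [|H_m(u)| <= 1 / (m |x - u|)]. The indicators give a normalized Bernoulli sum, compared with
   Brownian increments one summand at a time (Trotter); the centered [H_m] part vanishes in
   L^2; and the mean of [H_m] is the Lagrange interpolation error of [F], which is
   O(log m / m^2) for [F] of class C^2. *)
Require Import Defs.
From HB Require Import structures.
From mathcomp Require Import all_boot all_order all_algebra.
From mathcomp Require Import all_classical all_reals all_analysis.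
From mathcomp Require Import measurable_realfun.
From mathcomp Require Import ring lra.
Set Implicit Arguments.
Unset Strict Implicit.
Unset Printing Implicit Defensive.
Import Order.TTheory GRing.Theory Num.Theory.
Import numFieldNormedType.Exports.
Local Open Scope classical_set_scope.
Local Open Scope ring_scope.

(** * Lagrange interpolation at Chebyshev nodes *)

(** The sum of the [|L_j(x)|] at the Chebyshev nodes grows like log m, so term by term estimates do
    not bound [H_m]: the signs of the basis polynomials have to be used. Once [H_m] is bounded,
    dominated convergence handles its second moment, since [H_m (phi)] tends to 0 off the null event
    [phi = x]. For the mean, the remainder of [F] is treated through second differences of an
    explicit function of the angle instead of best polynomial approximation. The limit law is
    realised on the probability space of the model, as an increment of one of its Brownian motions
    over an interval of length [F(x)(1 - F(x))]. The central limit theorem thus becomes a comparison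
    of two iterated averaging operators whose first two moments agree, and a degenerate variance is
    merely an interval of length zero. The comparison needs test functions with a third-order
    remainder; bounded continuous ones are reached by cubic splines on a compact interval, the tails
    being controlled by second moments. *)

Section ChebyshevPoly.
Variable R : realType.
Implicit Types (t a b : R) (n m j : nat).

(** The Chebyshev polynomials of the first kind in degrees [n] and [n + 1]; carrying both makes the
    two-term recurrence structural. *)
Fixpoint cheb_pair n : {poly R} * {poly R} :=
  if n is n'.+1 then
    let p := cheb_pair n' in (p.2, 2%:P * 'X * p.2 - p.1)
  else (1, 'X).

Definition cheb n := (cheb_pair n).1.

Lemma chebSS n : cheb n.+2 = 2%:P * 'X * cheb n.+1 - cheb n.
Proof. by []. Qed.

Lemma cheb_ind (Q : nat -> {poly R} -> Prop) :
  Q 0%N 1 -> Q 1%N 'X ->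
  (forall n p q, Q n p -> Q n.+1 q -> Q n.+2 (2%:P * 'X * q - p)) ->
  forall n, Q n (cheb n).
Proof.
move=> Q0 Q1 QS n; suff [] : Q n (cheb n) /\ Q n.+1 (cheb n.+1) by [].
elim: n => [|n [IH0 IH1]]; first by split.
by split=> //; rewrite chebSS; apply: QS.
Qed.

Lemma sin_mulS n t : sin (n.+1%:R * t) = sin (n%:R * t) * cos t + cos (n%:R * t) * sin t.
Proof. by rewrite -natr1 mulrDl mul1r sinD. Qed.

Lemma cos_mulS n t : cos (n.+1%:R * t) = cos (n%:R * t) * cos t - sin (n%:R * t) * sin t.
Proof. by rewrite -natr1 mulrDl mul1r cosD. Qed.

Lemma horner_cheb n t : (cheb n).[cos t] = cos (n%:R * t).
Proof.
pose Q n p := p.[cos t] = cos (n%:R * t).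
apply: (@cheb_ind Q); rewrite /Q.
- by rewrite mul0r cos0 hornerC.
- by rewrite mul1r hornerX.
move=> {}n p q Hp Hq; rewrite !hornerE Hp Hq.
rewrite (cos_mulS n.+1) (sin_mulS n) (cos_mulS n).
by ring: (cos2sin2 t).
Qed.

(** This is [T_n (cos t) = cos (n t)] differentiated, but proved by the recurrence: the factor
    [sin t] stays on the left and no point is excluded. At a zero of [T_m] it yields the normalising
    constant of the Lagrange basis. *)
Lemma horner_deriv_cheb n t :
  (cheb n)^`().[cos t] * sin t = n%:R * sin (n%:R * t).
Proof.
pose Q n p := p.[cos t] = cos (n%:R * t) /\
  p^`().[cos t] * sin t = n%:R * sin (n%:R * t).
suff [] : Q n (cheb n) by [].
apply: (@cheb_ind Q); rewrite /Q.
- by split; rewrite ?mul0r ?cos0 ?hornerC// derivC horner0 mul0r.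
- by split; rewrite ?mul1r ?hornerX// derivX hornerC mul1r.
move=> {}n p q [p0 p1] [q0 q1].
have E0 : (2%:P * 'X * q - p).[cos t] = cos (n.+2%:R * t).
  rewrite !hornerE p0 q0 (cos_mulS n.+1) (sin_mulS n) (cos_mulS n).
  by ring: (cos2sin2 t).
split => //.
rewrite !poly.derivE !hornerE.
transitivity (2 * q.[cos t] * sin t + 2 * cos t * (q^`().[cos t] * sin t)
  - p^`().[cos t] * sin t); first by ring.
rewrite q0 q1 p1 (sin_mulS n.+1) (cos_mulS n) (sin_mulS n) -!natr1.
by ring: (cos2sin2 t).
Qed.

Lemma size_cheb n : size (cheb n) = n.+1.
Proof.
pose Q n (p : {poly R}) := size p = n.+1.
apply: (@cheb_ind Q); rewrite /Q ?size_poly1 ?size_polyX// => {}n p q sp sq.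
have s2 : size (2%:P * 'X * q) = n.+3.
  rewrite -mulrA mul_polyC size_scale ?pnatr_eq0// mulrC size_mulX ?sq//.
  by rewrite -size_poly_gt0 sq.
by rewrite size_polyDl ?s2// size_polyN sp.
Qed.

End ChebyshevPoly.

(** * Chebyshev-Gauss nodes and their Lagrange basis *)

Section ChebyshevNodes.
Variable R : realType.
Implicit Types (t a b x y : R) (n m j k : nat).

Definition cheb_angle m j : R := (2 * j%:R - 1) * pi / (2 * m%:R).

Lemma cheb_nodeE m j : cheb_node R m j = cos (cheb_angle m j).
Proof. by []. Qed.

Lemma mul_cheb_angle m j : (0 < m)%N ->
  m%:R * cheb_angle m j = pi *+ j - pi / 2.
Proof.
move=> m0; rewrite /cheb_angle -mulr_natr.
have : (m%:R : R) != 0 by rewrite pnatr_eq0 -lt0n.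
by move=> mn0; field.
Qed.

Lemma cos_mul_cheb_angle m j : (0 < m)%N -> cos (m%:R * cheb_angle m j) = 0 :> R.
Proof.
move=> m0; rewrite mul_cheb_angle// cosBpihalf -[pi *+ j]add0r.
by rewrite (alternatingn (@sinDpi R)) sin0 mulr0.
Qed.

Lemma sin_mul_cheb_angle m j : (0 < m)%N ->
  sin (m%:R * cheb_angle m j) = - (-1) ^+ j :> R.
Proof.
move=> m0; rewrite mul_cheb_angle// sinBpihalf -[pi *+ j]add0r.
by rewrite (alternatingn (@cosDpi R)) cos0 mulr1.
Qed.

Lemma cheb_angle_gt0 m j : (0 < j)%N -> (0 < m)%N -> 0 < cheb_angle m j.
Proof.
move=> j0 m0; rewrite /cheb_angle divr_gt0 ?mulr_gt0 ?pi_gt0 ?ltr0n//.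
have : (1 : R) <= j%:R by rewrite ler1n.
by lra.
Qed.

Lemma cheb_angle_ltpi m j : (j <= m)%N -> (0 < m)%N -> cheb_angle m j < pi.
Proof.
move=> jm m0; rewrite /cheb_angle ltr_pdivrMr ?mulr_gt0 ?ltr0n//.
rewrite mulrC ltr_pM2l ?pi_gt0//.
have : (j%:R : R) <= m%:R by rewrite ler_nat.
by lra.
Qed.

Lemma cheb_angleB m j k : (0 < m)%N ->
  cheb_angle m k - cheb_angle m j = (k%:R - j%:R) * (pi / m%:R).
Proof.
move=> m0; rewrite /cheb_angle.
have : (m%:R : R) != 0 by rewrite pnatr_eq0 -lt0n.
by move=> mn0; field.
Qed.

Lemma ltr_cheb_angle m j k : (0 < m)%N -> (cheb_angle m j < cheb_angle m k) = (j < k)%N.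
Proof.
move=> m0; rewrite -subr_gt0 cheb_angleB// pmulr_lgt0 ?divr_gt0 ?pi_gt0 ?ltr0n//.
by rewrite subr_gt0 ltr_nat.
Qed.

Lemma cheb_angle_in m j : (0 < j <= m)%N -> cheb_angle m j \in `[0, pi].
Proof.
case/andP => j0 jm; have m0 : (0 < m)%N by exact: leq_trans jm.
by rewrite in_itv/= ltW ?cheb_angle_gt0//= ltW// cheb_angle_ltpi.
Qed.

Lemma sin_cheb_angle_gt0 m j : (0 < j <= m)%N -> 0 < sin (cheb_angle m j).
Proof.
case/andP => j0 jm; have m0 : (0 < m)%N by exact: leq_trans jm.
by rewrite sin_gt0_pi// cheb_angle_gt0//= cheb_angle_ltpi.
Qed.

(** The cosine decreases on [[0, pi]], so the nodes are numbered from right to left. *)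
Lemma ltr_cheb_node m j k : (0 < j <= m)%N -> (0 < k <= m)%N ->
  (cheb_node R m j < cheb_node R m k) = (k < j)%N.
Proof.
move=> jm km; rewrite !cheb_nodeE ltr_cos ?cheb_angle_in// ltr_cheb_angle//.
by case/andP: jm; exact: leq_trans.
Qed.

Lemma cheb_node_inj m j k : (0 < j <= m)%N -> (0 < k <= m)%N ->
  cheb_node R m j = cheb_node R m k -> j = k.
Proof.
move=> jm km e; have [jk|kj|//] := ltngtP j k.
  by move: jk; rewrite -(ltr_cheb_node km jm) e ltxx.
by move: kj; rewrite -(ltr_cheb_node jm km) e ltxx.
Qed.

Let nodes m := [seq cheb_node R m i | i <- index_iota 1 m.+1].

Let mem_iota1 m i : i \in index_iota 1 m.+1 = (0 < i <= m)%N.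
Proof. by rewrite mem_index_iota ltnS. Qed.

Let uniq_nodes m : uniq (nodes m).
Proof.
rewrite map_inj_in_uniq ?iota_uniq// => i j; rewrite !mem_iota1.
exact: cheb_node_inj.
Qed.

(** The [m] nodes are distinct roots of a polynomial of degree [m], hence all of its roots. *)
Lemma cheb_prod m : (0 < m)%N ->
  cheb R m = lead_coef (cheb R m) *: \prod_(1 <= i < m.+1) ('X - (cheb_node R m i)%:P).
Proof.
move=> m0; rewrite -(big_map (cheb_node R m) predT (fun z => 'X - z%:P)).
apply: all_roots_prod_XsubC.
- by rewrite size_cheb size_map size_iota subn1.
- apply/allP => z /mapP[i]; rewrite mem_iota1 => im ->.
  by rewrite rootE cheb_nodeE horner_cheb cos_mul_cheb_angle.
- by rewrite uniq_rootsE uniq_nodes.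
Qed.

Lemma lead_coef_cheb_neq0 m : lead_coef (cheb R m) != 0.
Proof. by rewrite lead_coef_eq0 -size_poly_gt0 size_cheb. Qed.

Definition lagrange_poly m j : {poly R} :=
  \prod_(1 <= i < m.+1 | i != j)
    ((cheb_node R m j - cheb_node R m i)^-1 *: ('X - (cheb_node R m i)%:P)).

Lemma horner_lagrange_poly m j x :
  (lagrange_poly m j).[x] = lagrange_basis m j x.
Proof.
rewrite /lagrange_poly /lagrange_basis horner_prod; apply: eq_bigr => i _.
by rewrite !hornerE mulrC.
Qed.

Lemma lagrange_basis_node m j k : (0 < j <= m)%N -> (0 < k <= m)%N ->
  lagrange_basis m j (cheb_node R m k) = (k == j)%:R.
Proof.
move=> jm km; rewrite /lagrange_basis; have [->|kj] := eqVneq k j.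
  rewrite big_seq_cond big1// => i /andP[]; rewrite mem_iota1 => im ij.
  rewrite divff// subr_eq0; apply: contra ij => /eqP e.
  by rewrite (cheb_node_inj jm im e).
by rewrite (big_rem k) ?mem_iota1//= kj subrr !mul0r.
Qed.

Lemma size_lagrange_poly m j : (0 < j <= m)%N -> (size (lagrange_poly m j) <= m)%N.
Proof.
move=> jm; rewrite /lagrange_poly -big_filter.
set s := [seq i <- _ | _]; apply: (@leq_trans (size s).+1).
  elim: s => [|a s IH]; first by rewrite big_nil size_poly1.
  rewrite big_cons; apply: leq_trans (size_polyMleq _ _) _.
  set u := _ *: _; have u2 : (size u <= 2)%N.
    by apply: leq_trans (size_scale_leq _ _) _; rewrite size_XsubC.
  by have := leq_add u2 IH; case: (_ + _)%N => //=.
rewrite size_filter; have := count_predC (predC1 j) (index_iota 1 m.+1).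
rewrite size_iota subn1 /= => e; rewrite -[X in (_ <= X)%N]e -addn1 leq_add2l.
rewrite -has_count; apply/hasP; exists j; first by rewrite mem_iota1.
by rewrite /= negbK.
Qed.

(** The difference of the two sides is a polynomial of size at most [m] that vanishes at the [m]
    distinct nodes. *)
Lemma lagrange_exact m (p : {poly R}) x : (size p <= m)%N ->
  \sum_(1 <= j < m.+1) p.[cheb_node R m j] * lagrange_basis m j x = p.[x].
Proof.
move=> sp; pose q := \sum_(1 <= j < m.+1) p.[cheb_node R m j] *: lagrange_poly m j - p.
have q0 : q = 0.
  apply: (@roots_geq_poly_eq0 _ _ (nodes m)).
  - apply/allP => z /mapP[k]; rewrite mem_iota1 => km ->.
    rewrite rootE /q hornerD hornerN horner_sum (bigD1_seq k) ?iota_uniq ?mem_iota1//=.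
    rewrite hornerZ horner_lagrange_poly lagrange_basis_node// eqxx mulr1.
    rewrite big_seq_cond big1 ?addr0 ?subrr// => i; rewrite mem_iota1 => /andP[im ik].
    by rewrite hornerZ horner_lagrange_poly lagrange_basis_node// eq_sym (negbTE ik) mulr0.
  - exact: uniq_nodes.
  - rewrite size_map size_iota subn1 /=; apply: leq_trans (size_polyD _ _) _.
    rewrite geq_max size_polyN sp andbT big_seq.
    apply: (big_ind (fun r : {poly R} => (size r <= m)%N)); first by rewrite size_poly0.
      by move=> r1 r2 h1 h2; apply: leq_trans (size_polyD _ _) _; rewrite geq_max h1.
    move=> i; rewrite mem_iota1 => im.
    by apply: leq_trans (size_scale_leq _ _) _; exact: size_lagrange_poly.
have := congr1 (fun r => r.[x]) q0.
rewrite /q hornerD hornerN horner_sum horner0 => /eqP.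
rewrite subr_eq0 => /eqP <-.
by apply: eq_bigr => i _; rewrite hornerZ horner_lagrange_poly.
Qed.

(* Christoffel form of the Lagrange basis at the zeros of the Chebyshev polynomial *)
Lemma lagrange_basisE m j t : (0 < j <= m)%N -> cos t != cheb_node R m j ->
  lagrange_basis m j (cos t) =
  - (-1) ^+ j * sin (cheb_angle m j) * cos (m%:R * t) /
  (m%:R * (cos t - cheb_node R m j)).
Proof.
move=> jm tj; have m0 : (0 < m)%N by case/andP: jm; exact: leq_trans.
set c := lead_coef (cheb R m).
have c0 : c != 0 by exact: lead_coef_cheb_neq0.
set q := \prod_(1 <= i < m.+1 | i != j) ('X - (cheb_node R m i)%:P).
have Tq : cheb R m = c *: (('X - (cheb_node R m j)%:P) * q).
  rewrite {1}(cheb_prod m0) (bigD1_seq j) ?iota_uniq ?mem_iota1//=.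
have Lq : lagrange_basis m j (cos t) = q.[cos t] / q.[cheb_node R m j].
  rewrite /lagrange_basis /q !horner_prod -prodf_div.
  by apply: eq_bigr => i _; rewrite !hornerE.
have e1 : cos (m%:R * t) = c * ((cos t - cheb_node R m j) * q.[cos t]).
  by rewrite -horner_cheb Tq !hornerE.
(* Differentiating [T_m = c (X - x_j) q] at [x_j] leaves [c q(x_j)], which the trigonometric form of
   the derivative evaluates. *)
have e2 : c * q.[cheb_node R m j] * sin (cheb_angle m j) = m%:R * - (-1) ^+ j.
  rewrite -(@sin_mul_cheb_angle m)// -horner_deriv_cheb Tq.
  rewrite !poly.derivE !hornerE cheb_nodeE.
  by ring.
have s0 : sin (cheb_angle m j) != 0 by rewrite gt_eqF// sin_cheb_angle_gt0.
have sg : (-1) ^+ j * (-1) ^+ j = 1 :> R by rewrite -exprMn mulrNN mulr1 expr1n.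
have sg0 : (-1) ^+ j != 0 :> R by rewrite signr_eq0.
have mn0 : (m%:R : R) != 0 by rewrite pnatr_eq0 -lt0n.
have q0 : q.[cheb_node R m j] = m%:R * - (-1) ^+ j / (c * sin (cheb_angle m j)).
  by rewrite -e2; field; rewrite s0 c0.
rewrite Lq e1 q0.
have : cos t - cheb_node R m j != 0 by rewrite subr_eq0.
move: sg sg0; move: ((-1) ^+ j) (cos t - _) => e d sg sg0 d0.
(* The sign occurs in a denominator on the left only; multiplying that side by its square, which is
   1, turns the goal into a field identity. *)
rewrite -[LHS]mulr1 -sg; field.
by rewrite sg0 mn0 d0 c0 s0.
Qed.
End ChebyshevNodes.

(** * Interpolation of a step function at the Chebyshev nodes *)

Section StepInterpolation.
Variable R : realType.
Implicit Types (t s a b x y u : R) (n m i j k : nat).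

(** Leibniz estimate for terms of increasing size: if the signed partial sum [S] lies in [[0, b_n]],
    the next one is [b_(n+1) - S], which lies in [[0, b_(n+1)]] because [b_n <= b_(n+1)]. *)
Lemma alternating_sum_nondecr (b : nat -> R) i n : (i <= n)%N ->
  (forall k, (i <= k <= n)%N -> 0 <= b k) ->
  (forall k, (i <= k < n)%N -> b k <= b k.+1) ->
  0 <= (-1) ^+ n * \sum_(i <= k < n.+1) (-1) ^+ k * b k <= b n.
Proof.
move=> /subnKC <-; elim: (n - i)%N => [|d IH] b0 bS.
  rewrite addn0 big_nat1 mulrA -exprMn mulrNN mulr1 expr1n mul1r lexx andbT.
  by rewrite b0 ?addn0 ?leqnn.
rewrite addnS big_nat_recr/= ?leqW ?leq_addr// mulrDr [in X in _ + X]mulrA.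
rewrite -[in X in _ + X]exprMn mulrNN mulr1 expr1n mul1r exprS -mulrA mulN1r.
have /andP[h1 h2] : 0 <= (-1) ^+ (i + d) *
    (\sum_(i <= k < (i + d).+1) (-1) ^+ k * b k) <= b (i + d)%N.
  apply: IH => k /andP[ik kd]; first by rewrite b0// ik addnS leqW.
  by rewrite bS// ik addnS (leq_trans kd).
have h3 : b (i + d)%N <= b (i + d).+1 by rewrite bS// leq_addr addnS /=.
by lra.
Qed.

(** The mirror image for decreasing terms: the induction is on the length and splits off the first
    term, which now fixes the sign. *)
Lemma alternating_sum_nonincr (b : nat -> R) i n :
  (forall k, (i <= k < n)%N -> 0 <= b k) ->
  (forall k, (i <= k)%N -> (k.+1 < n)%N -> b k.+1 <= b k) ->
  (i < n)%N ->
  0 <= (-1) ^+ i * \sum_(i <= k < n) (-1) ^+ k * b k <= b i.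
Proof.
move=> b0 bS i_n; move: b0 bS (i_n); rewrite -(subnK (ltnW i_n)).
move: (n - i)%N => {n i_n} d.
elim: d i => [|d IH] i b0 bS id0; first by rewrite ltnn in id0.
rewrite big_ltn// mulrDr mulrA -exprMn mulrNN mulr1 expr1n mul1r.
have -> : (-1) ^+ i = - (-1) ^+ i.+1 :> R by rewrite exprS mulN1r opprK.
have bi : 0 <= b i by rewrite b0// leqnn.
case: d IH b0 bS id0 => [|d] IH b0 bS id0.
  by rewrite big_geq ?add1n// mulr0 addr0 lexx bi.
have /andP[h1 h2] : 0 <= (-1) ^+ i.+1 * \sum_(i.+1 <= k < d.+2 + i) (-1) ^+ k * b k <= b i.+1.
  rewrite (_ : (d.+2 + i)%N = (d.+1 + i.+1)%N); last by rewrite addSnnS.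
  apply: IH.
  - by move=> k /andP[ik kd]; rewrite b0// (ltnW ik) addSnnS.
  - by move=> k ik kd; rewrite bS// ?(ltnW ik)// addSnnS.
  - by rewrite addSn ltnS leq_addl.
have h3 : b i.+1 <= b i by rewrite bS// !addSn !ltnS leq_addl.
by lra.
Qed.

Lemma normr_sin_mul_le n a : `|sin (n%:R * a)| <= n%:R * `|sin a|.
Proof.
elim: n => [|n IH]; first by rewrite !mul0r sin0 normr0.
rewrite sin_mulS; apply: le_trans (ler_normD _ _) _.
rewrite !normrM -natr1 mulrDl mul1r lerD//.
  by apply: le_trans IH; rewrite ler_piMr// cos_max.
by rewrite ler_piMl// cos_max.
Qed.

Lemma cosB_prod s t : cos s - cos t = 2 * sin ((t - s) / 2) * sin ((t + s) / 2).
Proof.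
suff H a b : cos (b - a) - cos (b + a) = 2 * sin a * sin b.
  by rewrite -H; congr (cos _ - cos _); field.
by rewrite cosB cosD; ring.
Qed.

(** With [a] and [b] the half difference and half sum, [sin^2 b - sin^2 a = sin s sin t >= 0], so
    [|sin a| <= sin b] and [sin t = sin (a + b) <= 2 sin b]; the product formula
    [|cos s - cos t| = 2 |sin a| sin b] concludes. *)
Lemma sin_le_cosB s t : 0 <= s <= pi -> 0 <= t <= pi ->
  sin t * `|sin ((t - s) / 2)| <= `|cos s - cos t|.
Proof.
move=> /andP[s0 sp] /andP[t0 tp].
rewrite cosB_prod !normrM mulrAC ger0_norm// ler_wpM2r//.
set a := (t - s) / 2; set b := (t + s) / 2.
have sb : 0 <= sin b by rewrite sin_ge0_pi// /b; apply/andP; split; lra.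
have e : t = b + a by rewrite /a /b; field.
have e' : s = b - a by rewrite /a /b; field.
have h : `|sin a| <= sin b.
  rewrite -(@ler_pXn2r _ 2)// ?nnegrE// real_normK ?num_real//.
  rewrite -subr_ge0; have -> : sin b ^+ 2 - sin a ^+ 2 = sin t * sin s.
    by rewrite e e' sinD sinB; ring: (cos2sin2 a) (cos2sin2 b).
  by rewrite mulr_ge0// sin_ge0_pi// ?t0 ?s0.
rewrite (ger0_norm sb) {1}e sinD.
have h1 : sin b * cos a <= sin b by rewrite ler_piMr// cos_le1.
have h2 : cos b * sin a <= sin b.
  apply: le_trans (ler_norm _) _; rewrite normrM; apply: le_trans h.
  by rewrite ler_piMl// cos_max.
by lra.
Qed.

(** The inequality is linear in [x], so [x = 1] and [x = -1] suffice; there the difference of the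
    two sides is [4 sin (s/2) sin (t/2) sin ((t - s)/2)], respectively the same with cosines in the
    first two factors. *)
Lemma sin_cos_mono s t x : 0 <= s -> s <= t -> t <= pi -> -1 <= x <= 1 ->
  x * (sin t - sin s) <= sin (t - s).
Proof.
move=> s0 st tp /andP[x1 x2].
have half y : y = y / 2 *+ 2 by rewrite -mulr_natr divfK.
have pos y : 0 <= y <= pi / 2 -> 0 <= sin y.
  by move=> /andP[y0 yp]; rewrite sin_ge0_pi// y0/= (le_trans yp)// ; have := @pi_ge0 R; lra.
have s2 : 0 <= sin (s / 2) by apply: pos; apply/andP; split; lra.
have t2 : 0 <= sin (t / 2) by apply: pos; apply/andP; split; lra.
have ts2 : 0 <= sin ((t - s) / 2) by apply: pos; apply/andP; split; lra.
have cs2 : 0 <= cos (s / 2) by apply: cos_ge0_pihalf; apply/andP; split; lra.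
have ct2 : 0 <= cos (t / 2) by apply: cos_ge0_pihalf; apply/andP; split; lra.
have E : sin ((t - s) / 2) = sin (t / 2) * cos (s / 2) - cos (t / 2) * sin (s / 2).
  by rewrite mulrBl sinB.
have h1 : 0 <= sin (t - s) - (sin t - sin s).
  have -> : sin (t - s) - (sin t - sin s) = 4 * (sin (s / 2) * sin (t / 2) * sin ((t - s) / 2)).
    rewrite E sinB (half t) (half s) !sin_mulr2n !cos_mulr2n -!(half t) -!(half s).
    by ring: (cos2sin2 (t / 2)) (cos2sin2 (s / 2)).
  by rewrite !mulr_ge0.
have h2 : 0 <= sin (t - s) + (sin t - sin s).
  have -> : sin (t - s) + (sin t - sin s) = 4 * (cos (s / 2) * cos (t / 2) * sin ((t - s) / 2)).
    rewrite E sinB (half t) (half s) !sin_mulr2n !cos_mulr2n -!(half t) -!(half s).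
    by ring: (cos2sin2 (t / 2)) (cos2sin2 (s / 2)).
  by rewrite !mulr_ge0.
by nra.
Qed.

(** The [H_m(u)] of the overview: the error at [x] when the indicator of [[u, oo)] is
    interpolated. *)
Definition step_interp m x u : R :=
  \sum_(1 <= j < m.+1) (u <= cheb_node R m j)%R%:R * lagrange_basis m j x - (u <= x)%R%:R.

Lemma sum_lagrange_basis m x : (0 < m)%N ->
  \sum_(1 <= j < m.+1) lagrange_basis m j x = 1 :> R.
Proof.
move=> m0; rewrite -[RHS](hornerC 1 x) -(@lagrange_exact _ m) ?size_polyC ?oner_neq0//.
by apply: eq_bigr => i _; rewrite hornerC mul1r.
Qed.

(** The Christoffel form gives the second bound at once. For the first, with [x = cos t], [|cos (m
    t)| = |sin (m (t_j - t))| <= 2 m |sin ((t_j - t) / 2)|], and [sin_le_cosB] compares this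
    half-angle sine with [x - x_j]. *)
Lemma normr_lagrange_basis_le m j x : (0 < j <= m)%N -> -1 <= x <= 1 ->
  x != cheb_node R m j ->
  `|lagrange_basis m j x| <= 2 /\
  `|lagrange_basis m j x| * (m%:R * `|x - cheb_node R m j|) <= 1.
Proof.
move=> jm x1 xj; have m0 : (0 < m)%N by case/andP: jm; exact: leq_trans.
have mr0 : 0 < m%:R :> R by rewrite ltr0n.
have [/andP[t0 tp] tx] := acos_def x1.
set t := acos x in t0 tp tx; rewrite -tx in xj *.
have d0 : 0 < `|cos t - cheb_node R m j| by rewrite normr_gt0 subr_eq0.
have E : `|lagrange_basis m j (cos t)| * (m%:R * `|cos t - cheb_node R m j|) =
    sin (cheb_angle R m j) * `|cos (m%:R * t)|.
  rewrite lagrange_basisE// !normrM normfV normrM normrN normrX normrN1 expr1n mul1r.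
  rewrite (ger0_norm (ltW (sin_cheb_angle_gt0 R jm))) (ger0_norm (ltW mr0)).
  by rewrite divfK// mulf_neq0// gt_eqF.
split; last first.
  rewrite E mulr_ile1// ?sin_le1// ?cos_max// ltW// sin_cheb_angle_gt0//.
set tj := cheb_angle R m j in E *.
have := cheb_angle_in R jm; rewrite in_itv/= => tjI.
have h1 : sin tj * `|sin ((tj - t) / 2)| <= `|cos t - cheb_node R m j|.
  by rewrite cheb_nodeE; apply: sin_le_cosB => //; rewrite t0.
have h2 : `|cos (m%:R * t)| <= (2 * m)%:R * `|sin ((tj - t) / 2)|.
  apply: le_trans (normr_sin_mul_le _ _).
  have -> : (2 * m)%:R * ((tj - t) / 2) = m%:R * tj - m%:R * t.
    by rewrite natrM; field.
  rewrite sinB cos_mul_cheb_angle// mul0r subr0 sin_mul_cheb_angle//.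
  by rewrite normrM normrN normrX normrN1 expr1n mul1r.
have dm : 0 < m%:R * `|cos t - cheb_node R m j| by rewrite mulr_gt0.
rewrite -(ler_pM2r dm) E.
apply: le_trans (ler_wpM2l (ltW (sin_cheb_angle_gt0 R jm)) h2) _.
rewrite mulrCA natrM -mulrA ler_wpM2l// ler_wpM2l//.
Qed.

(** Nodes decrease with the index, so those at or above [u] form an initial segment [1, ..., J]. *)
Lemma cheb_cut m u : exists2 J, (J <= m)%N &
  forall j, (0 < j <= m)%N -> (u <= cheb_node R m j) = (j <= J)%N.
Proof.
suff H k : (k <= m)%N -> exists2 J, (J <= k)%N &
    forall j, (0 < j <= k)%N -> (u <= cheb_node R m j) = (j <= J)%N by exact: H.
elim: k => [_|k IH km]; first by exists 0%N => // -[].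
have [J Jk HJ] := IH (ltnW km).
have [uk|uk] := leP u (cheb_node R m k.+1).
  exists k.+1 => // j /andP[j0 jk]; rewrite jk; move: jk.
  rewrite leq_eqVlt => /predU1P[->//|jk]; rewrite (le_trans uk)// ltW//.
  by rewrite ltr_cheb_node ?km// j0 (leq_trans (ltnW jk)).
exists J => [|j /andP[j0]]; first exact: leqW.
rewrite leq_eqVlt => /predU1P[->|jk]; last by rewrite HJ// j0.
by rewrite leNgt uk ltnNge Jk.
Qed.

(* Consecutive basis polynomials alternate in sign and their absolute values are monotone on
   either side of [x], so a partial sum is controlled by its last term. *)
Lemma normr_step_interp_le m x u : (0 < m)%N -> -1 <= x <= 1 ->
  `|step_interp m x u| <= 2 /\ `|step_interp m x u| * (m%:R * `|x - u|) <= 1.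
Proof.
move=> m0 x1.
(* At a node the interpolant is exact and the error vanishes; afterwards every [x - x_j] is
   nonzero. *)
have [[k km xk]|xn] := pselect (exists2 k, (0 < k <= m)%N & x = cheb_node R m k).
  suff -> : step_interp m x u = 0 by rewrite normr0 mul0r ler0n ler01.
  rewrite /step_interp (bigD1_seq k) ?iota_uniq ?mem_index_iota//=.
  rewrite xk lagrange_basis_node// eqxx mulr1 big_seq_cond big1 ?addr0 ?subrr// => i.
  rewrite mem_index_iota ltnS => /andP[im ik].
  by rewrite lagrange_basis_node// eq_sym (negbTE ik) mulr0.
have xnode j : (0 < j <= m)%N -> x != cheb_node R m j.
  by move=> jm; apply/eqP => e; apply: xn; exists j.
(* A single node [j] on the far side of [u], seen from [x], gives both bounds, through those on its
   basis polynomial. *)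
have key j : (0 < j <= m)%N -> `|step_interp m x u| <= `|lagrange_basis m j x| ->
    `|x - u| <= `|x - cheb_node R m j| ->
    `|step_interp m x u| <= 2 /\ `|step_interp m x u| * (m%:R * `|x - u|) <= 1.
  move=> jm h1 h2; have [h3 h4] := normr_lagrange_basis_le jm x1 (xnode j jm).
  split; first exact: le_trans h3.
  apply: le_trans h4; rewrite ler_pM// ?mulr_ge0// ler_wpM2l//.
have [/andP[t0 tp] tx] := acos_def x1.
set t := acos x in t0 tp tx.
(* Moduli of the Christoffel terms: [L_j(x) = c (-1)^j b_j] for nodes to the right of [x], and the
   opposite for nodes to the left. *)
pose b j := sin (cheb_angle R m j) / `|x - cheb_node R m j|.
pose c := cos (m%:R * t) / m%:R.
have b_ge0 j : (0 < j <= m)%N -> 0 <= b j.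
  by move=> jm; rewrite /b divr_ge0// ltW// sin_cheb_angle_gt0.
have Lr j : (0 < j <= m)%N -> x < cheb_node R m j ->
    lagrange_basis m j x = c * ((-1) ^+ j * b j).
  move=> jm xj; rewrite -{1}tx lagrange_basisE ?tx ?xnode// /b /c.
  rewrite ltr0_norm ?subr_lt0//; field.
  by rewrite pnatr_eq0 -lt0n m0 !subr_eq0 xnode.
have Ll j : (0 < j <= m)%N -> cheb_node R m j < x ->
    lagrange_basis m j x = - c * ((-1) ^+ j * b j).
  move=> jm xj; rewrite -{1}tx lagrange_basisE ?tx ?xnode// /b /c.
  rewrite gtr0_norm ?subr_gt0//; field.
  by rewrite pnatr_eq0 -lt0n m0 !subr_eq0 xnode.
(* Cross-multiplied, the comparison of [b_j] with [b_(j+1)] is this inequality for consecutive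
   indices, on either side of [x]. *)
have mono j k : (0 < j)%N -> (j <= k)%N -> (k <= m)%N ->
    x * (sin (cheb_angle R m k) - sin (cheb_angle R m j)) <=
    sin (cheb_angle R m k - cheb_angle R m j).
  move=> j0 jk km; have jm : (0 < j <= m)%N by rewrite j0 (leq_trans jk).
  have k0 : (0 < k <= m)%N by rewrite km (leq_trans j0).
  apply: sin_cos_mono => //.
  - by have := cheb_angle_in R jm; rewrite in_itv/= => /andP[].
  - move: jk; rewrite leq_eqVlt => /predU1P[->//|jk].
    by rewrite ltW// ltr_cheb_angle.
  - by have := cheb_angle_in R k0; rewrite in_itv/= => /andP[].
have br j : (0 < j)%N -> (j.+1 <= m)%N -> x < cheb_node R m j.+1 -> b j <= b j.+1.
  move=> j0 jm xj; have xj' : x < cheb_node R m j.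
    by rewrite (lt_trans xj)// ltr_cheb_node ?j0 ?jm// ltnW.
  rewrite /b !ltr0_norm ?subr_lt0// ler_pdivrMr ?oppr_gt0 ?subr_lt0//.
  rewrite mulrAC ler_pdivlMr ?oppr_gt0 ?subr_lt0//.
  have := mono j j.+1 j0 (leqnSn _) jm; rewrite sinB !cheb_nodeE; lra.
have bl j : (0 < j)%N -> (j.+1 <= m)%N -> cheb_node R m j < x -> b j.+1 <= b j.
  move=> j0 jm xj; have xj' : cheb_node R m j.+1 < x.
    by rewrite (lt_trans _ xj)// ltr_cheb_node ?j0 ?jm// ltnW.
  rewrite /b !gtr0_norm ?subr_gt0// ler_pdivrMr ?subr_gt0//.
  rewrite mulrAC ler_pdivlMr ?subr_gt0//.
  have := mono j j.+1 j0 (leqnSn _) jm; rewrite sinB !cheb_nodeE; lra.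
have [J Jm HJ] := cheb_cut m u.
have SJ : step_interp m x u = \sum_(1 <= j < J.+1) lagrange_basis m j x - (u <= x)%R%:R.
  rewrite /step_interp; congr (_ - _).
  have e0 : \sum_(J.+1 <= j < m.+1) (u <= cheb_node R m j)%R%:R * lagrange_basis m j x = 0.
    rewrite big_nat_cond big1// => j; rewrite ltnS andbT => /andP[Jj jm].
    by rewrite HJ ?(leq_trans _ Jj)//= leqNgt Jj mul0r.
  rewrite (@big_cat_nat _ _ _ J.+1)//= e0 addr0 big_nat_cond [RHS]big_nat_cond.
  apply: eq_bigr => j; rewrite ltnS andbT => /andP[j0 jJ].
  by rewrite HJ ?jJ ?mul1r// j0 (leq_trans jJ).
have sgn n : `|(-1) ^+ n| = 1 :> R by rewrite normrX normrN1 expr1n.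
have [ux|xu] := leP u x; last first.
  have {}SJ : step_interp m x u = c * \sum_(1 <= j < J.+1) (-1) ^+ j * b j.
    rewrite SJ leNgt xu subr0 mulr_sumr big_nat_cond [RHS]big_nat_cond.
    apply: eq_bigr => j; rewrite ltnS andbT => /andP[j0 jJ].
    rewrite Lr// ?j0 ?(leq_trans jJ)// (lt_le_trans xu)// HJ// j0.
    by rewrite (leq_trans jJ).
  have [J0|J0] := posnP J.
    by rewrite SJ J0 big_geq// mulr0 normr0 mul0r ler0n ler01.
  have JJ : (0 < J <= m)%N by rewrite J0.
  have xJ : u <= cheb_node R m J by rewrite HJ.
  have xJ' : x < cheb_node R m J by exact: lt_le_trans xJ.
  apply: (key J) => //.
    rewrite SJ Lr// normrM [leRHS]normrM ler_wpM2l// [leRHS]normrM sgn mul1r [leRHS]ger0_norm ?b_ge0//.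
    have /andP[h1 h2] : 0 <= (-1) ^+ J * \sum_(1 <= k < J.+1) (-1) ^+ k * b k <= b J.
      apply: alternating_sum_nondecr => // k /andP[k1 kJ].
        by rewrite b_ge0// k1 (leq_trans kJ).
      apply: br => //; first by rewrite (leq_trans kJ).
      by rewrite (lt_le_trans xu)// HJ ?kJ// (leq_trans kJ).
    by move: h2; rewrite -(ger0_norm h1) normrM sgn mul1r.
  by rewrite !ltr0_norm ?subr_lt0//; lra.
(* For [u <= x] the counted nodes may lie on both sides of [x]. As the [L_j(x)] sum to 1, the error
   is minus the sum over the remaining nodes, which are all below [u] and hence to the left of
   [x]. *)
have {}SJ : step_interp m x u = c * \sum_(J.+1 <= j < m.+1) (-1) ^+ j * b j.
  have := sum_lagrange_basis x m0; rewrite (@big_cat_nat _ _ _ J.+1 1 m.+1)//= => e.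
  transitivity (- \sum_(J.+1 <= j < m.+1) lagrange_basis m j x).
    by rewrite SJ ux (_ : true%:R = 1 :> R)//; lra.
  rewrite -sumrN mulr_sumr big_nat_cond [RHS]big_nat_cond.
  apply: eq_bigr => j; rewrite ltnS andbT => /andP[Jj jm].
  have jm' : (0 < j <= m)%N by rewrite jm (leq_trans _ Jj).
  by rewrite Ll// ?mulNr ?opprK// (lt_le_trans _ ux)// ltNge HJ// -ltnNge.
have [mJ|Jm'] := leqP m J.
  by rewrite SJ big_geq ?ltnS// mulr0 normr0 mul0r ler0n ler01.
have JJ : (0 < J.+1 <= m)%N by [].
have xJ : cheb_node R m J.+1 < u by rewrite ltNge HJ// -ltnNge.
have xJ' : cheb_node R m J.+1 < x by exact: lt_le_trans ux.
apply: (key J.+1) => //.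
  rewrite SJ Ll// mulNr normrN normrM [leRHS]normrM ler_wpM2l// [leRHS]normrM sgn mul1r [leRHS]ger0_norm ?b_ge0//.
  have /andP[h1 h2] : 0 <= (-1) ^+ J.+1 * \sum_(J.+1 <= k < m.+1) (-1) ^+ k * b k <= b J.+1.
    apply: alternating_sum_nonincr => //.
    - by move=> k /andP[k1 kJ]; rewrite b_ge0// (leq_trans _ k1).
    - move=> k Jk km; have k0 : (0 < k)%N by exact: leq_trans Jk.
      apply: bl => //; rewrite (lt_le_trans _ ux)// ltNge HJ -?ltnNge// k0.
      by rewrite ltnW.
  by move: h2; rewrite -(ger0_norm h1) normrM sgn mul1r.
by rewrite !ger0_norm ?subr_ge0//; lra.
Qed.
End StepInterpolation.

(** * Interpolation error for C^2 functions *)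

Section SecondDifference.
Variable R : realType.
Implicit Types (f g : R -> R) (t x y a b : R).

Lemma is_derive_continuous f t d : is_derive t 1 f d -> {for t, continuous f}.
Proof. by move=> h; apply/differentiable_continuous/derivable1_diffP; exact: ex_derive. Qed.

Lemma MVT_closed f df a b : a <= b ->
  (forall x, a <= x <= b -> is_derive x 1 f (df x)) ->
  exists2 c, a <= c <= b & f b - f a = df c * (b - a).
Proof.
move=> ab fd; have [||c cab E] := @MVT_segment _ f df a b ab.
- by move=> x; rewrite in_itv/= => /andP[x1 x2]; apply: fd; rewrite !ltW.
- apply: derivable_within_continuous => x; rewrite in_itv/= => xab.
  by apply: ex_derive; exact: fd.
- by exists c => //; move: cab; rewrite in_itv.
Qed.

(** The mean value theorem twice: for [f (s + d) - f s] on [[t - d, t]], then for [f1] on an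
    interval of length [d]. *)
Lemma second_diff_le f f1 f2 t (d C : R) : 0 <= d ->
  (forall y, t - d <= y <= t + d -> is_derive y 1 f (f1 y)) ->
  (forall y, t - d <= y <= t + d -> is_derive y 1 f1 (f2 y)) ->
  (forall y, t - d <= y <= t + d -> `|f2 y| <= C) ->
  `|f (t + d) + f (t - d) - 2 * f t| <= C * d ^+ 2.
Proof.
move=> d0 fd f1d f2C; pose k s := f (s + d) - f s.
have kd s : t - d <= s <= t -> is_derive s 1 k (f1 (s + d) - f1 s).
  move=> /andP[s1 s2]; apply: is_deriveB; last by apply: fd; rewrite s1/=; lra.
  have fsd : is_derive (s + d) 1 f (f1 (s + d)) by apply: fd; apply/andP; split; lra.
  have := @is_derive1_comp _ f (fun y => y + d) s (f1 (s + d)) 1 fsd.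
  by rewrite mulr1; apply; apply: is_derive_eq; rewrite addr0.
have [|c /andP[c1 c2] E] := @MVT_closed k _ (t - d) t _ kd; first by rewrite lerBlDr lerDl.
have [|y /andP[y1 y2]|e /andP[e1 e2] E'] := @MVT_closed f1 f2 c (c + d).
- by rewrite lerDl.
- by apply: f1d; apply/andP; split; lra.
have -> : f (t + d) + f (t - d) - 2 * f t = f2 e * d ^+ 2.
  rewrite (_ : f (t + d) + f (t - d) - 2 * f t = k t - k (t - d)); last first.
    by rewrite /k subrK; ring.
  rewrite E E'; ring.
rewrite normrM [X in _ * X]ger0_norm ?sqr_ge0// ler_wpM2r ?sqr_ge0//.
by apply: f2C; apply/andP; split; lra.
Qed.

(** Through the half angle [b = a / 2]: [sin x - x cos x] has derivative [x sin x >= 0], so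
    [sin b >= b cos b], and [sin a = 2 sin b cos b >= 2 b cos^2 b >= b] because [cos^2 b >= 1/2]. *)
Lemma sin_ge_half a : 0 <= a <= pi / 2 -> a / 2 <= sin a.
Proof.
move=> /andP[a0 ap]; set b := a / 2.
have b0 : 0 <= b by rewrite /b; lra.
have bp : b <= pi / 4 by rewrite /b; lra.
pose g x : R := sin x - x * cos x.
have gd x : 0 <= x <= b -> is_derive x 1 g (x * sin x).
  move=> _; rewrite /g; apply: is_derive_eq.
  by rewrite /GRing.scale/=; ring.
have [c /andP[c0 cb]] := @MVT_closed g _ 0 b b0 gd.
rewrite /g sin0 mul0r !subr0 => E.
have pi0 := @pi_gt0 R.
have h1 : b * cos b <= sin b.
  rewrite -subr_ge0 E !mulr_ge0// sin_ge0_pi//; apply/andP; split; lra.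
have cb0 : 0 <= cos b by apply: cos_ge0_pihalf; apply/andP; split; lra.
have h2 : 1 / 2 <= cos b ^+ 2.
  have : 0 <= cos a by apply: cos_ge0_pihalf; apply/andP; split; lra.
  have -> : a = b *+ 2 by rewrite -mulr_natr /b; field.
  rewrite cos_mulr2n -mulr_natr; lra.
rewrite -/b; have -> : a = b *+ 2 by rewrite -mulr_natr /b; field.
rewrite sin_mulr2n -mulr_natr.
by nra.
Qed.

Lemma normr_cosB_le a b : `|cos a - cos b| <= `|a - b|.
Proof.
wlog ab : a b / a <= b.
  move=> H; have [|/ltW] := leP a b; first exact: H.
  by move=> ba; rewrite distrC [leRHS]distrC; exact: H.
have [c _ E] := @MVT_closed (@cos R) (fun x => - sin x) a b ab (fun x _ => is_derive_cos x).
rewrite distrC [leRHS]distrC E normrM ler_piMl// normrN; exact: sin_max.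
Qed.

Lemma sin_le_id a : 0 <= a -> sin a <= a.
Proof.
move=> a0; have [c _ E] := @MVT_closed (@sin R) cos 0 a a0 (fun x _ => is_derive_sin x).
move: E; rewrite sin0 !subr0 => ->; by rewrite ler_piMl// cos_le1.
Qed.

Lemma harmonic_le_ln n : (0 < n)%N -> \sum_(0 <= k < n) k.+1%:R^-1 <= 1 + ln n%:R :> R.
Proof.
elim: n => // -[_ _|n IH _]; first by rewrite big_nat1 invr1 ln1 addr0.
rewrite big_nat_recr//=; apply: le_trans (lerD (IH isT) (lexx _)) _.
rewrite -addrA lerD2l.
have n1 : (0 : R) < n.+1%:R by rewrite ltr0n.
have n2 : (0 : R) < n.+2%:R by rewrite ltr0n.
have : ln (1 + - n.+2%:R^-1 : R) <= - n.+2%:R^-1.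
  by apply: le_ln1Dx; rewrite ltrN2 invf_lt1// ltr1n.
have -> : 1 + - n.+2%:R^-1 = n.+1%:R / n.+2%:R :> R.
  have : (n.+2%:R : R) != 0 by rewrite gt_eqF.
  by rewrite -[n.+2%:R]natr1 => h; field.
by rewrite ln_div ?posrE//; move: (ln _) (ln _) (_ ^-1) => u v w h; lra.
Qed.

(** Splitting at [J] leaves two harmonic sums, each at most [1 + ln n]. *)
Lemma sum_invr_dist_le n J : (0 < n)%N -> (J <= n)%N ->
  \sum_(0 <= j < n) (1 + `|j%:R - J%:R|)^-1 <= 2 * (1 + ln n%:R) :> R.
Proof.
move=> n0 Jn; rewrite (@big_cat_nat _ _ _ J)//= mulrDl mul1r.
have hle k : (k <= n)%N -> \sum_(0 <= i < k) i.+1%:R^-1 <= 1 + ln n%:R :> R.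
  move=> kn; apply: le_trans (harmonic_le_ln n0).
  rewrite (@big_cat_nat _ _ _ k 0 n)//= lerDl; apply: sumr_ge0 => i _.
  by rewrite invr_ge0 ler0n.
apply: lerD.
  apply: le_trans (hle J Jn); rewrite big_nat_rev/= big_nat [leRHS]big_nat.
  apply: ler_sum => i /= iJ; rewrite add0n lef_pV2 ?posrE ?ltr0n ?ltr_pwDl//.
  rewrite natrB// addrAC subrr add0r normrN ger0_norm// -[X in X <= _]natr1.
  by rewrite addrC lerD2l -natr1; lra.
rewrite -{1}[J]add0n big_addn; apply: le_trans (hle (n - J)%N (leq_subr _ _)).
apply: ler_sum => i _; rewrite natrD addrK ger0_norm// lef_pV2 ?posrE ?ltr0n ?ltr_pwDl//.
by rewrite -natr1 addrC.
Qed.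
End SecondDifference.

(** * Lagrange interpolation error under a bounded second derivative *)

Section ChebyshevBias.
Variables (R : realType) (F g1 g2 : R -> R) (C : R).
Hypothesis dF : forall y : R, -1 < y < 1 -> is_derive y 1 F (g1 y).
Hypothesis dg1 : forall y : R, -1 < y < 1 -> is_derive y 1 g1 (g2 y).
Hypothesis g2C : forall y : R, -1 <= y <= 1 -> `|g2 y| <= C.
Hypothesis cF : {within `[-1, 1], continuous F}.
Hypothesis cg1 : {within `[-1, 1], continuous g1}.
Implicit Types (x y t th s : R) (m j k : nat).

Let C_ge0 : 0 <= C.
Proof. by apply: le_trans (g2C (y := 0) _); rewrite ?normr_ge0//; apply/andP; split; lra. Qed.

(** Derivatives are available inside [[-1, 1]] only; continuity up to the ends extends the mean
    value theorem to all pairs of points, in either order. *)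
Let MVT_in (f df : R -> R) x y :
  (forall z : R, -1 < z < 1 -> is_derive z 1 f (df z)) -> {within `[-1, 1], continuous f} ->
  -1 <= x <= 1 -> -1 <= y <= 1 ->
  exists2 c, -1 <= c <= 1 /\ `|c - x| <= `|y - x| & f y - f x = df c * (y - x).
Proof.
move=> fd cf; have key a b : -1 <= a -> a <= b -> b <= 1 ->
    exists2 c, a <= c <= b & f b - f a = df c * (b - a).
  move=> a1 ab b1; have [||c cab E] := @MVT_segment _ f df a b ab.
  - by move=> z; rewrite in_itv/= => /andP[z1 z2]; apply: fd; apply/andP; split; lra.
  - apply: continuous_subspaceW cf => z /=; rewrite !in_itv/= => /andP[z1 z2].
    by apply/andP; split; lra.
  - by exists c => //; move: cab; rewrite in_itv.
move=> /andP[x1 x2] /andP[y1 y2].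
have [xy|/ltW yx] := leP x y.
  have [c /andP[c1 c2] E] := key x y x1 xy y2.
  exists c => //; split; first by apply/andP; split; lra.
  by rewrite !ger0_norm ?subr_ge0//; lra.
have [c /andP[c1 c2] E] := key y x y1 yx x2.
exists c; last by rewrite -opprB E -mulrN opprB.
split; first by apply/andP; split; lra.
by rewrite !ler0_norm ?subr_le0//; lra.
Qed.

Let g1_lip x y : -1 <= x <= 1 -> -1 <= y <= 1 -> `|g1 y - g1 x| <= C * `|y - x|.
Proof.
move=> xI yI; have [c [cI _] ->] := MVT_in dg1 cg1 xI yI.
by rewrite normrM ler_wpM2r// g2C.
Qed.

Let remainder x y := F y - F x - g1 x * (y - x).

Let remainder_le x y : -1 <= x <= 1 -> -1 <= y <= 1 ->
  `|remainder x y| <= C * `|y - x| ^+ 2.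
Proof.
move=> xI yI; rewrite /remainder; have [c [cI cx] ->] := MVT_in dF cF xI yI.
rewrite -mulrBl normrM expr2 mulrA ler_wpM2r//.
by apply: le_trans (g1_lip xI cI) _; rewrite ler_wpM2l.
Qed.

(** Up to sign and a common factor, [W x] at the j-th angle is the j-th term of the error in
    Christoffel form once the tangent line at [x] has been subtracted from [F]. [W1] and [W2] are
    its first two derivatives in [t], as the rules produce them. *)
Let W x t := sin t * remainder x (cos t) / (x - cos t).
Let W1 x t := cos t * remainder x (cos t) / (x - cos t)
  - sin t ^+ 2 * (g1 (cos t) - g1 x) / (x - cos t)
  - sin t ^+ 2 * remainder x (cos t) / (x - cos t) ^+ 2.
Let W2 x t := (- sin t * remainder x (cos t) / (x - cos t)
   - cos t * sin t * (g1 (cos t) - g1 x) / (x - cos t)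
   - cos t * sin t * remainder x (cos t) / (x - cos t) ^+ 2)
  - (2 * sin t * cos t * (g1 (cos t) - g1 x) / (x - cos t)
   - sin t ^+ 3 * g2 (cos t) / (x - cos t)
   - sin t ^+ 3 * (g1 (cos t) - g1 x) / (x - cos t) ^+ 2)
  - (2 * sin t * cos t * remainder x (cos t) / (x - cos t) ^+ 2
   - sin t ^+ 3 * (g1 (cos t) - g1 x) / (x - cos t) ^+ 2
   - 2 * sin t ^+ 3 * remainder x (cos t) / (x - cos t) ^+ 3).

Let cos_oo t : 0 < t < pi -> -1 < cos t < 1.
Proof.
move=> /andP[t0 tp]; rewrite -cospi -[X in _ && (_ < X)]cos0 !ltr_cos ?t0 ?tp//.
all: by rewrite in_itv/=; rewrite ?lexx ?pi_ge0 ?(ltW t0) ?(ltW tp).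
Qed.

Let cos_cc t : -1 <= cos t <= 1.
Proof. by rewrite cos_geN1 cos_le1. Qed.

Let dR x t : 0 < t < pi ->
  is_derive t 1 (fun t => remainder x (cos t)) (- sin t * (g1 (cos t) - g1 x)).
Proof.
move=> tI; have := is_derive1_comp (dF (cos_oo tI)) (is_derive_cos t) => h.
rewrite /remainder; apply: is_derive_eq.
rewrite /GRing.scale/=; ring.
Qed.

Let dR1 x t : 0 < t < pi ->
  is_derive t 1 (fun t => g1 (cos t) - g1 x) (- sin t * g2 (cos t)).
Proof.
move=> tI; have := is_derive1_comp (dg1 (cos_oo tI)) (is_derive_cos t) => h.
apply: is_derive_eq; rewrite /GRing.scale/=; ring.
Qed.

Let dp x t : cos t != x -> is_derive t 1 (fun t => (x - cos t)^-1) (- sin t / (x - cos t) ^+ 2).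
Proof.
move=> tx; have p0 : x - cos t != 0 by rewrite subr_eq0 eq_sym.
have h : is_derive t 1 (fun t => x - cos t) (sin t).
  apply: is_derive_eq; ring.
have h' := @is_deriveV R (fun t => x - cos t) t (sin t) 1 p0 h.
apply: is_derive_eq; rewrite /GRing.scale/=; field.
exact: p0.
Qed.

Let dW x t : 0 < t < pi -> cos t != x -> is_derive t 1 (W x) (W1 x t).
Proof.
move=> tI tx; have h1 := dR x tI; have h2 := dp tx.
rewrite /W; apply: is_derive_eq; rewrite /W1 /GRing.scale/=.
have p0 : x - cos t != 0 by rewrite subr_eq0 eq_sym.
by field.
Qed.

Let dW1 x t : 0 < t < pi -> cos t != x -> is_derive t 1 (W1 x) (W2 x t).
Proof.
move=> tI tx; have h1 := dR x tI; have h2 := dp tx; have h3 := dR1 x tI.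
have -> : W1 x = (fun t => cos t * remainder x (cos t) * (x - cos t)^-1
  - sin t * sin t * (g1 (cos t) - g1 x) * (x - cos t)^-1
  - sin t * sin t * remainder x (cos t) * ((x - cos t)^-1 * (x - cos t)^-1)).
  by apply/funext => s; rewrite /W1 !expr2 invfM.
apply: is_derive_eq; rewrite /W2 /GRing.scale/=.
have p0 : x - cos t != 0 by rewrite subr_eq0 eq_sym.
by field.
Qed.

(** In terms of [A = r / p^2] and [B = r1 / p], both bounded by [C] because the remainder vanishes
    to second order at [x], the singular quotients disappear except for one factor [sin t / p]. The
    constants are [8 = 2 + 3 + 3] and [5 = 1 + 2 + 2]. *)
Let W2_le x t : -1 <= x <= 1 -> cos t != x -> 0 <= sin t ->
  `|W2 x t| <= C * (8 + 5 * (sin t / `|x - cos t|)).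
Proof.
move=> xI tx s0; have p0 : x - cos t != 0 by rewrite subr_eq0 eq_sym.
have := remainder_le xI (cos_cc t); have := g1_lip xI (cos_cc t).
have := g2C (cos_cc t).
set r := remainder x (cos t); set r1 := g1 (cos t) - g1 x; set r2 := g2 _.
rewrite [`|cos t - x|]distrC /W2 -/r -/r1 -/r2.
set p := x - cos t in p0 *; set s := sin t in s0 *; set c := cos t.
move=> hr2 hr1 hr.
have q0 : 0 < `|p| by rewrite normr_gt0.
pose A := r / p ^+ 2; pose B := r1 / p.
have hA : `|A| <= C by rewrite normrM normfV normrX ler_pdivrMr ?exprn_gt0.
have hB : `|B| <= C by rewrite normrM normfV ler_pdivrMr.
have s1 : `|s| <= 1 by exact: sin_max.
have c1 : `|c| <= 1 by exact: cos_max.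
have p2 : `|p| <= 2.
  have := xI; have := cos_cc t; rewrite -/c => /andP[? ?] /andP[? ?].
  by rewrite ler_norml /p -/c; apply/andP; split; lra.
have -> : - s * r / p - c * s * r1 / p - c * s * r / p ^+ 2
   - (2 * s * c * r1 / p - s ^+ 3 * r2 / p - s ^+ 3 * r1 / p ^+ 2)
   - (2 * s * c * r / p ^+ 2 - s ^+ 3 * r1 / p ^+ 2 - 2 * s ^+ 3 * r / p ^+ 3)
   = (- s * p * A - 3 * (s * c) * B - 3 * (s * c) * A)
     + s * s * (s / p) * (r2 + 2 * B + 2 * A).
  by rewrite /A /B; field.
have n2 (a b u v : R) : `|a| <= u -> `|b| <= v -> `|a * b| <= u * v.
  by move=> h1 h2; rewrite normrM ler_pM.
rewrite [leRHS]mulrDr; apply: le_trans (ler_normD _ _) (lerD _ _).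
  apply: le_trans (ler_normB _ _) _.
  have sc D : `|D| <= C -> `|3 * (s * c) * D| <= 3 * C.
    move=> hD; apply: (n2) => //; rewrite normrM ger0_norm// ler_piMr//.
    by rewrite normrM mulr_ile1.
  have e1 := sc _ hA; have e2 := sc _ hB.
  have e3 : `|- s * p * A| <= 2 * C.
    by apply: (n2) => //; rewrite -[leRHS]mul1r; apply: (n2); rewrite ?normrN.
  have := ler_normB (- s * p * A) (3 * (s * c) * B).
  lra.
have -> : C * (5 * (s / `|p|)) = 1 * (s / `|p|) * (C + 2 * C + 2 * C) by ring.
apply: (n2) => //.
  apply: (n2); first by rewrite -[leRHS]mulr1; exact: (n2).
  by rewrite normrM normfV (ger0_norm s0).
apply: le_trans (ler_normD _ _) _; apply: lerD.
  by apply: le_trans (ler_normD _ _) _; apply: lerD => //; rewrite normrM ger0_norm// ler_wpM2l.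
by rewrite normrM ger0_norm// ler_wpM2l.
Qed.

Let W_le x t : -1 <= x <= 1 -> `|W x t| <= C * `|sin t| * `|x - cos t|.
Proof.
move=> xI; rewrite /W; have [p0|p0] := eqVneq (x - cos t) 0.
  by rewrite p0 invr0 mulr0 normr0 mulr0.
have q0 : 0 < `|x - cos t| by rewrite normr_gt0.
rewrite !normrM normfV ler_pdivrMr//.
have := ler_wpM2r (normr_ge0 (sin t)) (remainder_le xI (cos_cc t)).
rewrite [`|cos t - x|]distrC mulrC => h; apply: le_trans h _.
by rewrite (_ : _ * _ * _ * _ = C * `|x - cos t| ^+ 2 * `|sin t|)//; ring.
Qed.

(** Two Abel summations in closed form: an inner term is counted [2 + 1 + 1 = 4] times, and the two
    terms at each end fall short by 3 and 1. For [a_j = (-1)^j w_j] each summand is a second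
    difference of [w] up to sign. *)
Let sum_second_diff (a : nat -> R) n :
  \sum_(2 <= j < n.+2) (2 * a j + a j.+1 + a j.-1) =
  4 * \sum_(1 <= j < n.+3) a j - 3 * a 1%N - a 2%N - a n.+1 - 3 * a n.+2.
Proof.
elim: n => [|n IH]; first by rewrite big_geq// big_nat_recr//= big_nat1; ring.
by rewrite big_nat_recr//= IH [in RHS]big_nat_recr//=; ring.
Qed.

Let alternating_second_diff_le (w : nat -> R) n :
  4 * `|\sum_(1 <= j < n.+3) (-1) ^+ j * w j| <=
  3 * `|w 1%N| + `|w 2%N| + `|w n.+1| + 3 * `|w n.+2| +
  \sum_(2 <= j < n.+2) `|w j.+1 + w j.-1 - 2 * w j|.
Proof.
have sgn k : `|(-1) ^+ k| = 1 :> R by rewrite normrX normrN1 expr1n.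
pose a j := (-1) ^+ j * w j.
have na j : `|a j| = `|w j| by rewrite normrM sgn mul1r.
have h : `|\sum_(2 <= j < n.+2) (2 * a j + a j.+1 + a j.-1)| <=
    \sum_(2 <= j < n.+2) `|w j.+1 + w j.-1 - 2 * w j|.
  apply: le_trans (ler_norm_sum _ _ _) _; rewrite big_nat [leRHS]big_nat.
  apply: ler_sum => -[//|j] _ /=.
  rewrite /a !exprS (_ : _ + _ + _ = (-1) ^+ j.+2 * (w j.+2 + w j - 2 * w j.+1)).
    by rewrite normrM sgn mul1r.
  by rewrite !exprS; ring.
rewrite sum_second_diff in h.
set S := \sum_(1 <= j < _) _ in h *.
have -> : 4 * `|S| = `|4 * S| by rewrite normrM ger0_norm.
set D := \sum_(2 <= j < _) _ in h *.
have -> : 4 * S = (4 * S - 3 * a 1%N - a 2%N - a n.+1 - 3 * a n.+2) +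
  (3 * a 1%N + a 2%N + a n.+1 + 3 * a n.+2) by ring.
apply: le_trans (ler_normD _ _) _; rewrite [leRHS]addrC; apply: lerD => //.
have n3 (b : R) : 3 * `|b| = `|3 * b| by rewrite normrM ger0_norm.
rewrite -!na !n3.
by do !(apply: le_trans (ler_normD _ _) (lerD _ _) => //).
Qed.

(** The tangent line of [F] at [x] has degree below [m] as [m > 1], so interpolation reproduces it
    and only the remainder is left; the Christoffel form then exhibits the alternating signs. *)
Let bias_alternating m x : (1 < m)%N -> -1 <= x <= 1 ->
  (forall j, (0 < j <= m)%N -> x != cheb_node R m j) ->
  \sum_(1 <= j < m.+1) F (cheb_node R m j) * lagrange_basis m j x - F x =
  - (cos (m%:R * acos x) / m%:R) * \sum_(1 <= j < m.+1) (-1) ^+ j * W x (cheb_angle R m j).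
Proof.
move=> m1 xI xnode; have m0 : (0 < m)%N by exact: ltnW.
have [_ tx] := acos_def xI.
have size_le : (size (((F x - g1 x * x)%:P + g1 x *: 'X : {poly R})%R) <= m)%N.
  apply: leq_trans (size_polyD _ _) _; rewrite geq_max.
  rewrite (leq_trans (size_polyC_leq1 _))//= (leq_trans (size_scale_leq _ _))//.
  by rewrite size_polyX.
have := lagrange_exact x size_le; set p := (_ + _)%R.
have hp y : p.[y] = F x - g1 x * x + g1 x * y by rewrite !hornerE.
rewrite hp subrK => {1}<-.
rewrite -sumrB mulr_sumr !big_nat; apply: eq_bigr => j; rewrite ltnS => jm.
have p0 : x - cheb_node R m j != 0 by rewrite subr_eq0 xnode.
have mn0 : (m%:R : R) != 0 by rewrite pnatr_eq0 -lt0n.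
have := @lagrange_basisE R m j (acos x) jm; rewrite tx => ->; last exact: xnode.
by rewrite /W -!cheb_nodeE /remainder hp; field; rewrite p0 mn0.
Qed.

Let W_le_dist x th s : 0 <= th <= pi -> cos th = x -> 0 <= s <= pi ->
  `|W x s| <= C * `|s - th|.
Proof.
move=> thI tx sI; have xI : -1 <= x <= 1 by rewrite -tx; exact: cos_cc.
apply: le_trans (W_le s xI) _; rewrite -mulrA; apply: ler_wpM2l => //.
rewrite -[leRHS]mul1r; apply: ler_pM => //; first exact: sin_max.
by rewrite -tx [leRHS]distrC; exact: normr_cosB_le.
Qed.

(** [sin_le_cosB] bounds the ratio by the inverse of [|sin ((s - th) / 2)|], and this sine is at
    least [|s - th| / 4]. *)
Let sin_ratio_le x th s : 0 <= th <= pi -> cos th = x -> 0 <= s <= pi -> s != th ->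
  cos s != x /\ sin s / `|x - cos s| <= 4 / `|s - th|.
Proof.
move=> thI tx sI sth; have sx : cos s != x.
  rewrite -tx; apply/eqP => /cos_inj e; move/eqP: sth; apply; apply: e; by rewrite in_itv.
split=> //; have q0 : 0 < `|x - cos s| by rewrite normr_gt0 subr_eq0 eq_sym.
have r0 : 0 < `|s - th| by rewrite normr_gt0 subr_eq0.
rewrite ler_pdivrMr// mulrAC ler_pdivlMr//.
have := sin_le_cosB thI sI; rewrite tx; have s0 := sin_ge0_pi sI.
have : `|s - th| / 4 <= `|sin ((s - th) / 2)|.
  apply: (@le_trans _ _ (sin (`|s - th| / 2))).
    have -> : `|s - th| / 4 = `|s - th| / 2 / 2 by field.
    apply: sin_ge_half; have : `|s - th| <= pi.
      move: thI sI => /andP[? ?] /andP[? ?]; rewrite ler_norml; apply/andP; split; lra.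
    by move=> h; apply/andP; split; [rewrite divr_ge0|rewrite ler_pM2r].
  rewrite -[X in sin (_ / X)](@ger0_norm _ 2)// -normf_div.
  have [a0|a0] := leP 0 ((s - th) / 2); first by rewrite (ger0_norm a0) ler_norm.
  by rewrite (ltr0_norm a0) sinN -normrN ler_norm.
move=> h1 h2; have := ler_wpM2l s0 h1; lra.
Qed.

(** Within [3 d] of [th] the bound [|W s| <= C |s - th|] is enough: the left side is at most
    [14 C d], while [D <= 5] makes the right side at least [16 C d]. Farther away, all of
    [[t - d, t + d]] stays at distance at least [D d / 4] from [th] and the second derivative
    applies; [80 = 5 * 4 * 4]. *)
Let W_second_diff_le x th t (d D : R) : 0 <= th <= pi -> cos th = x ->
  0 < d -> 0 < t - d -> t + d < pi -> 0 < D -> D * d <= 2 * d + `|t - th| ->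
  `|W x (t + d) + W x (t - d) - 2 * W x t| <= 80 * C * d * (d + D^-1).
Proof.
move=> thI tx d0 t1 t2 D0 Dd.
have xI : -1 <= x <= 1 by rewrite -tx; exact: cos_cc.
have Cd : 0 <= C * d by rewrite mulr_ge0// ltW.
have DV : 0 < D^-1 by rewrite invr_gt0.
have [near|far] := leP `|t - th| (3 * d).
  have wn s u : `|s - th| <= u * d -> 0 <= s <= pi -> `|W x s| <= u * (C * d).
    move=> su sI; apply: le_trans (W_le_dist thI tx sI) _.
    by rewrite mulrCA; apply: ler_wpM2l.
  have nd : `|d| = d by rewrite gtr0_norm.
  have h1 : `|W x (t + d)| <= 4 * (C * d).
    apply: wn; last by apply/andP; split; lra.
    by rewrite addrAC; apply: le_trans (ler_normD _ _) _; rewrite nd; lra.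
  have h2 : `|W x (t - d)| <= 4 * (C * d).
    apply: wn; last by apply/andP; split; lra.
    by rewrite addrAC; apply: le_trans (ler_normB _ _) _; rewrite nd; lra.
  have h3 : `|2 * W x t| <= 6 * (C * d).
    rewrite normrM ger0_norm//.
    have : `|W x t| <= 3 * (C * d) by apply: wn => //; apply/andP; split; lra.
    lra.
  have D5 : 1 / 5 <= D^-1.
    rewrite mul1r lef_pV2 ?posrE//.
    by rewrite -(ler_pM2r d0); lra.
  have := ler_normB (W x (t + d) + W x (t - d)) (2 * W x t).
  have := ler_normD (W x (t + d)) (W x (t - d)).
  have := ler_wpM2l Cd D5; have := mulr_ge0 Cd (ltW d0).
  lra.
have fars s : t - d <= s <= t + d -> D * d / 4 <= `|s - th|.
  move=> /andP[s1 s2]; have : `|t - th| <= `|s - th| + d.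
    rewrite (_ : t - th = s - th + (t - s)); last by ring.
    apply: le_trans (ler_normD _ _) _; rewrite lerD2l ler_norml; apply/andP; split; lra.
  lra.
have Dd0 : 0 < D * d by rewrite mulr_gt0.
have sth s : t - d <= s <= t + d -> s != th.
  move=> /fars h; apply/eqP => e; move: h; rewrite e subrr normr0; lra.
have sI s : t - d <= s <= t + d -> 0 < s < pi.
  by move=> /andP[s1 s2]; apply/andP; split; lra.
have sIc s : t - d <= s <= t + d -> 0 <= s <= pi.
  by move=> /andP[s1 s2]; apply/andP; split; lra.
have -> : 80 * C * d * (d + D^-1) = (C * (8 + 5 * (16 / (D * d)))) * d ^+ 2 + 72 * (C * d * d).
  by field; rewrite (gt_eqF D0) (gt_eqF d0).
rewrite -[leLHS]addr0; apply: lerD; last by rewrite !mulr_ge0 ?(ltW d0).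
apply: (@second_diff_le _ (W x) (W1 x) (W2 x)).
- exact: ltW.
- by move=> s sd; apply: dW; [exact: sI|have [] := sin_ratio_le thI tx (sIc _ sd) (sth _ sd)].
- by move=> s sd; apply: dW1; [exact: sI|have [] := sin_ratio_le thI tx (sIc _ sd) (sth _ sd)].
move=> s sd; have [h1 h2] := sin_ratio_le thI tx (sIc _ sd) (sth _ sd).
apply: le_trans (W2_le xI h1 (sin_ge0_pi (sIc _ sd))) _.
apply: ler_wpM2l => //; rewrite lerD2l; apply: ler_wpM2l => //.
apply: le_trans h2 _; have := fars _ sd => h3.
have r0 : 0 < `|s - th| by apply: lt_le_trans h3; rewrite divr_gt0.
rewrite ler_pdivrMr// mulrAC ler_pdivlMr//; lra.
Qed.

(* The remainder of [F] at [x] vanishes to second order, so [W] is C^{1,1} off [x] with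
   [|W''| = O(1 / |t - th|)]; two Abel summations turn the alternating sum of [W] into a sum of
   second differences, each of size [d^2 / |th_j - th|], hence the harmonic sum. *)
Lemma cheb_bias_le m x : (1 < m)%N -> -1 <= x <= 1 ->
  `|\sum_(1 <= j < m.+1) F (cheb_node R m j) * lagrange_basis m j x - F x| <=
  C * (500 + 160 * ln m%:R) / m%:R ^+ 2.
Proof.
move=> m1 xI; have m0 : (0 < m)%N by exact: ltnW.
have mr0 : 0 < m%:R :> R by rewrite ltr0n.
have lnm0 : 0 <= ln m%:R :> R by rewrite ln_ge0// ler1n.
have K0 : 0 <= 500 + 160 * ln m%:R :> R by lra.
have [[k km xk]|xn] := pselect (exists2 k, (0 < k <= m)%N & x = cheb_node R m k).
  rewrite (bigD1_seq k) ?iota_uniq ?mem_index_iota//=.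
  rewrite [in X in _ * X + _]xk lagrange_basis_node// eqxx mulr1 big_seq_cond big1.
    by rewrite xk addr0 subrr normr0 divr_ge0 ?sqr_ge0 ?mulr_ge0.
  move=> i; rewrite mem_index_iota ltnS => /andP[im ik].
  by rewrite xk lagrange_basis_node// eq_sym (negbTE ik) mulr0.
have xnode j : (0 < j <= m)%N -> x != cheb_node R m j.
  by move=> jm; apply/eqP => e; apply: xn; exists j.
have [/andP[t0 tp] tx] := acos_def xI.
set th := acos x in t0 tp tx.
pose d := pi / m%:R : R.
have pi0 := @pi_gt0 R.
have d0 : 0 < d by rewrite divr_gt0.
have dm : d <= 4 / m%:R.
  by rewrite /d ler_pM2r ?invr_gt0//; have := @pihalf_lt2 R; lra.
pose w j := W x (cheb_angle R m j).
have mang j : cheb_angle R m j = (2 * j%:R - 1) / 2 * d.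
  by rewrite /cheb_angle /d; field; rewrite pnatr_eq0 -lt0n.
have angS j : cheb_angle R m j.+1 = cheb_angle R m j + d.
  by rewrite !mang -natr1; field.
have E := bias_alternating m1 xI xnode; rewrite -/th in E.
rewrite E normrM normrN normrM normfV (ger0_norm (ltW mr0)).
have w1 j : (0 < j <= m)%N -> `|w j| <= C * `|x - cheb_node R m j| /\
    `|w j| <= 2 * C * sin (cheb_angle R m j).
  move=> jm; have := W_le (cheb_angle R m j) xI.
  have sj := sin_cheb_angle_gt0 R jm; rewrite -cheb_nodeE (gtr0_norm sj) => h.
  split; apply: le_trans h _.
    by rewrite ler_wpM2r// ler_piMr// sin_le1.
  rewrite mulrAC [2 * C]mulrC ler_wpM2r ?(ltW sj)// ler_wpM2l//.
  have := cos_cc (cheb_angle R m j); have := xI; rewrite -cheb_nodeE => /andP[? ?] /andP[? ?].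
  by rewrite ler_norml; apply/andP; split; lra.
(* The sine is at most the distance of the angle to either end of [[0, pi]], so the four boundary
   terms of the Abel summation are [O(d)]. *)
have wend j : (0 < j <= m)%N -> `|w j| <= 2 * C * (j%:R * d) /\ `|w j| <= 2 * C * ((m%:R + 1 - j%:R) * d).
  move=> jm; have [_ h] := w1 j jm; have C2 : 0 <= 2 * C by rewrite mulr_ge0.
  have /andP[a0 ap] : 0 <= cheb_angle R m j <= pi by have := cheb_angle_in R jm; rewrite in_itv.
  split; apply: le_trans h _; apply: ler_wpM2l => //.
    apply: le_trans (sin_le_id a0) _; rewrite mang ler_wpM2r ?(ltW d0)//; lra.
  have -> : sin (cheb_angle R m j) = sin (pi - cheb_angle R m j).
    by rewrite sinB sinpi cospi; ring.
  apply: le_trans (sin_le_id _) _; first by lra.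
  have -> : pi = m%:R * d by rewrite /d mulrC divfK// gt_eqF.
  rewrite mang -mulrBl ler_wpM2r ?(ltW d0)//; lra.
(* The fractional index at which the angle would equal [th]; distances between angles become
   [|j - tau| d], and [J] is the integer part of [tau]. *)
pose tau := th / d + 2^-1.
have thE : th = (2 * tau - 1) / 2 * d by rewrite /tau; field; rewrite gt_eqF.
have tau0 : 0 <= tau by rewrite addr_ge0// divr_ge0// ltW.
have [J /andP[J1 J2]] : exists J : nat, J%:R <= tau < J%:R + 1.
  by exists (Num.truncn tau); rewrite natr1 truncn_itv.
have Jm : (J <= m)%N.
  rewrite -ltnS -(ltr_nat R) (le_lt_trans J1)// /tau -[m.+1%:R]natr1.
  have : th / d <= m%:R.
    by rewrite ler_pdivrMr// /d mulrC divfK// gt_eqF.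
  lra.
have w3 j : (1 < j < m)%N ->
    `|w j.+1 + w j.-1 - 2 * w j| <= 80 * C * d * (d + (1 + `|j%:R - J%:R|)^-1).
  case: j => [|j]; rewrite ?ltn0// => /andP[j1 jm] /=.
  have j0 : (0 < j)%N by [].
  have e : cheb_angle R m j = cheb_angle R m j.+1 - d by rewrite angS addrK.
  rewrite /w (angS j.+1) e.
  apply: (@W_second_diff_le x th) => //.
  - by rewrite t0.
  - by rewrite -e cheb_angle_gt0.
  - by rewrite -angS cheb_angle_ltpi.
  have -> : cheb_angle R m j.+1 - th = (j.+1%:R - tau) * d.
    by rewrite mang {1}thE; field.
  rewrite normrM (gtr0_norm d0) -mulrDl ler_wpM2r ?(ltW d0)//.
  have -> : j.+1%:R - J%:R = (j.+1%:R - tau) + (tau - J%:R) by ring.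
  have := ler_normD (j.+1%:R - tau) (tau - J%:R).
  rewrite [`|tau - J%:R|]ger0_norm ?subr_ge0//; lra.
have [n nE] : exists n, m = n.+2 by case: (m) m1 => [//|[//|n]] _; exists n.
have := alternating_second_diff_le w n; rewrite -nE => hS.
set S := `|\sum_(1 <= j < _) _| in hS *.
have hsum : \sum_(2 <= j < m) `|w j.+1 + w j.-1 - 2 * w j| <=
   80 * C * d * (m%:R * d + 2 * (1 + ln m%:R)).
  apply: (@le_trans _ _ (\sum_(2 <= j < m) 80 * C * d * (d + (1 + `|j%:R - J%:R|)^-1))).
    by rewrite big_nat [leRHS]big_nat; apply: ler_sum => j; exact: w3.
  have K1 : 0 <= 80 * C * d by apply: mulr_ge0; [exact: mulr_ge0|exact: ltW].
  rewrite -mulr_sumr; apply: (ler_wpM2l K1).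
  apply: (@le_trans _ _ (\sum_(0 <= j < m) (d + (1 + `|j%:R - J%:R|)^-1))).
    rewrite [leRHS](@big_cat_nat _ _ _ 2)//= lerDr sumr_ge0// => j _.
    by rewrite addr_ge0 ?(ltW d0)// invr_ge0 addr_ge0.
  rewrite big_split/=; apply: lerD; last exact: sum_invr_dist_le.
  by rewrite sumr_const_nat subn0 mulr_natl.
have mdpi : m%:R * d = pi by rewrite /d mulrC divfK// gt_eqF.
have [|h1 _] := wend 1%N; first by rewrite m0.
have [|h2 _] := wend 2%N; first by rewrite m1.
have [|_ h3] := wend n.+1; first by rewrite nE leqnSn.
have [|_ h4] := wend m; first by rewrite m0 leqnn.
have e3 : m%:R + 1 - n.+1%:R = 2 :> R by rewrite nE -[n.+2%:R]natr1; ring.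
have e4 : m%:R + 1 - m%:R = 1 :> R by ring.
rewrite e3 in h3; rewrite e4 in h4.
(* [500 = 20 + 320 + 160]: the boundary terms give [6 + 4 + 4 + 6], the second differences
   [80 (pi + 2 + 2 ln m)], with [pi <= 4]. *)
have S_le : 4 * S <= C * d * (500 + 160 * ln m%:R).
  apply: le_trans hS _; rewrite mdpi in hsum.
  have hpi : pi <= 4 :> R by have := @pihalf_lt2 R; lra.
  have Cd : 0 <= C * d by rewrite mulr_ge0// ltW.
  have : C * d * pi <= C * d * 4 by rewrite ler_wpM2l.
  have := mulr_ge0 Cd lnm0.
  lra.
have c1 := cos_max (m%:R * th).
have S0 : 0 <= S by rewrite /S.
apply: (@le_trans _ _ (m%:R^-1 * S)).
  by rewrite ler_wpM2r// ler_piMl// invr_ge0 ltW.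
have -> : C * (500 + 160 * ln m%:R) / m%:R ^+ 2 = m%:R^-1 * ((C * (4 / m%:R) * (500 + 160 * ln m%:R)) / 4).
  by field; rewrite gt_eqF.
rewrite ler_pM2l ?invr_gt0// ler_pdivlMr// mulrC; apply: le_trans S_le _.
by rewrite ler_wpM2r// ler_wpM2l.
Qed.
End ChebyshevBias.

(** * Moments of the normal law *)

Section NormalMoments.
Variable R : realType.
Local Notation mu := (@lebesgue_measure R).

(** The fundamental theorem of calculus on [[-n-1, n+1]], then dominated convergence. It serves as
    integration by parts against the normal density. *)
Lemma Rintegral_derivative_eq0 (G g : R -> R) :
  (forall x : R, is_derive x 1 G (g x)) -> continuous g ->
  mu.-integrable [set: R] (EFin \o g) ->
  G n.+1%:R - G (- n.+1%:R) @[n --> \oo] --> (0 : R) ->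
  \int[mu]_x g x = 0.
Proof.
move=> dG g_cont ig G0.
pose f_ n (x : R) : R := (g \_ `[- n.+1%:R, n.+1%:R]) x.
have intf n : (\int[mu]_x (f_ n x)%:E = (G n.+1%:R - G (- n.+1%:R))%:E)%E.
  transitivity (\int[mu]_(x in `[(- n.+1%:R)%R, n.+1%:R%R]) (g x)%:E)%E.
    by rewrite [RHS]integral_mkcond; apply: eq_integral => x _; rewrite restrict_EFin.
  rewrite EFinB; apply: continuous_FTC2.
  - by rewrite gtrN// ltr0n.
  - exact: continuous_subspaceT.
  - split; first by move=> x _; exact: ex_derive.
    + by apply: cvg_at_right_filter; exact: is_derive_continuous (dG _).
    + by apply: cvg_at_left_filter; exact: is_derive_continuous (dG _).
  - by move=> x _; rewrite derive1E; exact: (@derive_val _ _ _ _ _ _ _ (dG x)).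
have mf n : measurable_fun [set: R] (f_ n).
  apply/(measurable_restrictT _ _).1 => //.
  apply: measurable_funTS; exact: continuous_measurable_fun.
have [| | | | |_ _] := @dominated_convergence _ _ _ mu setT measurableT
  (fun n x => (f_ n x)%:E) (EFin \o g) (fun x => (`|g x|)%:E).
- by move=> n; apply/measurable_EFinP; exact: mf.
- by apply/measurable_EFinP; exact: continuous_measurable_fun.
- apply: nearW => x _; apply: cvg_near_cst; near=> n.
  rewrite /f_ patchE mem_set//= in_itv/= -ler_norml.
  rewrite -natr1 ler_wpDr//; near: n; exact: nbhs_infty_ger.
- exact: integrable_abse ig.
- apply: nearW => x n _ /=; rewrite lee_fin /f_ patchE; case: ifP => //.
  by rewrite normr0.
have -> : (fun n => (\int[mu]_(x in setT) (f_ n x)%:E)%E) = (fun n => (G n.+1%:R - G (- n.+1%:R))%:E).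
  by apply/funext => n; exact: intf.
move=> cG; have cG0 : (G n.+1%:R - G (- n.+1%:R))%:E @[n --> \oo] --> 0%:E.
  by apply: cvg_EFin; [exact: nearW|exact: G0].
by rewrite /Rintegral (cvg_unique _ cG cG0).
Unshelve. all: by end_near. Qed.

(** The Radon-Nikodym derivative of the normal law agrees almost everywhere with the explicit
    density, both having the same integrals over measurable sets. *)
Lemma ge0_integral_normal_prob (m s : R) (f : R -> \bar R) :
  measurable_fun [set: R] f -> (forall x, 0 <= f x)%E ->
  (\int[normal_prob m s]_x f x = \int[mu]_x (f x * (normal_pdf m s x)%:E))%E.
Proof.
move=> mf f0; have dom := normal_prob_dominates m s.
rewrite -(Radon_Nikodym_SigmaFinite.change_of_variables dom)//.
apply: ae_eq_integral => //.
- apply: emeasurable_funM => //; apply: (measurable_int mu).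
  exact: Radon_Nikodym_SigmaFinite.f_integrable.
- apply: emeasurable_funM => //=; apply/measurableT_comp => //=.
  exact: measurable_normal_pdf.
- apply: ae_eqe_mul2l => /=; apply: integral_ae_eq => //=.
  + exact: Radon_Nikodym_SigmaFinite.f_integrable.
  + by apply/measurableT_comp => //; exact: measurable_normal_pdf.
  + by move=> E _ mE; rewrite -Radon_Nikodym_SigmaFinite.f_integral.
Qed.

Variables m s : R.
Hypothesis s0 : s != 0.
Let q : R -> R := normal_pdf m s.

Let qE (x : R) : q x = normal_peak s * expR (- (x - m) ^+ 2 / (s ^+ 2 *+ 2)).
Proof. by rewrite /q normal_pdfE. Qed.

Let s2 : 0 < s ^+ 2. Proof. by rewrite exprn_even_gt0. Qed.

Let q_ge0 x : 0 <= q x. Proof. exact: normal_pdf_ge0. Qed.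

(** Half of the Gaussian exponent absorbs the fourth power: with [y = u^2 / (4 s^2)],
    [u^4 = 32 s^4 (y^2 / 2)] and [y^2 / 2 <= e^y]. What is left is, up to a constant, the normal
    density of variance [2 s^2]. *)
Let pow4_le (x : R) : (x - m) ^+ 4 * q x <=
  32 * s ^+ 4 * (normal_peak s * expR (- (x - m) ^+ 2 / (s ^+ 2 *+ 4))).
Proof.
rewrite qE mulrCA [leRHS]mulrCA ler_wpM2l ?normal_peak_ge0//.
move: (x - m) => u.
set y := u ^+ 2 / (s ^+ 2 *+ 4).
have y0 : 0 <= y by rewrite divr_ge0 ?sqr_ge0// mulrn_wge0// ltW.
have h := expR_ge1Dxn 1 y0; rewrite (_ : 2`!%:R = 2)// in h.
have -> : expR (- u ^+ 2 / (s ^+ 2 *+ 2)) = expR (- y) * expR (- y).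
  rewrite -expRD /y; congr expR; rewrite -[_ *+ 2]mulr_natr -[_ *+ 4]mulr_natr.
  move: s0; move: (s) => z z0; field.
  exact: z0.
have -> : - u ^+ 2 / (s ^+ 2 *+ 4) = - y by rewrite /y mulNr.
have -> : u ^+ 4 = 32 * s ^+ 4 * (y ^+ 2 / 2) by rewrite /y -[_ *+ 4]mulr_natr; field.
have e0 := expR_gt0 (- y); have s4 : 0 <= 32 * s ^+ 4 by rewrite mulr_ge0// exprn_even_ge0.
set K := 32 * s ^+ 4 in s4 *; set e := expR (- y) in e0 *.
rewrite -mulrA; apply: ler_wpM2l => //; rewrite mulrA ler_piMl ?(ltW e0)//.
by rewrite /e expRN ler_pdivrMr ?expR_gt0// mul1r; lra.
Qed.

Let sq2 : Num.sqrt 2 * s != 0 :> R.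
Proof. by rewrite mulf_neq0// gt_eqF// sqrtr_gt0. Qed.

Let wide (x : R) : normal_peak s * expR (- (x - m) ^+ 2 / (s ^+ 2 *+ 4)) =
  normal_peak s / normal_peak (Num.sqrt 2 * s) * normal_pdf m (Num.sqrt 2 * s) x.
Proof.
rewrite normal_pdfE//= /normal_fun mulrA divfK.
  by rewrite exprMn sqr_sqrtr// mulr_natl -mulrnA.
by rewrite gt_eqF// normal_peak_gt0.
Qed.

(** [|u|^k <= 1 + u^4] for [k <= 4], so one domination covers all these moments. *)
Lemma integrable_pow_normal_pdf k : (k <= 4)%N ->
  mu.-integrable [set: R] (EFin \o (fun x : R => (x - m) ^+ k * q x)).
Proof.
move=> k4.
pose c := 32 * s ^+ 4 * (normal_peak s / normal_peak (Num.sqrt 2 * s)).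
apply: (@le_integrable _ _ _ mu _ _ _ (EFin \o (fun x : R => q x + c * normal_pdf m (Num.sqrt 2 * s) x))) => //.
- apply/measurable_EFinP; apply: measurable_funM; last exact: measurable_normal_pdf.
  by apply: measurable_funX; exact: measurable_funB.
- move=> x _ /=; rewrite lee_fin.
  apply: le_trans (ler_norm _); rewrite normrM [`|q x|]ger0_norm//.
  apply: (@le_trans _ _ (q x + (x - m) ^+ 4 * q x)); last first.
    rewrite lerD2l (le_trans (pow4_le x))// wide mulrA.
    by rewrite /c !mulrA.
  move: (x - m) => u.
  rewrite -{2}[q x]mul1r -mulrDl ler_wpM2r// normrX.
  have -> : u ^+ 4 = `|u| ^+ 4 by rewrite -normrX ger0_norm// exprn_even_ge0.
  have [x1|x1] := leP `|u| 1.
    by rewrite (le_trans (exprn_ile1 _ _ _))// lerDl exprn_ge0.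
  by rewrite (le_trans (ler_weXn2l (ltW x1) k4))// lerDr.
- have h1 : mu.-integrable [set: R] (EFin \o q) by exact: integrable_normal_pdf.
  have h2 : mu.-integrable [set: R] (EFin \o normal_pdf m (Num.sqrt 2 * s)).
    exact: integrable_normal_pdf.
  exact: (integrableD measurableT h1 (integrableZl measurableT c h2)).
Qed.

Let dq (x : R) : is_derive x 1 q (- (x - m) / s ^+ 2 * q x).
Proof.
have -> : q = (fun x => normal_peak s * expR (- (x - m) ^+ 2 / (s ^+ 2 *+ 2))).
  by apply/funext => y; rewrite qE.
have e : is_derive x 1 (fun x => - (x - m) ^+ 2 / (s ^+ 2 *+ 2)) (- (x - m) / s ^+ 2).
  apply: is_derive_eq; rewrite /GRing.scale/= -[_ *+ 2]mulr_natr; field.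
  by rewrite s0.
have h := is_derive1_comp (is_derive_expR _) e.
apply: is_derive_eq; rewrite /GRing.scale/=; ring.
Qed.

Let q_cont : continuous q. Proof. by move=> x; exact: is_derive_continuous (dq x). Qed.

Let bnd k (x : R) : (k <= 3)%N -> 1 <= `|x - m| ->
  `|(x - m) ^+ k * q x| <= 32 * s ^+ 4 * normal_peak s / `|x - m|.
Proof.
move=> k3 x1; have x0 : 0 < `|x - m| by exact: lt_le_trans x1.
rewrite ler_pdivlMr// normrM normrX [`|q x|]ger0_norm// mulrAC -exprSr.
apply: (@le_trans _ _ ((x - m) ^+ 4 * q x)).
  have -> : (x - m) ^+ 4 = `|x - m| ^+ 4 by rewrite -normrX ger0_norm// exprn_even_ge0.
  by rewrite ler_wpM2r// ler_weXn2l.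
apply: le_trans (pow4_le x) _; have K0 : 0 <= 32 * s ^+ 4 * normal_peak s.
  by apply: mulr_ge0 (normal_peak_ge0 _); rewrite mulr_ge0// exprn_even_ge0.
rewrite mulrA (ler_piMr K0)// -expR0 ler_expR mulNr oppr_le0 divr_ge0 ?sqr_ge0//.
by rewrite mulrn_wge0// ltW.
Qed.

Let cvg0 k : (k <= 3)%N ->
  (n.+1%:R - m) ^+ k * q n.+1%:R - (- n.+1%:R - m) ^+ k * q (- n.+1%:R) @[n --> \oo] --> (0 : R).
Proof.
move=> k3; pose K := 32 * s ^+ 4 * normal_peak s.
have K0 : 0 <= K by apply: mulr_ge0 (normal_peak_ge0 _); rewrite mulr_ge0// exprn_even_ge0.
apply: (@norm_cvg0 _ R^o).
apply: (@squeeze_cvgr _ _ _ _ (fun=> 0) (fun n => (4 * K) * harmonic n)).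
- near=> n; rewrite normr_ge0/=.
  have nm : 2 * `|m| + 2 <= n.+1%:R.
    by rewrite -[n.+1%:R]natr1 ler_wpDr//; near: n; exact: nbhs_infty_ger.
  have n0 : 0 < n.+1%:R :> R by rewrite ltr0n.
  have h1 : n.+1%:R / 2 <= `|n.+1%:R - m|.
    by have := lerB_dist n.+1%:R m; rewrite (gtr0_norm n0); lra.
  have h2 : n.+1%:R / 2 <= `|- n.+1%:R - m|.
    by have := lerB_dist (- n.+1%:R) m; rewrite normrN (gtr0_norm n0); lra.
  have n1 : 1 <= n.+1%:R / 2 :> R by have := normr_ge0 m; lra.
  have e u : n.+1%:R / 2 <= `|u - m| -> `|(u - m) ^+ k * q u| <= 2 * K * n.+1%:R^-1.
    move=> hu; apply: le_trans (bnd k3 (le_trans n1 hu)) _.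
    rewrite -/K -mulrA mulrCA ler_wpM2l// -invf_div lef_pV2 ?posrE//.
    exact: lt_le_trans (lt_le_trans ltr01 n1) hu.
  have := ler_normB ((n.+1%:R - m) ^+ k * q n.+1%:R) ((- n.+1%:R - m) ^+ k * q (- n.+1%:R)).
  have := e _ h1; have := e _ h2 => e2 e1 h; apply: le_trans h _; apply: le_trans (lerD e1 e2) _.
  by rewrite le_eqVlt; apply/orP; left; apply/eqP; ring.
- exact: cvg_cst.
- by rewrite -[X in _ --> X](mulr0 (4 * K)); apply: cvgMr; exact: cvg_harmonic.
Unshelve. all: by end_near. Qed.

Lemma normal_pdf_moment1 : \int[mu]_x ((x - m) * q x) = 0.
Proof.
have i1 : mu.-integrable [set: R] (EFin \o (fun x : R => (x - m) * q x)).
  exact: (@integrable_pow_normal_pdf 1).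
suff : \int[mu]_x (- s ^- 2 * ((x - m) * q x)) = 0.
  rewrite RintegralZl// => /eqP; rewrite mulf_eq0 oppr_eq0 invr_eq0 expf_eq0/= (negbTE s0)/=.
  by move/eqP.
apply: (@Rintegral_derivative_eq0 q).
- move=> x; have := dq x.
  by rewrite (_ : - (x - m) / s ^+ 2 * q x = - s ^- 2 * ((x - m) * q x))//; field.
- move=> x; apply: cvgM; first exact: cvg_cst.
  by apply: cvgM; [apply: cvgB; [exact: cvg_id|exact: cvg_cst]|exact: q_cont].
- exact: (integrableZl measurableT (- s ^- 2) i1).
- by have := @cvg0 0 isT; under eq_fun do rewrite !expr0 !mul1r.
Qed.

(** The derivative of [(x - m)^(k+1) q], where [q' = - (x - m) q / s^2], has integral 0.
    Integrability and vanishing at infinity come from the fourth-power bound, whence [k <= 2]. *)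
Lemma normal_pdf_moment_rec k : (k <= 2)%N ->
  \int[mu]_x ((x - m) ^+ k.+2 * q x) = s ^+ 2 * k.+1%:R * \int[mu]_x ((x - m) ^+ k * q x).
Proof.
move=> k2; have i1 : mu.-integrable [set: R] (EFin \o (fun x : R => (x - m) ^+ k.+2 * q x)).
  exact: integrable_pow_normal_pdf.
have i2 : mu.-integrable [set: R] (EFin \o (fun x : R => (x - m) ^+ k * q x)).
  by apply: integrable_pow_normal_pdf; exact: leq_trans k2 _.
pose g (x : R) := k.+1%:R * ((x - m) ^+ k * q x) - s ^- 2 * ((x - m) ^+ k.+2 * q x).
have iZ (c : R) (h : R -> R) : mu.-integrable [set: R] (EFin \o h) ->
    mu.-integrable [set: R] (EFin \o (fun x => c * h x)).
  by move=> ih; exact: (integrableZl measurableT c ih).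
suff g0 : \int[mu]_x g x = 0.
  move: g0; rewrite /g RintegralB//; [|exact: iZ..].
  rewrite !RintegralZl// => /eqP; rewrite subr_eq0 => /eqP e.
  by rewrite -mulrA e mulrA divff ?mul1r// expf_neq0.
have cm : continuous (fun x : R => x - m).
  by move=> x; apply: cvgB; [exact: cvg_id|exact: cvg_cst].
have cX n : continuous (fun x : R => (x - m) ^+ n).
  move=> x; apply: (@continuous_comp _ _ _ (fun x : R => x - m) (fun y => y ^+ n)).
    exact: cm.
  exact: exprn_continuous.
apply: (@Rintegral_derivative_eq0 (fun x => (x - m) ^+ k.+1 * q x)).
- move=> x; have h := dq x.
  have h2 : is_derive x 1 (fun x : R => (x - m) ^+ k.+1) (k.+1%:R * (x - m) ^+ k).
    have hp : is_derive (x - m) 1 (fun x : R => x ^+ k.+1) (k.+1%:R * (x - m) ^+ k).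
      have := @is_derive_poly R 'X^(k.+1) (x - m); rewrite derivXn hornerMn hornerXn -mulr_natl.
      by rewrite (_ : horner 'X^(k.+1) = fun y => y ^+ k.+1)//; apply/funext => y; rewrite hornerXn.
    have hm : is_derive x 1 (fun x : R => x - m) 1.
      by apply: is_derive_eq; rewrite subr0.
    by have := @is_derive1_comp R (fun y => y ^+ k.+1) (fun x => x - m) x _ _ hp hm; rewrite mulr1.
  apply: is_derive_eq; rewrite /g /GRing.scale/= !exprS; field.
  by rewrite s0.
- move=> x; apply: cvgB; (apply: cvgM; [exact: cvg_cst|]);
    by apply: cvgM; [exact: cX|exact: q_cont].
- exact: (integrableB measurableT (iZ _ _ i2) (iZ _ _ i1)).
- exact: cvg0.
Qed.
End NormalMoments.

(** * Expectation and independence *)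

Section Expectation.
Context d (T : measurableType d) (R : realType) (P : probability T R).
Implicit Types (X Y Z : T -> R) (c : R).

Definition L1 X : Prop := P.-integrable [set: T] (EFin \o X).
Definition Ex X : R := \int[P]_w X w.

Lemma L1_mf X : L1 X -> measurable_fun [set: T] X.
Proof. by move=> /measurable_int/measurable_EFinP. Qed.

Lemma L1_le X Y : measurable_fun [set: T] X -> (forall w, `|X w| <= Y w) -> L1 Y -> L1 X.
Proof.
move=> mX XY iY; apply: (le_integrable measurableT _ _ iY); first exact/measurable_EFinP.
by move=> w _ /=; rewrite lee_fin (le_trans (XY w))// ler_norm.
Qed.

Lemma L1_cst c : L1 (fun=> c).
Proof. exact: finite_measure_integrable_cst. Qed.

Lemma L1_bounded X c : measurable_fun [set: T] X -> (forall w, `|X w| <= c) -> L1 X.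
Proof. by move=> mX Xc; exact: L1_le mX Xc (L1_cst c). Qed.

Lemma L1D X Y : L1 X -> L1 Y -> L1 (fun w => X w + Y w).
Proof. by move=> iX iY; exact: (integrableD measurableT iX iY). Qed.

Lemma L1Z c X : L1 X -> L1 (fun w => c * X w).
Proof. by move=> iX; exact: (integrableZl measurableT c iX). Qed.

Lemma L1B X Y : L1 X -> L1 Y -> L1 (fun w => X w - Y w).
Proof. by move=> iX iY; exact: (integrableB measurableT iX iY). Qed.

Lemma L1_norm X : L1 X -> L1 (fun w => `|X w|).
Proof. by move=> iX; exact: (integrable_abse iX). Qed.

Lemma L1_sum I (s : seq I) (X : I -> T -> R) : (forall i, L1 (X i)) ->
  L1 (fun w => \sum_(i <- s) X i w).
Proof.
move=> iX; elim: s => [|i s IH].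
  by under eq_fun do rewrite big_nil; exact: L1_cst.
by under eq_fun do rewrite big_cons; exact: L1D.
Qed.

Lemma eq_Ex X Y : X =1 Y -> Ex X = Ex Y.
Proof. by move=> XY; congr Ex; apply/funext. Qed.

Lemma Ex_cst c : Ex (fun=> c) = c.
Proof. by rewrite /Ex Rintegral_cst//= (_ : P setT = 1%E) ?mulr1//; exact: probability_setT. Qed.

Lemma ExD X Y : L1 X -> L1 Y -> Ex (fun w => X w + Y w) = Ex X + Ex Y.
Proof. exact: RintegralD. Qed.

Lemma ExB X Y : L1 X -> L1 Y -> Ex (fun w => X w - Y w) = Ex X - Ex Y.
Proof. exact: RintegralB. Qed.

Lemma ExZ c X : L1 X -> Ex (fun w => c * X w) = c * Ex X.
Proof. by move=> iX; rewrite /Ex RintegralZl. Qed.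

Lemma Ex_sum I (s : seq I) (X : I -> T -> R) : (forall i, L1 (X i)) ->
  Ex (fun w => \sum_(i <- s) X i w) = \sum_(i <- s) Ex (X i).
Proof.
move=> iX; elim: s => [|i s IH].
  by rewrite big_nil -[RHS](Ex_cst 0); apply: eq_Ex => w; rewrite big_nil.
rewrite big_cons -IH -ExD//; last exact: L1_sum.
by apply: eq_Ex => w; rewrite big_cons.
Qed.

Lemma Ex_le X Y : L1 X -> L1 Y -> (forall w, X w <= Y w) -> Ex X <= Ex Y.
Proof. by move=> iX iY XY; apply: le_Rintegral => // w _; exact: XY. Qed.

Lemma Ex_ge0 X : (forall w, 0 <= X w) -> 0 <= Ex X.
Proof. by move=> X0; apply: Rintegral_ge0 => w _. Qed.

Lemma normr_Ex_le X : L1 X -> `|Ex X| <= Ex (fun w => `|X w|).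
Proof. by move=> iX; exact: le_normr_Rintegral. Qed.

Lemma integral_Ex X : L1 X -> (\int[P]_w (X w)%:E = (Ex X)%:E)%E.
Proof. by move=> iX; rewrite /Ex /Rintegral fineK//; exact: integrable_fin_num. Qed.

Lemma expectation_Ex X : L1 X -> ('E_P[X] = (Ex X)%:E)%E.
Proof. by move=> iX; rewrite unlock integral_Ex. Qed.

Lemma ge0_L1 X (a : \bar R) : measurable_fun [set: T] X -> (forall w, 0 <= X w) ->
  (\int[P]_w (X w)%:E = a)%E -> a \is a fin_num -> L1 X /\ Ex X = fine a.
Proof.
move=> mX X0 ia afin; split; last by rewrite /Ex /Rintegral ia.
apply/integrableP; split; first exact/measurable_EFinP.
rewrite (_ : (fun x => _) = EFin \o X); last first.
  by apply/funext => w /=; rewrite ger0_norm.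
by rewrite ia ltey_eq afin.
Qed.

Lemma Ex_indic (A : set T) : measurable A -> Ex (\1_A) = fine (P A).
Proof. by move=> mA; rewrite /Ex /Rintegral integral_indic// setIT. Qed.

(** Measurability of [X] is a separate clause because that of its fourth power does not imply it. *)
Definition L4 X : Prop := measurable_fun [set: T] X /\ L1 (fun w => X w ^+ 4).

Lemma L4_cst c : L4 (fun=> c).
Proof. by split => //; exact: L1_cst. Qed.

(** The arithmetic-geometric mean inequality, applied twice. *)
Lemma prod4_le (a b c e : R) : `|a * b * c * e| <= a ^+ 4 + b ^+ 4 + c ^+ 4 + e ^+ 4.
Proof.
have h u v : `|u * v| <= (u ^+ 2 + v ^+ 2) / 2 :> R.
  by rewrite normrM -[u ^+ 2]real_normK ?num_real// -[v ^+ 2]real_normK ?num_real//;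
    have := sqr_ge0 (`|u| - `|v|); rewrite sqrrB; lra.
rewrite -mulrA; apply: le_trans (h _ _) _.
have k u v : (u * v) ^+ 2 <= (u ^+ 4 + v ^+ 4) / 2 :> R.
  by have := sqr_ge0 (u ^+ 2 - v ^+ 2); rewrite sqrrB -!exprM exprMn; lra.
have := k a b; have := k c e.
have : 0 <= a ^+ 4 by rewrite exprn_even_ge0.
have : 0 <= b ^+ 4 by rewrite exprn_even_ge0.
have : 0 <= c ^+ 4 by rewrite exprn_even_ge0.
have : 0 <= e ^+ 4 by rewrite exprn_even_ge0.
by move: (a ^+ 4) (b ^+ 4) (c ^+ 4) (e ^+ 4) ((a * b) ^+ 2) ((c * e) ^+ 2) => *; lra.
Qed.

Lemma L1_prod4 X Y Z V : L4 X -> L4 Y -> L4 Z -> L4 V -> L1 (fun w => X w * Y w * Z w * V w).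
Proof.
move=> [mX iX] [mY iY] [mZ iZ] [mV iV].
apply: (@L1_le _ (fun w => X w ^+ 4 + Y w ^+ 4 + Z w ^+ 4 + V w ^+ 4)).
- by do !apply: measurable_funM.
- by move=> w; exact: prod4_le.
- by do !apply: L1D.
Qed.

Lemma L1_prod2 X Y : L4 X -> L4 Y -> L1 (fun w => X w * Y w).
Proof.
move=> iX iY; have := L1_prod4 iX iY (L4_cst 1) (L4_cst 1).
by under eq_fun do rewrite !mulr1.
Qed.

Lemma L1_L4 X : L4 X -> L1 X.
Proof. by move=> iX; have := L1_prod2 iX (L4_cst 1); under eq_fun do rewrite mulr1. Qed.

Lemma L1_sqr X : L4 X -> L1 (fun w => X w ^+ 2).
Proof. by move=> iX; have := L1_prod2 iX iX. Qed.

Lemma L4D X Y : L4 X -> L4 Y -> L4 (fun w => X w + Y w).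
Proof.
move=> iX iY; split; first by apply: measurable_funD; [exact: iX.1|exact: iY.1].
have h (u v : R) : (u + v) ^+ 4 = u ^+ 4 + 4 * (u * u * u * v) + 6 * (u * u * v * v) +
  4 * (u * v * v * v) + v ^+ 4 by ring.
under eq_fun do rewrite h.
do !apply: L1D; [exact: iX.2|exact/L1Z/L1_prod4|exact/L1Z/L1_prod4|exact/L1Z/L1_prod4|exact: iY.2].
Qed.

Lemma L4Z c X : L4 X -> L4 (fun w => c * X w).
Proof.
move=> iX; split; first by apply: measurable_funM => //; exact: iX.1.
by under eq_fun do rewrite exprMn; apply: L1Z; exact: iX.2.
Qed.

Lemma L4B X Y : L4 X -> L4 Y -> L4 (fun w => X w - Y w).
Proof.
move=> iX iY; have := L4D iX (L4Z (-1) iY).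
by under eq_fun do rewrite mulN1r.
Qed.

Definition indep X Y : Prop := forall A B : set R, measurable A -> measurable B ->
  P (X @^-1` A `&` Y @^-1` B) = (P (X @^-1` A) * P (Y @^-1` B))%E.

Section Joint.
Variables (X Y : T -> R).
Hypotheses (mX : measurable_fun [set: T] X) (mY : measurable_fun [set: T] Y).
Hypothesis iXY : indep X Y.

Let X' : {mfun T >-> R} := mfun_Sub (mem_set mX).
Let Y' : {mfun T >-> R} := mfun_Sub (mem_set mY).
Let J w : R * R := (X w, Y w).

Let mJ : measurable_fun [set: T] J.
Proof. exact: measurable_fun_pair. Qed.

Let J' : {mfun T >-> (R * R)%type} := mfun_Sub (mem_set mJ).

Let jointE A : measurable A -> ((distribution P X' \x distribution P Y') A = distribution P J' A)%E.
Proof.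
move=> mA; apply: (product_measure_unique (m' := distribution P J')) => // B C mB mC.
Qed.

(** The joint law is the product of the marginals, so Fubini applies: one variable is frozen while
    the other is averaged. *)
Lemma indep_Ex_bounded (f : R * R -> R) c : measurable_fun [set: (R * R)%type] f ->
  (forall z, `|f z| <= c) ->
  Ex (fun w => f (X w, Y w)) = Ex (fun w => Ex (fun w' => f (X w, Y w'))).
Proof.
move=> mf fc.
have mfE : measurable_fun [set: (R * R)%type] (EFin \o f) by exact/measurable_EFinP.
have bdd : [bounded f z | z in [set: (R * R)%type]].
  by exists c; split; [exact: num_real|move=> y cy z _ /=; rewrite (le_trans (fc z))// ltW].
have ifp : (distribution P X' \x distribution P Y')%E.-integrable [set: (R * R)%type] (EFin \o f).
  apply: measurable_bounded_integrable => //.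
  apply: (@le_lt_trans _ _ (distribution P J' setT)); first by rewrite -(jointE measurableT).
  by rewrite ltey_eq fin_num_measure.
have iJ : P.-integrable [set: T] ((EFin \o f) \o J).
  by apply: measurable_bounded_integrable => //;
   [rewrite ltey_eq fin_num_measure|exact: measurableT_comp|
    exists c; split; [exact: num_real|move=> y cy z _ /=; rewrite (le_trans (fc _))// ltW]].
have e1 : (\int[P]_w (f (X w, Y w))%:E = \int[distribution P J']_z (f z)%:E)%E.
  by rewrite (@integral_distribution _ _ _ _ _ P J' (EFin \o f)).
have e2 : (\int[distribution P J']_z (f z)%:E = \int[distribution P X' \x distribution P Y']_z (f z)%:E)%E.
  by apply: eq_measure_integral => A mA _; symmetry; exact: jointE.
have e3 := integral12_prod_meas1 ifp.
have inner x : fubini_F (distribution P Y') (EFin \o f) x = (Ex (fun w' => f (x, Y w')))%:E.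
  have mfx : measurable_fun [set: R] (fun y => f (x, y)).
    by apply: measurableT_comp => //; exact: measurable_pair1.
  have mfxY : measurable_fun [set: T] (fun w => f (x, Y w)) by exact: measurableT_comp mfx mY.
  rewrite /fubini_F (@integral_distribution _ _ _ _ _ P Y' (fun y => (f (x, y))%:E)).
  - by rewrite -integral_Ex//; apply: L1_bounded mfxY _ => w; exact: fc.
  - exact/measurable_EFinP.
  - by apply: (L1_bounded (c := c)) => // w; exact: fc.
have mF := measurable_fubini_F ifp.
rewrite {1}/Ex /Rintegral e1 e2 -e3 {1}/Ex /Rintegral; congr fine.
rewrite (@integral_distribution _ _ _ _ _ P X' (fubini_F (distribution P Y') (EFin \o f)))//.
  by apply: eq_integral => w _ /=; rewrite inner.
have -> : fubini_F (distribution P Y') (EFin \o f) \o X' = EFin \o (fun w => Ex (fun w' => f (X w, Y w'))).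
  by apply/funext => w /=; rewrite inner.
apply: (L1_bounded (c := c)).
  have := measurableT_comp mF mX.
  rewrite (_ : _ \o X = EFin \o (fun w => Ex (fun w' => f (X w, Y w')))); first by move/measurable_EFinP.
  by apply/funext => w /=; rewrite inner.
move=> w; have mfxY : measurable_fun [set: T] (fun w' => f (X w, Y w')).
  by apply: (measurableT_comp mf); exact: measurable_fun_pair.
have i : L1 (fun w' => f (X w, Y w')) by apply: L1_bounded mfxY _ => w'; exact: fc.
apply: le_trans (normr_Ex_le i) _; rewrite -[leRHS]Ex_cst; apply: Ex_le (L1_norm i) (L1_cst _) _.
by move=> w'; exact: fc.
Qed.
End Joint.

Lemma indepC X Y : indep X Y -> indep Y X.
Proof. by move=> h A B mA mB; rewrite setIC h// muleC. Qed.

Lemma indep_comp X Y (f g : R -> R) : measurable_fun [set: R] f -> measurable_fun [set: R] g ->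
  indep X Y -> indep (f \o X) (g \o Y).
Proof.
move=> mf mg h A B mA mB; apply: (h (f @^-1` A) (g @^-1` B)).
  by rewrite -[X in measurable X]setTI; exact: mf.
by rewrite -[X in measurable X]setTI; exact: mg.
Qed.

Lemma Ex_cvg (X : nat -> T -> R) Z Y :
  (forall n, measurable_fun [set: T] (X n)) -> measurable_fun [set: T] Z ->
  {ae P, forall w, X n w @[n --> \oo] --> Z w} ->
  (forall n w, `|X n w| <= Y w) -> L1 Y ->
  Ex (X n) @[n --> \oo] --> Ex Z.
Proof.
move=> mX mZ cXZ XY iY.
have iX n : L1 (X n) by exact: L1_le (mX n) (XY n) iY.
have [| | | | |iZ _] := @dominated_convergence _ _ _ P setT measurableT
  (fun n w => (X n w)%:E) (EFin \o Z) (EFin \o Y).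
- by move=> n; apply/measurable_EFinP; exact: mX.
- exact/measurable_EFinP.
- by apply: filterS cXZ => w cw _; apply: cvg_EFin => //; exact: nearW.
- exact: iY.
- by apply: nearW => w n _ /=; rewrite lee_fin.
have -> : (\int[P]_w (EFin \o Z) w = (Ex Z)%:E)%E by exact: integral_Ex.
by move=> /fine_cvg.
Qed.

(* Truncation at [n] reduces the statement to the bounded case. *)
Lemma indep_ExM X Y : L1 X -> L1 Y -> L1 (fun w => X w * Y w) -> indep X Y ->
  Ex (fun w => X w * Y w) = Ex X * Ex Y.
Proof.
move=> iX iY i2 hXY; have mX := L1_mf iX; have mY := L1_mf iY.
pose tr n (x : R) : R := Num.max (- n%:R) (Num.min x n%:R).
have mtr n : measurable_fun [set: R] (tr n).
  by apply: measurable_maxr => //; exact: measurable_minr.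
have trb n x : `|tr n x| <= n%:R.
  by rewrite /tr ler_norml le_max lexx/= ge_max ge_min lexx orbT andbT ge0_cp.
have trx n x : `|tr n x| <= `|x|.
  rewrite /tr; have n0 : 0 <= n%:R :> R by [].
  have [xn|xn] := leP x n%:R; have [xm|xm] := leP (- n%:R) x.
  - by [].
  - by rewrite normrN (ger0_norm n0) ltr0_norm; lra.
  - by rewrite max_r; [rewrite (ger0_norm n0) ger0_norm; lra|lra].
  - by rewrite max_r; [rewrite (ger0_norm n0) ger0_norm; lra|lra].
have trE x : tr n x @[n --> \oo] --> x.
  apply: cvg_near_cst; near=> n.
  have : `|x| <= n%:R by near: n; exact: nbhs_infty_ger.
  by rewrite ler_norml /tr => /andP[h1 h2]; rewrite min_l// max_r.
have mXY Z n : L1 Z -> measurable_fun [set: T] (tr n \o Z).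
  by move=> iZ; apply: measurableT_comp (mtr n) (L1_mf iZ).
have bnd n : Ex (fun w => tr n (X w) * tr n (Y w)) = Ex (tr n \o X) * Ex (tr n \o Y).
  have [iXn iYn] : L1 (tr n \o X) /\ L1 (tr n \o Y).
    by split; apply: (L1_bounded (c := n%:R)) => [|w]; [exact: mXY|exact: trb|exact: mXY|exact: trb].
  rewrite (@indep_Ex_bounded X Y mX mY hXY (fun z => tr n z.1 * tr n z.2) (n%:R * n%:R)).
  - rewrite mulrC -(ExZ _ iXn); apply: eq_Ex => w /=; rewrite ExZ//; exact: mulrC.
  - by apply: measurable_funM; apply: measurableT_comp.
  - by move=> z; rewrite normrM ler_pM.
have c1 : Ex (fun w => tr n (X w) * tr n (Y w)) @[n --> \oo] --> Ex (fun w => X w * Y w).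
  apply: (@Ex_cvg _ _ (fun w => `|X w * Y w|)).
  - by move=> n; apply: measurable_funM; exact: mXY.
  - exact: L1_mf.
  - by apply: nearW => w; apply: cvgM; exact: trE.
  - by move=> n w; rewrite !normrM ler_pM.
  - exact: L1_norm.
have cZ Z : L1 Z -> Ex (tr n \o Z) @[n --> \oo] --> Ex Z.
  move=> iZ; apply: (@Ex_cvg _ _ (fun w => `|Z w|)).
  - by move=> n; exact: mXY.
  - exact: L1_mf.
  - by apply: nearW => w; exact: trE.
  - by move=> n w; exact: trx.
  - exact: L1_norm.
rewrite (_ : (fun n => _) = (fun n => Ex (tr n \o X) * Ex (tr n \o Y))) in c1; last first.
  by apply/funext.
by apply: (cvg_unique _ c1) => //; apply: cvgM; exact: cZ.
Unshelve. all: by end_near. Qed.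
End Expectation.

(** * Integrals against the possibly degenerate normal law, and normal random variables *)

Section NormalMoments.
Context (R : realType).
Local Notation mu := (@lebesgue_measure R).

Lemma normal_law_integral (m v : R) (f : R -> R) : 0 < v ->
  measurable_fun [set: R] f -> (forall x, 0 <= f x) ->
  mu.-integrable [set: R] (EFin \o (fun x : R => f x * normal_pdf m (Num.sqrt v) x)) ->
  (\int[normal_law m v]_x (f x)%:E = (\int[mu]_x (f x * normal_pdf m (Num.sqrt v) x))%:E)%E.
Proof.
move=> v0 mf f0 ifq; rewrite /normal_law gt_eqF// ge0_integral_normal_prob//.
- rewrite /Rintegral fineK; last exact: integrable_fin_num.
  by apply: eq_integral => x _; rewrite EFinM.
- exact/measurable_EFinP.
Qed.

Lemma dirac_integral (m : R) (f : R -> R) : measurable_fun [set: R] f ->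
  (\int[normal_law m 0]_x (f x)%:E = (f m)%:E)%E.
Proof.
move=> mf; rewrite /normal_law eqxx integral_dirac//.
  by rewrite diracT mul1e.
exact/measurable_EFinP.
Qed.

(** Integrals are transferred to random variables for nonnegative functions only. The shifted square
    is there to recover the mean, from [E (X - m + 1)^2 = v + 2 (E X - m) + 1]. *)
Lemma normal_law_moments (m v : R) : 0 <= v ->
  [/\ (\int[normal_law m v]_x ((x - m) ^+ 2)%:E = v%:E)%E,
      (\int[normal_law m v]_x ((x - m) ^+ 4)%:E = (3 * v ^+ 2)%:E)%E &
      (\int[normal_law m v]_x ((x - m + 1) ^+ 2)%:E = (v + 1)%:E)%E].
Proof.
have mp (k : nat) (c : R) : measurable_fun [set: R] (fun x : R => (x - m + c) ^+ k).
  by apply: measurable_funX; apply: measurable_funD => //; apply: measurable_funB.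
have mp0 (k : nat) : measurable_fun [set: R] (fun x : R => (x - m) ^+ k).
  by apply: measurable_funX; apply: measurable_funB.
rewrite le_eqVlt => /predU1P[<-|v0].
  by rewrite !dirac_integral// subrr; split; congr (_%:E); ring.
pose s : R := Num.sqrt v; have s0 : s != 0 by rewrite gt_eqF// sqrtr_gt0.
have s2 : s ^+ 2 = v by rewrite sqr_sqrtr// ltW.
have i k : (k <= 4)%N ->
    mu.-integrable [set: R] (EFin \o (fun x : R => (x - m) ^+ k * normal_pdf m s x)).
  exact: integrable_pow_normal_pdf.
have m0 : \int[mu]_x ((x - m) ^+ 0 * normal_pdf m s x) = 1.
  rewrite /Rintegral (_ : (\int[mu]_x _)%E = 1%E)// -(integral_normal_pdf m s).
  by apply: eq_integral => x _; rewrite expr0 mul1r.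
have m2 : \int[mu]_x ((x - m) ^+ 2 * normal_pdf m s x) = v.
  by rewrite (normal_pdf_moment_rec m s0)// m0 s2 !mulr1.
have m4 : \int[mu]_x ((x - m) ^+ 4 * normal_pdf m s x) = 3 * v ^+ 2.
  by rewrite (normal_pdf_moment_rec m s0)// m2 s2; ring.
have m1 := normal_pdf_moment1 m s0.
have i1 : mu.-integrable [set: R] (EFin \o (fun x : R => (x - m) * normal_pdf m s x)).
  exact: (i 1%N).
have i0 : mu.-integrable [set: R] (EFin \o (fun x : R => (x - m) ^+ 0 * normal_pdf m s x)).
  exact: (i 0%N).
have i3 := integrableD measurableT (i 2%N isT) (integrableD measurableT (integrableZl measurableT 2 i1) i0).
have e x : (x - m + 1) ^+ 2 * normal_pdf m s x = (x - m) ^+ 2 * normal_pdf m s x +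
  (2 * ((x - m) * normal_pdf m s x) + (x - m) ^+ 0 * normal_pdf m s x) by ring.
split.
- by rewrite normal_law_integral// ?m2// => [x|]; [exact: sqr_ge0|exact: i].
- by rewrite normal_law_integral// ?m4// => [x|]; [rewrite exprn_even_ge0|exact: i].
- rewrite normal_law_integral//; last 2 first.
  + by move=> x; exact: sqr_ge0.
  + by rewrite (_ : (fun x => _) = (fun x => (x - m) ^+ 2 * normal_pdf m s x +
      (2 * ((x - m) * normal_pdf m s x) + (x - m) ^+ 0 * normal_pdf m s x)))//; apply/funext.
  + congr (_%:E); under eq_Rintegral do rewrite e.
    rewrite RintegralD//; last 2 first.
    * exact: (i 2%N).
    * exact: (integrableD measurableT (integrableZl measurableT 2 i1) i0).
    rewrite RintegralD//; last exact: (integrableZl measurableT 2 i1).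
    by rewrite RintegralZl// m0 m1 m2; ring.
Qed.

End NormalMoments.

Section NormalVariables.
Context d (T : measurableType d) (R : realType) (P : probability T R).
Implicit Types (X Y : T -> R).
Local Notation Ex := (Ex P).

Lemma ge0_integral_normal_law X (m v : R) (f : R -> R) :
  measurable_fun [set: T] X -> has_normal_law P X m v ->
  measurable_fun [set: R] f -> (forall x, 0 <= f x) ->
  (\int[P]_w (f (X w))%:E = \int[normal_law m v]_x (f x)%:E)%E.
Proof.
move=> mX hX mf f0; pose X' : {mfun T >-> measurableTypeR R} := @mfun_Sub _ _ T (measurableTypeR R) X (mem_set mX).
transitivity (\int[distribution P X']_x (f x)%:E)%E; last first.
  by apply: eq_measure_integral => A mA _; exact: hX.
rewrite ge0_integral_distribution//.
exact/measurable_EFinP.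
Qed.

Lemma L4_normal X (m v : R) : measurable_fun [set: T] X -> has_normal_law P X m v -> 0 <= v ->
  [/\ L4 P X, Ex X = m, Ex (fun w => (X w - m) ^+ 2) = v &
      Ex (fun w => (X w - m) ^+ 4) = 3 * v ^+ 2].
Proof.
move=> mX hX v0; have [h2 h4 h3] := normal_law_moments m v0.
have mp (k : nat) (c : R) : measurable_fun [set: R] (fun x : R => (x - m + c) ^+ k).
  by apply: measurable_funX; apply: measurable_funD => //; apply: measurable_funB.
have mp0 (k : nat) : measurable_fun [set: R] (fun x : R => (x - m) ^+ k).
  by apply: measurable_funX; apply: measurable_funB.
have [||||i2 e2] := @ge0_L1 _ _ _ P (fun w => (X w - m) ^+ 2) v%:E => //.
- exact: measurableT_comp (mp0 2%N) mX.
- by move=> w; exact: sqr_ge0.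
- by rewrite (ge0_integral_normal_law (f := fun x => (x - m) ^+ 2) mX hX)// => x; exact: sqr_ge0.
have [||||i4 e4] := @ge0_L1 _ _ _ P (fun w => (X w - m) ^+ 4) (3 * v ^+ 2)%:E => //.
- exact: measurableT_comp (mp0 4%N) mX.
- by move=> w; rewrite exprn_even_ge0.
- by rewrite (ge0_integral_normal_law (f := fun x => (x - m) ^+ 4) mX hX)// => x; rewrite exprn_even_ge0.
have [||||i3 e3] := @ge0_L1 _ _ _ P (fun w => (X w - m + 1) ^+ 2) (v + 1)%:E => //.
- exact: measurableT_comp (mp 2%N 1) mX.
- by move=> w; exact: sqr_ge0.
- by rewrite (ge0_integral_normal_law (f := fun x => (x - m + 1) ^+ 2) mX hX)// => x; exact: sqr_ge0.
have l4 : L4 P (fun w => X w - m) by split => //; apply: measurable_funB.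
have lX : L4 P X.
  by have := L4D l4 (L4_cst P m); under eq_fun do rewrite subrK.
split => //.
have iX := L1_L4 lX; have ic := L1_L4 l4.
have : Ex (fun w => (X w - m + 1) ^+ 2) = v + 2 * (Ex X - m) + 1.
  rewrite /= in e2; rewrite -{1}e2 (_ : Ex X - m = Ex (fun w => X w - m)); last by rewrite ExB// ?Ex_cst//; exact: L1_cst.
  rewrite -ExZ// -[X in _ = _ + X](Ex_cst P 1) -ExD//; last exact: L1Z.
  rewrite -ExD//; [|by apply: L1D => //; exact: L1Z|exact: L1_cst].
  by apply: eq_Ex => w; ring.
by rewrite e3 /= => h; lra.
Qed.

End NormalVariables.

Lemma cvgM_eq0 (R : realType) (c : R) (u : nat -> R) : u n @[n --> \oo] --> (0 : R) ->
  c * u n @[n --> \oo] --> (0 : R).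
Proof. by move=> u0; rewrite -[X in _ --> X](mulr0 c); apply: cvgM u0; exact: cvg_cst. Qed.

(** * Law of large numbers in quadratic mean under decaying covariances *)

Section LawOfLargeNumbers.
Context d (T : measurableType d) (R : realType) (P : probability T R).
Implicit Types (X Y : T -> R) (U V Z : nat -> T -> R).
Local Notation Ex := (Ex P).
Local Notation L1 := (L1 P).

Definition L2to0 U : Prop := [/\ forall n, measurable_fun [set: T] (U n),
  forall n, L1 (fun w => U n w ^+ 2) & Ex (fun w => U n w ^+ 2) @[n --> \oo] --> (0 : R)].

Lemma sqrD_le (a b : R) : (a + b) ^+ 2 <= 2 * a ^+ 2 + 2 * b ^+ 2.
Proof. by have := sqr_ge0 (a - b); rewrite sqrrB sqrrD; lra. Qed.

Lemma Ex_le_L2to0 U (e : nat -> R) : (forall n, measurable_fun [set: T] (U n)) ->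
  (forall n, L1 (fun w => U n w ^+ 2)) ->
  (forall n, Ex (fun w => U n w ^+ 2) <= e n) -> e n @[n --> \oo] --> (0 : R) -> L2to0 U.
Proof.
move=> mU iU Ue e0; split => //.
apply: (@squeeze_cvgr _ _ _ _ (fun=> 0) e) => //; last exact: cvg_cst.
by apply: nearW => n; rewrite Ue andbT; apply: Ex_ge0 => w; exact: sqr_ge0.
Qed.

Lemma L2to0D U V : L2to0 U -> L2to0 V -> L2to0 (fun n w => U n w + V n w).
Proof.
move=> [mU iU U0] [mV iV V0].
have iUV n : L1 (fun w => 2 * U n w ^+ 2 + 2 * V n w ^+ 2) by apply: L1D; exact: L1Z.
have mS n : measurable_fun [set: T] (fun w => U n w + V n w) by exact: measurable_funD.
have i n : L1 (fun w => (U n w + V n w) ^+ 2).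
  apply: L1_le (iUV n); first exact: measurable_funX.
  by move=> w; rewrite ger0_norm ?sqr_ge0// sqrD_le.
apply: (@Ex_le_L2to0 _ (fun n => 2 * Ex (fun w => U n w ^+ 2) + 2 * Ex (fun w => V n w ^+ 2))) => //.
- move=> n; rewrite -!ExZ// -ExD; [|exact: L1Z|exact: L1Z].
  by apply: Ex_le => // w; exact: sqrD_le.
- by rewrite (_ : 0 = 2 * 0 + 2 * 0 :> R); [apply: cvgD; apply: cvgMr|lra].
Qed.

Lemma L2to0Z (c : R) U : L2to0 U -> L2to0 (fun n w => c * U n w).
Proof.
move=> [mU iU U0]; split => [n|n|].
- exact: measurable_funM.
- by under eq_fun do rewrite exprMn; exact: L1Z.
- rewrite (_ : (fun n => _) = (fun n => c ^+ 2 * Ex (fun w => U n w ^+ 2))).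
    by rewrite (_ : 0 = c ^+ 2 * 0 :> R); [apply: cvgMr|rewrite mulr0].
  by apply/funext => n; rewrite -ExZ//; apply: eq_Ex => w; rewrite exprMn.
Qed.

Lemma eq_L2to0 U V : (forall n w, U n w = V n w) -> L2to0 U -> L2to0 V.
Proof. by move=> UV; rewrite (_ : U = V)//; apply/funext => n; apply/funext => w. Qed.

(** When a summand is added, its products with the previous ones have lags [1, ..., n] and
    expectations bounded by the [rho j], so each step costs at most twice the sum of the [rho j]. *)
Lemma Ex_sqr_sum_le Z (rho : nat -> R) n : (forall k l, L1 (fun w => Z k w * Z l w)) ->
  (forall k j, `|Ex (fun w => Z k w * Z (k + j)%N w)| <= rho j) ->
  Ex (fun w => (\sum_(k < n) Z k w) ^+ 2) <= 2 * n%:R * \sum_(j < n) rho j.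
Proof.
move=> iZ hZ; have rho0 j : 0 <= rho j by apply: le_trans (hZ 0%N j).
have iSZ N k : L1 (fun w => (\sum_(l < N) Z l w) * Z k w).
  by under eq_fun do rewrite big_distrl/=; apply: L1_sum => l; exact: iZ.
have iSS N : L1 (fun w => (\sum_(l < N) Z l w) ^+ 2).
  by under eq_fun do rewrite expr2 big_distrr/=; apply: L1_sum => l; exact: iSZ.
elim: n => [|n IH].
  rewrite big_ord0 mulr0 (@eq_Ex _ _ _ _ _ (fun=> 0)) ?Ex_cst// => w.
  by rewrite big_ord0 expr0n.
have -> : Ex (fun w => (\sum_(k < n.+1) Z k w) ^+ 2) = Ex (fun w => (\sum_(k < n) Z k w) ^+ 2) +
    (2 * \sum_(l < n) Ex (fun w => Z l w * Z n w) + Ex (fun w => Z n w * Z n w)).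
  have iS : L1 (fun w => 2 * \sum_(l < n) Z l w * Z n w).
    by apply: L1Z; apply: L1_sum => l; exact: iZ.
  rewrite -Ex_sum => [|l]; last exact: iZ.
  rewrite -ExZ; last by apply: L1_sum => l; exact: iZ.
  rewrite -ExD// -ExD//; last exact: L1D.
  apply: eq_Ex => w; rewrite big_ord_recr/= -big_distrl/=; ring.
have h : \sum_(l < n) Ex (fun w => Z l w * Z n w) <= \sum_(j < n) rho j.+1.
  rewrite [leRHS](reindex_inj rev_ord_inj)/=; apply: ler_sum => l _.
  have := hZ l (n - l)%N; rewrite subnKC ?(ltnW (ltn_ord l))// subnSK//.
  by move=> /(le_trans (ler_norm _)).
have h0 : Ex (fun w => Z n w * Z n w) <= rho 0%N.
  by have := hZ n 0%N; rewrite addn0; exact/le_trans/ler_norm.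
have e : \sum_(j < n.+1) rho j = rho 0%N + \sum_(j < n) rho j.+1 by rewrite big_ord_recl.
have e' : \sum_(j < n.+1) rho j = \sum_(j < n) rho j + rho n by rewrite big_ord_recr.
have := rho0 0%N; have := rho0 n => r1 r2; rewrite -[n.+1%:R]natr1.
have : n%:R * \sum_(j < n) rho j <= n%:R * \sum_(j < n.+1) rho j.
  by apply: ler_wpM2l => //; rewrite e'; lra.
rewrite -mulrA in IH; move: (\sum_(j < n.+1) rho j) e e' => S e e' h1.
have -> : 2 * (n%:R + 1) * S = 2 * (n%:R * S) + 2 * S by ring.
lra.
Qed.

(** Dividing by [n^2] leaves twice the Cesaro mean of [rho], which tends to 0 with [rho]. Cesaro
    means tolerate covariances that are not summable, as those of fractional Brownian increments
    with [H > 1/2]. *)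
Lemma L2_lln Z (rho : nat -> R) : (forall k, measurable_fun [set: T] (Z k)) ->
  (forall k l, L1 (fun w => Z k w * Z l w)) ->
  (forall k j, `|Ex (fun w => Z k w * Z (k + j)%N w)| <= rho j) ->
  rho j @[j --> \oo] --> (0 : R) ->
  L2to0 (fun n w => n%:R^-1 * \sum_(k < n) Z k w).
Proof.
move=> mZ iZ hZ rho0.
have iSS N : L1 (fun w => (\sum_(l < N) Z l w) ^+ 2).
  under eq_fun do rewrite expr2 big_distrr/=; apply: L1_sum => l.
  by under eq_fun do rewrite big_distrl/=; apply: L1_sum => k; exact: iZ.
apply: (@Ex_le_L2to0 _ (fun n => 2 * (n%:R^-1 * \sum_(j < n) rho j))).
- by move=> n; apply: measurable_funM => //; exact: measurable_sum.
- by move=> n; under eq_fun do rewrite exprMn; exact: L1Z.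
- move=> n; under eq_Ex do rewrite exprMn; rewrite ExZ//.
  case: n => [|n]; first by rewrite invr0 expr0n !mul0r mulr0.
  rewrite exprVn ler_pdivrMl; last by rewrite exprn_gt0.
  apply: le_trans (Ex_sqr_sum_le n.+1 iZ hZ) _.
  rewrite le_eqVlt; apply/orP; left; apply/eqP.
  by have : n.+1%:R != 0 :> R by []; move: (n.+1%:R) => t t0; field.
- suff c : n%:R^-1 * \sum_(j < n) rho j @[n --> \oo] --> (0 : R).
    exact: cvgM_eq0.
  rewrite -cvg_shiftS/=; have := cesaro rho0.
  by rewrite /arithmetic_mean /series/=; under eq_fun do rewrite /= big_mkord.
Qed.

End LawOfLargeNumbers.

(** * Increments of Brownian and fractional Brownian motion *)

Section Independence.
Context d (T : measurableType d) (R : realType) (P : probability T R).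

Lemma mutually_independent2 (I : eqType) (G : I -> set (set T)) i j (A B : set T) :
  mutually_independent P G -> i != j -> G i A -> G j B -> P (A `&` B) = (P A * P B)%E.
Proof.
move=> hG ij GA GB; have := hG [:: i; j] (fun k => if k == i then A else B).
have ji : (j == i) = false by rewrite eq_sym (negbTE ij).
rewrite !big_cons !big_nil/= eqxx ji mule1 => <-.
- congr (P _); apply/seteqP; split=> [w [Aw Bw] k /=|w hw].
    by rewrite !inE => /orP[]/eqP->; rewrite ?eqxx ?ji.
  have := hw i; have := hw j; rewrite /= !inE !eqxx ji orbT => hj hi.
  by split; [exact: hi|exact: hj].
- by rewrite inE ij.
- by move=> k; rewrite !inE => /orP[]/eqP->; rewrite ?eqxx ?ji.
Qed.

Lemma g_sigma_algebra_preimageP (X : T -> R) (A : set R) : measurable A ->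
  g_sigma_algebra_preimage X (X @^-1` A).
Proof. by move=> mA; exists A => //; rewrite setTI. Qed.

Lemma mutually_independent_indep (I : eqType) (X : I -> T -> R) i j :
  mutually_independent P (fun i => g_sigma_algebra_preimage (X i)) -> i != j ->
  indep P (X i) (X j).
Proof.
by move=> hX ij A B mA mB; apply: (mutually_independent2 hX ij);
  exact: g_sigma_algebra_preimageP.
Qed.

Definition sigma_measurable (G : set (set T)) (X : T -> R) :=
  forall A : set R, measurable A -> G (X @^-1` A).

Section SigmaFamily.
Context (J : Type) (D : set J) (X : J -> T -> R).
Let S := g_sigma_algebraType (\bigcup_(j in D) g_sigma_algebra_preimage (X j)).

(** This is ordinary measurability on [T] retyped with the generated sigma-algebra, so the closure
    lemmas for measurable functions carry over. *)
Lemma sigma_familyE (Y : T -> R) :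
  sigma_measurable (sigma_family D X) Y <-> measurable_fun [set: S] (Y : S -> R).
Proof.
split=> [h _ A mA|h A mA]; first by rewrite setTI; exact: h.
by have := h measurableT A mA; rewrite setTI.
Qed.

Lemma sigma_family_incl j : D j -> sigma_measurable (sigma_family D X) (X j).
Proof.
move=> Dj A mA; apply: sub_gen_smallest; exists j => //.
exact: g_sigma_algebra_preimageP.
Qed.

Lemma sigma_familyB (Y Z : T -> R) : sigma_measurable (sigma_family D X) Y ->
  sigma_measurable (sigma_family D X) Z ->
  sigma_measurable (sigma_family D X) (fun w => Y w - Z w).
Proof. by move=> /sigma_familyE mY /sigma_familyE mZ; apply/sigma_familyE/measurable_funB. Qed.

Lemma sigma_familyM (Y Z : T -> R) : sigma_measurable (sigma_family D X) Y ->
  sigma_measurable (sigma_family D X) Z ->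
  sigma_measurable (sigma_family D X) (fun w => Y w * Z w).
Proof. by move=> /sigma_familyE mY /sigma_familyE mZ; apply/sigma_familyE/measurable_funM. Qed.

End SigmaFamily.

Lemma independent_processes_indep (I : eqType) (W : I -> R -> {RV P >-> R}) i j (X Y : T -> R) :
  mutually_independent_processes W -> i != j ->
  sigma_measurable (sigma_family [set t | 0 <= t] (W i)) X ->
  sigma_measurable (sigma_family [set t | 0 <= t] (W j)) Y -> indep P X Y.
Proof.
by move=> hW ij hX hY A B mA mB; apply: (mutually_independent2 hW ij); [exact: hX|exact: hY].
Qed.

End Independence.

(** * Laws of large numbers for increments over multiples of the time step *)

Section Increments.
Context d (T : measurableType d) (R : realType) (P : probability T R).
Variable h : R.
Hypothesis h0 : 0 < h.
Local Notation Ex := (Ex P).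
Local Notation L1 := (L1 P).
Local Notation L4 := (L4 P).
Local Notation L2to0 := (L2to0 P).

Definition step_incr (p : R -> T -> R) (r k : nat) (w : T) : R :=
  p ((k + r)%:R * h) w - p (k%:R * h) w.

Let time_ge0 k : 0 <= k%:R * h.
Proof. by rewrite mulr_ge0// ltW. Qed.
Hint Resolve time_ge0 : core.

Let time_le k l : (k <= l)%N -> k%:R * h <= l%:R * h.
Proof. by move=> kl; rewrite ler_wpM2r ?ler_nat// ltW. Qed.

Lemma measurable_step_incr (W : R -> {RV P >-> R}) r k : measurable_fun [set: T] (step_incr W r k).
Proof. exact: measurable_funB. Qed.

Lemma sigma_measurable_step_incr (W : R -> {RV P >-> R}) r k :
  sigma_measurable (sigma_family [set t | 0 <= t] W) (step_incr W r k).
Proof. by apply: sigma_familyB; apply: (sigma_family_incl (X := W)) => /=. Qed.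

Lemma normr_ExM_le (X Y : T -> R) : L1 (fun w => X w ^+ 2) -> L1 (fun w => Y w ^+ 2) ->
  L1 (fun w => X w * Y w) ->
  `|Ex (fun w => X w * Y w)| <= 2^-1 * (Ex (fun w => X w ^+ 2) + Ex (fun w => Y w ^+ 2)).
Proof.
move=> i1 i2 i3; apply: le_trans (normr_Ex_le i3) _.
rewrite -ExD// -ExZ; last exact: L1D.
apply: Ex_le; [exact: L1_norm|by apply: L1Z; exact: L1D|move=> w].
rewrite normrM -[X w ^+ 2]real_normK ?num_real// -[Y w ^+ 2]real_normK ?num_real//.
by have := sqr_ge0 (`|X w| - `|Y w|); rewrite sqrrB; lra.
Qed.

Section Brownian.
Variable W : R -> {RV P >-> R}.
Hypothesis W_bm : brownian_motion W.

Let W_normal (s t : R) : 0 <= s -> s <= t -> has_normal_law P (fun w => W t w - W s w) 0 (t - s).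
Proof. by case: W_bm => _ + _ _; apply. Qed.

Lemma bm_moments (s t : R) : 0 <= s -> s <= t -> [/\ L4 (fun w => W t w - W s w),
  Ex (fun w => W t w - W s w) = 0, Ex (fun w => (W t w - W s w) ^+ 2) = t - s &
  Ex (fun w => (W t w - W s w) ^+ 4) = 3 * (t - s) ^+ 2].
Proof.
move=> s0 st; have mI : measurable_fun [set: T] (fun w => W t w - W s w) by exact: measurable_funB.
have [|i e1 e2 e4] := L4_normal mI (W_normal s0 st); first by rewrite subr_ge0.
split=> //.
- by rewrite -[RHS]e2; apply: eq_Ex => w; rewrite subr0.
- by rewrite -[RHS]e4; apply: eq_Ex => w; rewrite subr0.
Qed.

Lemma bm_indep (a b c e : R) : 0 <= a -> a <= b -> b <= c -> c <= e ->
  indep P (fun w => W b w - W a w) (fun w => W e w - W c w).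
Proof.
move=> a0 ab bc ce; case: W_bm => _ _ W_ind _.
(* The default value [e] makes the sequence constant from index 3 on, hence monotone; increments
   number 0 and 2 are the two in question. *)
pose t i : R := nth e [:: a; b; c] i.
have /= := W_ind 3%N t a0.
have ht : {homo t : i j / (i <= j)%N >-> i <= j}.
  by case=> [|[|[|i]]]; case=> [|[|[|j]]]//= _; rewrite /t/= ?nth_nil ?(le_trans ab)// ?(le_trans bc)//.
move=> /(_ ht) hh.
have := @mutually_independent_indep _ _ _ P _ (fun (i : 'I_3) w => W (t i.+1) w - W (t i) w) ord0 (Ordinal (erefl (2 < 3)%N)) hh.
exact.
Qed.

Lemma bm_incr_moments r k : let X := step_incr W r k in
  [/\ L4 X, Ex X = 0, Ex (fun w => X w ^+ 2) = r%:R * h &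
      Ex (fun w => X w ^+ 4) = 3 * (r%:R * h) ^+ 2].
Proof.
have e : (k + r)%:R * h - k%:R * h = r%:R * h by rewrite natrD; ring.
have := @bm_moments (k%:R * h) ((k + r)%:R * h); rewrite e; apply => //.
by apply: time_le; rewrite leq_addr.
Qed.

Lemma bm_incr_indep r k j : (r <= j)%N -> indep P (step_incr W r k) (step_incr W r (k + j)).
Proof.
move=> rj; apply: bm_indep => //; apply: time_le; rewrite ?leq_addr//.
by rewrite leq_add2l.
Qed.

(** Increments over [r] steps are independent once the lag reaches [r]; for the finitely many
    smaller lags the mean of the two variances is a bound. *)
Lemma Ex_bm_incrM r k j :
  `|Ex (fun w => step_incr W r k w * step_incr W r (k + j) w)| <= (j < r)%N%:R * (r%:R * h).
Proof.
have [i e1 e2 _] := bm_incr_moments r k; have [i' e1' e2' _] := bm_incr_moments r (k + j).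
have [jr|rj] := ltnP j r.
  rewrite mul1r; apply: le_trans (normr_ExM_le _ _ _) _; [exact: L1_sqr|exact: L1_sqr|exact: L1_prod2|].
  by rewrite e2 e2'; lra.
by rewrite indep_ExM ?e1 ?mul0r ?normr0//; [exact: L1_L4|exact: L1_L4|exact: L1_prod2|exact: bm_incr_indep].
Qed.

Lemma indicator_cvg0 (r : nat) (c : R) : (j < r)%N%:R * c @[j --> \oo] --> (0 : R).
Proof.
apply: cvg_near_cst; near=> j; have : (r <= j)%N by near: j; exact: nbhs_infty_ge.
by rewrite ltnNge => ->; rewrite mul0r.
Unshelve. all: by end_near. Qed.

Lemma bm_incr_lln r s : L2to0 (fun n w => n%:R^-1 * \sum_(k < n) step_incr W r (k + s) w).
Proof.
apply: (@L2_lln _ _ _ _ (fun k => step_incr W r (k + s)) (fun j => (j < r)%N%:R * (r%:R * h))).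
- by move=> k; exact: measurable_step_incr.
- by move=> k l; apply: L1_prod2; [have [] := bm_incr_moments r (k + s)|have [] := bm_incr_moments r (l + s)].
- by move=> k j; rewrite -addnA (addnC j) addnA; exact: Ex_bm_incrM.
- exact: indicator_cvg0.
Qed.

Lemma L1_centered_sqrM (X Y : T -> R) (v : R) : L4 X -> L4 Y ->
  L1 (fun w => (X w ^+ 2 - v) * (Y w ^+ 2 - v)).
Proof.
move=> iX iY; have e w : (X w ^+ 2 - v) * (Y w ^+ 2 - v) =
  X w * X w * Y w * Y w - v * X w ^+ 2 - v * Y w ^+ 2 + v ^+ 2 by ring.
under eq_fun do rewrite e; apply: L1D; last exact: L1_cst.
apply: L1B; last by apply: L1Z; exact: L1_sqr.
by apply: L1B; [exact: L1_prod4|apply: L1Z; exact: L1_sqr].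
Qed.

Lemma Ex_centered_sqrM (X Y : T -> R) (v : R) : L4 X -> L4 Y ->
  Ex (fun w => X w ^+ 2) = v -> Ex (fun w => Y w ^+ 2) = v ->
  Ex (fun w => (X w ^+ 2 - v) * (Y w ^+ 2 - v)) = Ex (fun w => X w ^+ 2 * Y w ^+ 2) - v ^+ 2.
Proof.
move=> iX iY eX eY; have i2 := L1_sqr iX; have i3 := L1_sqr iY.
have i4 : L1 (fun w => X w ^+ 2 * Y w ^+ 2).
  by have := L1_prod4 iX iX iY iY; congr L1; apply/funext => w; ring.
have -> : Ex (fun w => (X w ^+ 2 - v) * (Y w ^+ 2 - v)) =
  Ex (fun w => X w ^+ 2 * Y w ^+ 2 - v * X w ^+ 2 - v * Y w ^+ 2 + v ^+ 2).
  by apply: eq_Ex => w; ring.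
rewrite ExD; [|by apply: L1B; [apply: L1B => //|]; exact: L1Z|exact: L1_cst].
rewrite ExB; [|by apply: L1B => //; exact: L1Z|exact: L1Z].
rewrite ExB//; last exact: L1Z.
by rewrite (ExZ v i2) (ExZ v i3) eX eY Ex_cst; ring.
Qed.

Lemma bm_incr_sqr_lln r s :
  L2to0 (fun n w => n%:R^-1 * \sum_(k < n) (step_incr W r (k + s) w ^+ 2 - r%:R * h)).
Proof.
set v := r%:R * h.
apply: (@L2_lln _ _ _ _ (fun k w => step_incr W r (k + s) w ^+ 2 - v) (fun j => (j < r)%N%:R * (2 * v ^+ 2))).
- by move=> k; apply: measurable_funB => //; apply: measurable_funX; exact: measurable_step_incr.
- by move=> k l; apply: L1_centered_sqrM; [have [] := bm_incr_moments r (k + s)|have [] := bm_incr_moments r (l + s)].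
- move=> k j; rewrite -addnA (addnC j) addnA; move: (k + s)%N => {s}k.
  have [i e1 e2 e4] := bm_incr_moments r k; have [i' e1' e2' e4'] := bm_incr_moments r (k + j).
  have [jr|rj] := ltnP j r.
    rewrite mul1r; apply: le_trans (normr_ExM_le _ _ _) _; do ?exact: L1_centered_sqrM.
    rewrite (_ : Ex _ = 2 * v ^+ 2); last first.
      rewrite (Ex_centered_sqrM i i e2 e2) -[RHS](_ : 3 * v ^+ 2 - v ^+ 2 = _); last by ring.
      by rewrite -e4; congr (_ - _); apply: eq_Ex => w; ring.
    rewrite (_ : Ex _ = 2 * v ^+ 2); last first.
      rewrite (Ex_centered_sqrM i' i' e2' e2') -[RHS](_ : 3 * v ^+ 2 - v ^+ 2 = _); last by ring.
      by rewrite -e4'; congr (_ - _); apply: eq_Ex => w; ring.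
    by lra.
  rewrite (Ex_centered_sqrM i i' e2 e2') indep_ExM ?e2 ?e2' ?subrr ?mul0r ?normr0//;
    [exact: L1_sqr|exact: L1_sqr| |].
    by have := L1_prod4 i i i' i'; congr L1; apply/funext => w; ring.
  have msq : measurable_fun [set: R] (fun x : R => x ^+ 2) by exact: measurable_funX.
  exact: (indep_comp msq msq (bm_incr_indep _ rj)).
- exact: indicator_cvg0.
Qed.

End Brownian.

Section FractionalBrownian.
Variables (H : R) (W : R -> {RV P >-> R}).
Hypotheses (H_gt : 2^-1 < H) (H_lt1 : H < 1).
Hypothesis W_fbm : fractional_brownian_motion H W.

Let p := 2 * H.
Let p_gt1 : 1 < p. Proof. by move: H_gt; rewrite /p => hH; lra. Qed.
Let p_lt2 : p < 2. Proof. by move: H_lt1; rewrite /p => hH; lra. Qed.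

Lemma fbm_L4 (t : R) : 0 <= t -> L4 (W t).
Proof.
move=> t0; case: W_fbm => W_gauss _ _.
have [//|m [v [v0 hv]]] := W_gauss 1%N (fun=> t) (fun=> 1).
have hW : has_normal_law P (W t) m v.
  move: hv; rewrite (_ : (fun w => _) = W t)//.
  by apply/funext => w; rewrite big_ord1 mul1r.
by have [] := L4_normal (measurable_funP (W t)) hW v0.
Qed.

Lemma Ex_fbm (t : R) : 0 <= t -> Ex (W t) = 0.
Proof.
move=> t0; case: W_fbm => _ /(_ t t0) + _; rewrite expectation_Ex; last exact/L1_L4/fbm_L4.
by case.
Qed.

Lemma Ex_fbmM (s t : R) : 0 <= s -> 0 <= t -> Ex (fun w => W s w * W t w) =
  2^-1 * (t `^ p + s `^ p - `|t - s| `^ p).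
Proof.
move=> s0 t0; case: W_fbm => _ W_mean /(_ s t s0 t0).
rewrite unlock !W_mean//= => cov.
have i : L1 (fun w => W s w * W t w) by apply: L1_prod2; exact: fbm_L4.
have := cov; rewrite (_ : (_ * _)%R = (fun w => W s w * W t w)); last first.
  by apply/funext => w /=; rewrite /GRing.mul/= !subr0.
by rewrite (expectation_Ex i) => -[].
Qed.

(** Half a second difference of [t^(2H)] with step [r h] at [t = j h]; the absolute value covers
    overlapping increments, [j < r]. *)
Definition fbm_cov (r j : nat) : R := 2^-1 * (((j + r)%:R * h) `^ p +
  `|j%:R * h - r%:R * h| `^ p - 2 * (j%:R * h) `^ p).

Lemma L4_fbm_incr r k : L4 (step_incr W r k).
Proof. by apply: L4B; exact: fbm_L4. Qed.

Lemma Ex_fbm_incr r k : Ex (step_incr W r k) = 0.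
Proof. by rewrite /step_incr ExB ?Ex_fbm ?subrr//; apply/L1_L4/fbm_L4. Qed.

Lemma Ex_fbm_incrM r k j :
  Ex (fun w => step_incr W r k w * step_incr W r (k + j) w) = fbm_cov r j.
Proof.
have i a b : L1 (fun w => W (a%:R * h) w * W (b%:R * h) w) by apply: L1_prod2; exact: fbm_L4.
transitivity (Ex (fun w => W ((k + r)%:R * h) w * W ((k + j + r)%:R * h) w -
  W ((k + r)%:R * h) w * W ((k + j)%:R * h) w - W (k%:R * h) w * W ((k + j + r)%:R * h) w
  + W (k%:R * h) w * W ((k + j)%:R * h) w)).
  by apply: eq_Ex => w; rewrite /step_incr; ring.
rewrite ExD//; last by apply: L1B => //; exact: L1B.
rewrite ExB//; last exact: L1B.
rewrite ExB// !Ex_fbmM//.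
have -> : (k + j + r)%:R * h - (k + r)%:R * h = j%:R * h by rewrite !natrD; ring.
have -> : (k + j)%:R * h - (k + r)%:R * h = j%:R * h - r%:R * h by rewrite !natrD; ring.
have -> : (k + j + r)%:R * h - k%:R * h = (j + r)%:R * h by rewrite !natrD; ring.
have -> : (k + j)%:R * h - k%:R * h = j%:R * h by rewrite !natrD; ring.
rewrite (ger0_norm (time_ge0 j)) (ger0_norm (time_ge0 (j + r))) /fbm_cov; by field.
Qed.

Lemma fbm_cov0 r : fbm_cov r 0 = (r%:R * h) `^ p.
Proof.
rewrite /fbm_cov mul0r sub0r normrN (ger0_norm (time_ge0 r)) add0n powR0; last first.
  by rewrite gt_eqF// (lt_trans _ p_gt1).
by field.
Qed.

Lemma Ex_fbm_incr_sqr r k : Ex (fun w => step_incr W r k w ^+ 2) = (r%:R * h) `^ p.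
Proof. by rewrite -fbm_cov0 -(Ex_fbm_incrM r k 0) addn0. Qed.

(** A Gaussian process is given through the normality of its linear combinations; two increments
    involve four sample times. A centred normal variable has fourth moment [3 v^2], and the free
    coefficient [b] allows polarization towards mixed moments. *)
Lemma Ex_fbm_incr_comb4 r k l (b : R) :
  let Z w := step_incr W r k w + b * step_incr W r l w in
  Ex (fun w => Z w ^+ 4) = 3 * Ex (fun w => Z w ^+ 2) ^+ 2.
Proof.
move=> Z; case: W_fbm => W_gauss _ _.
have iZ : L4 Z by apply: L4D; [exact: L4_fbm_incr|apply: L4Z; exact: L4_fbm_incr].
pose t (i : 'I_4) : R := nth 0 [:: (k + r)%:R * h; k%:R * h; (l + r)%:R * h; l%:R * h] i.
pose c (i : 'I_4) : R := nth 0 [:: 1; -1; b; - b] i.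
have [|m [v [v0 hv]]] := W_gauss 4%N t c.
  by case; case=> [|[|[|[|]]]]//= ?; rewrite /t/=.
have hZ : has_normal_law P Z m v.
  move: hv; rewrite (_ : (fun w => _) = Z)//.
  by apply/funext => w; rewrite !big_ord_recr big_ord0/= /c /t /Z /step_incr/=; ring.
have [_ em e2 e4] := L4_normal iZ.1 hZ v0.
have m0 : m = 0.
  by rewrite -em /Z ExD ?ExZ ?Ex_fbm_incr ?mulr0 ?addr0//; [exact/L1_L4/L4_fbm_incr
    |exact/L1_L4/L4_fbm_incr|apply/L1Z/L1_L4/L4_fbm_incr].
have <- : v = Ex (fun w => Z w ^+ 2) by rewrite -e2; apply: eq_Ex => w; rewrite m0 subr0.
by rewrite -e4; apply: eq_Ex => w; rewrite m0 subr0.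
Qed.

(* Polarization: [(a + b)^4 + (a - b)^4 = 2 a^4 + 12 a^2 b^2 + 2 b^4]. *)
Lemma Ex_fbm_incr_sqrM r k j :
  Ex (fun w => step_incr W r k w ^+ 2 * step_incr W r (k + j) w ^+ 2) =
  fbm_cov r 0 ^+ 2 + 2 * fbm_cov r j ^+ 2.
Proof.
set X := step_incr W r k; set Y := step_incr W r (k + j).
have iX : L4 X := L4_fbm_incr r k; have iY : L4 Y := L4_fbm_incr r (k + j).
pose Zp w := X w + 1 * Y w; pose Zm w := X w + (-1) * Y w; pose X2 w := X w + 0 * X w.
pose Y2 w := Y w + 0 * Y w.
have iZp : L4 Zp by apply: L4D => //; exact: L4Z.
have iZm : L4 Zm by apply: L4D => //; exact: L4Z.
have ep := Ex_fbm_incr_comb4 r k (k + j) 1; have em := Ex_fbm_incr_comb4 r k (k + j) (-1).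
have eX := Ex_fbm_incr_comb4 r k k 0; have eY := Ex_fbm_incr_comb4 r (k + j) (k + j) 0.
rewrite -/X -/Y /= in ep em eX eY.
have v1 : Ex (fun w => X w ^+ 2) = fbm_cov r 0 by rewrite Ex_fbm_incr_sqr fbm_cov0.
have v2 : Ex (fun w => Y w ^+ 2) = fbm_cov r 0 by rewrite Ex_fbm_incr_sqr fbm_cov0.
have c1 : Ex (fun w => X w * Y w) = fbm_cov r j by rewrite Ex_fbm_incrM.
have q b : Ex (fun w => (X w + b * Y w) ^+ 2) = fbm_cov r 0 + 2 * b * fbm_cov r j + b ^+ 2 * fbm_cov r 0.
  rewrite -{1}v1 -c1 -v2 -ExZ; last exact: L1_prod2.
  rewrite -ExZ; last exact: L1_sqr.
  rewrite -ExD; [|exact: L1_sqr|by apply: L1Z; exact: L1_prod2].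
  rewrite -ExD; [|by apply: L1D; [exact: L1_sqr|apply: L1Z; exact: L1_prod2]|by apply: L1Z; exact: L1_sqr].
  by apply: eq_Ex => w; ring.
have eX' : Ex (fun w => X w ^+ 4) = 3 * fbm_cov r 0 ^+ 2.
  rewrite -v1; transitivity (Ex (fun w => (X w + 0 * X w) ^+ 4)).
    by apply: eq_Ex => w; rewrite mul0r addr0.
  by rewrite eX; congr (_ * _ ^+ 2); apply: eq_Ex => w; rewrite mul0r addr0.
have eY' : Ex (fun w => Y w ^+ 4) = 3 * fbm_cov r 0 ^+ 2.
  rewrite -v2; transitivity (Ex (fun w => (Y w + 0 * Y w) ^+ 4)).
    by apply: eq_Ex => w; rewrite mul0r addr0.
  by rewrite eY; congr (_ * _ ^+ 2); apply: eq_Ex => w; rewrite mul0r addr0.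
rewrite !q in ep em.
have i22 : L1 (fun w => X w ^+ 2 * Y w ^+ 2).
  by have := L1_prod4 iX iX iY iY; congr L1; apply/funext => w; ring.
have : Ex (fun w => (X w + 1 * Y w) ^+ 4 + (X w + (-1) * Y w) ^+ 4) =
  Ex (fun w => 2 * X w ^+ 4 + 12 * (X w ^+ 2 * Y w ^+ 2) + 2 * Y w ^+ 4).
  by apply: eq_Ex => w; ring.
rewrite ExD; [|exact: iZp.2|exact: iZm.2].
rewrite ExD; [|by apply: L1D; apply: L1Z => //; exact: iX.2|by apply: L1Z; exact: iY.2].
rewrite ExD; [|by apply: L1Z; exact: iX.2|exact: L1Z].
rewrite (ExZ _ iX.2) (ExZ _ iY.2) (ExZ _ i22) ep em eX' eY'.
by move: (Ex _) (fbm_cov r 0) (fbm_cov r j) => E v c hE; have : 12 * E = 12 * (v ^+ 2 + 2 * c ^+ 2);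
  [rewrite -[12 * E](addrK (12 * v ^+ 2)); move: hE; rewrite !sqrrD !expr2; lra|lra].
Qed.

Lemma powRN_cvg0 (a : R) : 0 < a -> (n%:R * h) `^ (- a) @[n --> \oo] --> (0 : R).
Proof.
move=> a0; apply/cvgrPdist_lt => e e0; near=> n.
rewrite sub0r normrN ger0_norm ?powR_ge0//.
have nh : ((e^-1 + 1) `^ a^-1) <= n%:R * h.
  by rewrite -ler_pdivrMr//; near: n; exact: nbhs_infty_ger.
have nh0 : 0 < n%:R * h by apply: lt_le_trans nh; rewrite powR_gt0// ltr_wpDl// invr_ge0 ltW.
rewrite powRN invf_plt ?posrE ?powR_gt0//.
apply: (@lt_le_trans _ _ (e^-1 + 1)); first by rewrite ltrDl.
have e1 : 0 <= e^-1 + 1 by rewrite addr_ge0// invr_ge0 ltW.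
have an : a != 0 by rewrite gt_eqF.
rewrite -[leLHS]powRr1// -[X in _ `^ X <= _](mulVf an) powRrM.
by apply: ge0_ler_powR => //; rewrite ?nnegrE ?powR_ge0// ltW.
Unshelve. all: by end_near. Qed.

(** A second difference of [y^p] is bounded by [p (p - 1) u^(p - 2)] times the squared step, [u]
    being the left end of the interval, and [p = 2 H < 2] makes this power tend to 0. *)
Lemma fbm_cov_cvg0 r : fbm_cov r j @[j --> \oo] --> (0 : R).
Proof.
(* The shift by [r + 1] keeps the left end of the interval, [j + 1] steps of size [h], positive. *)
rewrite -(cvg_shiftn r.+1)/=.
pose C := p * (p - 1) * (r%:R * h) ^+ 2.
have c0 : C * (j.+1%:R * h) `^ (- (2 - p)) @[j --> \oo] --> (0 : R).
  apply: cvgM_eq0; have : 0 < 2 - p by rewrite subr_gt0.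
  by move=> /powRN_cvg0 c; rewrite (cvg_shiftS (fun j => (j%:R * h) `^ (- (2 - p)))).
have bnd j : `|fbm_cov r (j + r.+1)| <= C * (j.+1%:R * h) `^ (- (2 - p)).
  set u := j.+1%:R * h; have u0 : 0 < u by rewrite mulr_gt0.
  have tE : (j + r.+1)%:R * h - r%:R * h = u by rewrite /u addnS -addSn natrD; ring.
  have rh := time_ge0 r.
  have := @second_diff_le _ (fun y : R => y `^ p) (fun y => p * y `^ (p - 1))
    (fun y => p * ((p - 1) * y `^ (p - 1 - 1))) ((j + r.+1)%:R * h) (r%:R * h)
    (p * ((p - 1) * u `^ (p - 2))) rh.
  have pE : (j + r.+1 + r)%:R * h = (j + r.+1)%:R * h + r%:R * h.
    by rewrite (natrD _ (j + r.+1)) mulrDl.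
  rewrite /fbm_cov pE tE [`|u|]ger0_norm ?(ltW u0)//.
  move=> bd; rewrite normrM [`|2^-1|]ger0_norm//.
  have p0 : 0 <= p by rewrite ltW// (lt_trans _ p_gt1).
  have p1 : 0 <= p - 1 by rewrite subr_ge0 ltW.
  apply: le_trans (ler_wpM2l _ (bd _ _ _)) _; first by rewrite invr_ge0.
  - by move=> y /andP[y0 _]; apply: is_derive1_powR; exact: lt_le_trans u0 y0.
  - move=> y /andP[y0 _]; have := is_derive1_powR (p - 1) (lt_le_trans u0 y0).
    by move=> dy; apply: is_deriveZ.
  - move=> y /andP[y0 _]; have yy := lt_le_trans u0 y0.
    rewrite ger0_norm; last by do !apply: mulr_ge0 => //; exact: powR_ge0.
    rewrite ler_wpM2l// ler_wpM2l//.
    have -> : p - 1 - 1 = - (2 - p) by ring.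
    have -> : p - 2 = - (2 - p) by ring.
    rewrite !powRN lef_pV2 ?posrE ?powR_gt0//.
    by apply: ge0_ler_powR; rewrite ?nnegrE ?subr_ge0 ?(ltW p_lt2) ?(ltW u0) ?(ltW yy).
  - rewrite /C (_ : - (2 - p) = p - 2); last by ring.
    have : 0 <= p * (p - 1) * (r%:R * h) ^+ 2 * u `^ (p - 2).
      by do !apply: mulr_ge0 => //; exact: powR_ge0.
    set Q := p * (p - 1) * _ * _ => Q0.
    rewrite (_ : p * ((p - 1) * u `^ (p - 2)) * (r%:R * h) ^+ 2 = Q); first by lra.
    by rewrite /Q; ring.
apply/norm_cvg0P; apply: (squeeze_cvgr _ (cvg_cst 0) c0).
by apply: nearW => j; rewrite normr_ge0 bnd.
Qed.

Lemma fbm_incr_lln r s : L2to0 (fun n w => n%:R^-1 * \sum_(k < n) step_incr W r (k + s) w).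
Proof.
apply: (@L2_lln _ _ _ _ (fun k => step_incr W r (k + s)) (fun j => `|fbm_cov r j|)).
- by move=> k; exact: measurable_step_incr.
- by move=> k l; apply: L1_prod2; exact: L4_fbm_incr.
- by move=> k j; rewrite -addnA (addnC j) addnA Ex_fbm_incrM.
- exact/norm_cvg0P/fbm_cov_cvg0.
Qed.

(** By the mixed moment formula, the covariance of two squared increments is twice the square of
    their covariance. *)
Lemma fbm_incr_sqr_lln r s :
  L2to0 (fun n w => n%:R^-1 * \sum_(k < n) (step_incr W r (k + s) w ^+ 2 - (r%:R * h) `^ p)).
Proof.
set v := (r%:R * h) `^ p.
apply: (@L2_lln _ _ _ _ (fun k w => step_incr W r (k + s) w ^+ 2 - v) (fun j => 2 * fbm_cov r j ^+ 2)).
- by move=> k; apply: measurable_funB => //; apply: measurable_funX; exact: measurable_step_incr.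
- by move=> k l; apply: L1_centered_sqrM; exact: L4_fbm_incr.
- move=> k j; rewrite -addnA (addnC j) addnA; move: (k + s)%N => {s}k.
  rewrite (Ex_centered_sqrM (L4_fbm_incr r k) (L4_fbm_incr r (k + j))) ?Ex_fbm_incr_sqr//.
  rewrite Ex_fbm_incr_sqrM fbm_cov0 -/v addrC addKr.
  by rewrite ger0_norm// mulr_ge0// sqr_ge0.
- have c := fbm_cov_cvg0 r; apply: cvgM_eq0.
  by rewrite -[X in _ --> X](mulr0 0); exact: (cvgM c c).
Qed.

End FractionalBrownian.

Section Mixed.
Variables (H : R) (B BH : R -> {RV P >-> R}) (sigma gamma : R).
Hypotheses (H_gt : 2^-1 < H) (H_lt1 : H < 1).
Hypotheses (B_bm : brownian_motion B) (BH_fbm : fractional_brownian_motion H BH).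
Hypothesis B_BH_indep : forall X Y : T -> R,
  sigma_measurable (sigma_family [set t | 0 <= t] B) X ->
  sigma_measurable (sigma_family [set t | 0 <= t] BH) Y -> indep P X Y.

(** By independence of the two motions the covariance of the products is a product of covariances:
    the Brownian factor is bounded, the fractional one tends to 0. *)
Lemma cross_incr_lln r s : L2to0 (fun n w => n%:R^-1 *
  \sum_(k < n) (step_incr B r (k + s) w * step_incr BH r (k + s) w)).
Proof.
have iB k : L4 (step_incr B r k) by have [] := bm_incr_moments B_bm r k.
have iH k : L4 (step_incr BH r k) := L4_fbm_incr BH_fbm r k.
have ii k l : L1 (fun w => (step_incr B r k w * step_incr B r l w) *
    (step_incr BH r k w * step_incr BH r l w)).
  by have := L1_prod4 (iB k) (iB l) (iH k) (iH l); congr L1; apply/funext => w; ring.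
apply: (@L2_lln _ _ _ _ (fun k w => step_incr B r (k + s) w * step_incr BH r (k + s) w)
  (fun j => (r%:R * h) * `|fbm_cov H r j|)).
- by move=> k; apply: measurable_funM; exact: measurable_step_incr.
- move=> k l; have := ii (k + s)%N (l + s)%N.
  by congr L1; apply/funext => w; ring.
- move=> k j; rewrite -addnA (addnC j) addnA; move: (k + s)%N => {s}k.
  rewrite (_ : Ex _ = Ex (fun w => (step_incr B r k w * step_incr B r (k + j) w) *
    (step_incr BH r k w * step_incr BH r (k + j) w))); last by apply: eq_Ex => w; ring.
  rewrite indep_ExM.
  + rewrite (Ex_fbm_incrM BH_fbm) normrM ler_wpM2r//.
    apply: le_trans (Ex_bm_incrM B_bm r k j) _.
    by case: (j < r)%N; rewrite ?mul1r// mul0r.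
  + exact: L1_prod2.
  + exact: L1_prod2.
  + exact: ii.
  + by apply: B_BH_indep; apply: sigma_familyM; exact: sigma_measurable_step_incr.
- by apply: cvgM_eq0; apply/norm_cvg0P; exact: (fbm_cov_cvg0 H_gt H_lt1).
Qed.

Let M t w := sigma * B t w + gamma * BH t w.

Lemma mixed_incr_lln r s : L2to0 (fun n w => n%:R^-1 * \sum_(k < n) step_incr M r (k + s) w).
Proof.
apply: eq_L2to0 (L2to0D (L2to0Z sigma (bm_incr_lln B_bm r s))
  (L2to0Z gamma (fbm_incr_lln H_gt H_lt1 BH_fbm r s))) => n w /=.
rewrite mulrCA [X in _ + X]mulrCA -mulrDr; congr (_ * _).
by rewrite !big_distrr -big_split/=; apply: eq_bigr => k _; rewrite /step_incr /M; ring.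
Qed.

Definition mixed_var r := sigma ^+ 2 * (r%:R * h) + gamma ^+ 2 * (r%:R * h) `^ (2 * H).

Lemma mixed_incr_sqr_lln r s : L2to0 (fun n w => n%:R^-1 *
  \sum_(k < n) (step_incr M r (k + s) w ^+ 2 - mixed_var r)).
Proof.
apply: eq_L2to0 (L2to0D (L2to0Z (sigma ^+ 2) (bm_incr_sqr_lln B_bm r s))
  (L2to0D (L2to0Z (2 * sigma * gamma) (cross_incr_lln r s))
  (L2to0Z (gamma ^+ 2) (fbm_incr_sqr_lln H_gt H_lt1 BH_fbm r s)))) => n w /=.
rewrite mulrCA [X in _ + (X + _)]mulrCA [X in _ + (_ + X)]mulrCA -!mulrDr; congr (_ * _).
rewrite !big_distrr -!big_split/=; apply: eq_bigr => k _.
by rewrite /step_incr /M /mixed_var; ring.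
Qed.

End Mixed.
End Increments.

(** * Limits of the estimators along a path *)

Section PathLimits.
Context (R : realType) (F : set_system nat) {FF : ProperFilter F}.
Hypothesis F_gt0 : \forall n \near F, (0 < n)%N.
Variables (h : R) (h0 : 0 < h).

(** Limits are taken along an arbitrary proper filter on the integers, so that they apply along
    extracted subsequences. *)
Definition mean_incr (p : R -> R) (s r n : nat) : R :=
  n%:R^-1 * \sum_(k < n) (p ((k + s + r)%:R * h) - p ((k + s)%:R * h)).

Definition mean_sqr_incr (p : R -> R) (s r n : nat) : R :=
  n%:R^-1 * \sum_(k < n) (p ((k + s + r)%:R * h) - p ((k + s)%:R * h)) ^+ 2.

Section OnePath.
Variables (M : R -> R) (theta : R) (v : nat -> R) (s r : nat).
Hypothesis M_mean : mean_incr M s r n @[n --> F] --> (0 : R).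
Hypothesis M_sqr : n%:R^-1 *
  \sum_(k < n) ((M ((k + s + r)%:R * h) - M ((k + s)%:R * h)) ^+ 2 - v r) @[n --> F] --> (0 : R).

Lemma mean_incr_drift : mean_incr (fun t => theta * t + M t) s r n @[n --> F] --> theta * (r%:R * h).
Proof.
have c : theta * (r%:R * h) + mean_incr M s r n @[n --> F] --> theta * (r%:R * h) + 0.
  by apply: cvgD => //; exact: cvg_cst.
rewrite addr0 in c; apply: cvg_trans c; apply: near_eq_cvg.
near=> n; have n0 : n%:R != 0 :> R by rewrite pnatr_eq0 -lt0n; near: n.
rewrite /mean_incr/= -[LHS](mulKf n0); congr (_ * _).
rewrite mulrDr (mulVKf n0) -[X in X + _](_ : \sum_(k < n) theta * (r%:R * h) = _).
  by rewrite -big_split/=; apply: eq_bigr => k _; rewrite natrD; ring.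
by rewrite sumr_const card_ord -[LHS]mulr_natl.
Unshelve. all: by end_near. Qed.

Lemma mean_sqr_incr_drift :
  mean_sqr_incr (fun t => theta * t + M t) s r n @[n --> F] --> (theta * (r%:R * h)) ^+ 2 + v r.
Proof.
pose b := theta * (r%:R * h).
have c : b ^+ 2 + v r + (2 * b * mean_incr M s r n + n%:R^-1 *
  \sum_(k < n) ((M ((k + s + r)%:R * h) - M ((k + s)%:R * h)) ^+ 2 - v r)) @[n --> F]
  --> b ^+ 2 + v r + (2 * b * 0 + 0).
  by apply: cvgD; [exact: cvg_cst|apply: cvgD => //; apply: cvgM => //; exact: cvg_cst].
rewrite mulr0 !addr0 in c; apply: cvg_trans c; apply: near_eq_cvg.
near=> n; have n0 : n%:R != 0 :> R by rewrite pnatr_eq0 -lt0n; near: n.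
rewrite /mean_incr /mean_sqr_incr/= -[LHS](mulKf n0); congr (_ * _).
rewrite mulrDr [X in _ + X]mulrDr (mulrCA n%:R (2 * b)) !(mulVKf n0).
rewrite -[X in X + _](_ : \sum_(k < n) (b ^+ 2 + v r) = _); last first.
  by rewrite sumr_const card_ord -[LHS]mulr_natl.
rewrite big_distrr/= -!big_split/=; apply: eq_bigr => k _; rewrite /b natrD; ring.
Unshelve. all: by end_near. Qed.

End OnePath.

Section StatLimits.
Variables (M : R -> R) (theta : R) (v : nat -> R).
Hypothesis M_mean : forall s r, mean_incr M s r n @[n --> F] --> (0 : R).
Hypothesis M_sqr : forall s r, n%:R^-1 *
  \sum_(k < n) ((M ((k + s + r)%:R * h) - M ((k + s)%:R * h)) ^+ 2 - v r) @[n --> F] --> (0 : R).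
Let Y t := theta * t + M t.

Lemma cvg_theta_hat : theta_hat h n Y @[n --> F] --> theta.
Proof.
have c : h^-1 * mean_incr Y 0 1 n @[n --> F] --> h^-1 * (theta * (1%:R * h)).
  by apply: cvgM; [exact: cvg_cst|exact: mean_incr_drift].
have -> : theta = h^-1 * (theta * (1%:R * h)) by field; rewrite gt_eqF.
apply: cvg_trans c; apply: near_eq_cvg; near=> n.
rewrite /theta_hat /mean_incr invfM mulrCA mulrA; congr (_ * _).
by apply: eq_bigr => k _; rewrite /incr addn0 addn1.
Unshelve. all: by end_near. Qed.

Lemma cvg_xi : xi h n Y @[n --> F] --> (theta * h) ^+ 2 + v 1%N.
Proof.
have := @mean_sqr_incr_drift M theta v 0 1 (M_mean _ _) (M_sqr _ _).
rewrite mul1r; apply: cvg_trans; apply: near_eq_cvg; near=> n.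
rewrite /xi /mean_sqr_incr; congr (_ * _).
by apply: eq_bigr => k _; rewrite /incr addn0 addn1.
Unshelve. all: by end_near. Qed.

(* [2 a b = (a + b)^2 - a^2 - b^2] for two adjacent increments *)
Let cvg_lag s : n%:R^-1 * \sum_(k < n)
    (Y ((k + s)%:R * h) - Y (k%:R * h)) * (Y ((k + s + s)%:R * h) - Y ((k + s)%:R * h))
  @[n --> F] --> (theta * (s%:R * h)) ^+ 2 + 2^-1 * (v (s + s)%N - 2 * v s).
Proof.
have sq a b := @mean_sqr_incr_drift M theta v a b (M_mean _ _) (M_sqr _ _).
have c : 2^-1 * (mean_sqr_incr Y 0 (s + s) n - mean_sqr_incr Y 0 s n - mean_sqr_incr Y s s n)
  @[n --> F] --> 2^-1 * (((theta * ((s + s)%:R * h)) ^+ 2 + v (s + s)%N) -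
     ((theta * (s%:R * h)) ^+ 2 + v s) - ((theta * (s%:R * h)) ^+ 2 + v s)).
  apply: cvgM; first exact: cvg_cst.
  by do 2 (apply: cvgB; last exact: sq); exact: sq.
rewrite (_ : (theta * (s%:R * h)) ^+ 2 + _ = 2^-1 * (((theta * ((s + s)%:R * h)) ^+ 2 + v (s + s)%N) -
     ((theta * (s%:R * h)) ^+ 2 + v s) - ((theta * (s%:R * h)) ^+ 2 + v s))); last first.
  by rewrite natrD; field.
apply: cvg_trans c; apply: near_eq_cvg; near=> n.
rewrite /mean_sqr_incr -!mulrBr mulrCA; congr (_ * _).
rewrite -!sumrB big_distrr/=; apply: eq_bigr => k _.
by rewrite addn0 addnA; field.
Unshelve. all: by end_near. Qed.

Lemma cvg_eta : Defs.eta h n Y @[n --> F] --> (theta * h) ^+ 2 + 2^-1 * (v 2%N - 2 * v 1%N).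
Proof.
have := @cvg_lag 1%N; rewrite mul1r; apply: cvg_trans; apply: near_eq_cvg; near=> n.
by congr (_ * _); apply: eq_bigr => k _; rewrite /incr !addn1.
Unshelve. all: by end_near. Qed.

Lemma cvg_zeta : zeta h n Y @[n --> F] --> (theta * (2 * h)) ^+ 2 + 2^-1 * (v 4%N - 2 * v 2%N).
Proof.
have := @cvg_lag 2%N; apply: cvg_trans; apply: near_eq_cvg; near=> n.
by congr (_ * _); apply: eq_bigr => k _; rewrite -addnA !addn2 addn4.
Unshelve. all: by end_near. Qed.

End StatLimits.

Lemma cvg_subject_mean N (a : nat -> nat -> R) (b : nat -> R) :
  (forall i, (i < N)%N -> a n i @[n --> F] --> b i) ->
  subject_mean N (a n) @[n --> F] --> subject_mean N b.
Proof.
move=> ab; apply: cvgM; first exact: cvg_cst.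
suff c K : (K <= N)%N -> \sum_(i < K) a n i @[n --> F] --> \sum_(i < K) b i by exact: c.
elim: K => [_|K IH KN].
  by rewrite big_ord0; under eq_fun do rewrite big_ord0; exact: cvg_cst.
rewrite big_ord_recr/=; under eq_fun do rewrite big_ord_recr/=.
by apply: cvgD; [apply: IH; exact: ltnW|exact: ab].
Qed.

(** * Consistency of the plug-in estimators along a path *)

Section EstimatorLimits.
Variables (N : nat) (M : nat -> R -> R) (theta : nat -> R) (sigma gamma H : R).
Hypotheses (N0 : (0 < N)%N) (gamma0 : 0 < gamma) (H_gt : 2^-1 < H).
Let v r := mixed_var h H sigma gamma r.
Hypothesis M_mean : forall i s r, (i < N)%N -> mean_incr (M i) s r n @[n --> F] --> (0 : R).
Hypothesis M_sqr : forall i s r, (i < N)%N -> n%:R^-1 *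
  \sum_(k < n) ((M i ((k + s + r)%:R * h) - M i ((k + s)%:R * h)) ^+ 2 - v r) @[n --> F] --> (0 : R).
Let Y i t := theta i * t + M i t.

Let W := subject_mean N (fun i => theta i ^+ 2).
(** The covariance of two adjacent one-step increments of the mixed process, positive because
    [H > 1/2]. *)
Let kappa := gamma ^+ 2 * (h `^ (2 * H) * (2 `^ (2 * H - 1) - 1)).

Let pow2_gt1 : 1 < 2 `^ (2 * H - 1) :> R.
Proof.
rewrite -[ltLHS](powRr0 2) /powR gt_eqF//= ltr_expR ltr_pM2r ?ln_gt0 ?ltr1n//.
by rewrite subr_gt0; move: H_gt => hH; lra.
Qed.

Let kappa_gt0 : 0 < kappa.
Proof. by rewrite !mulr_gt0 ?exprn_gt0 ?powR_gt0 ?subr_gt0. Qed.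

Let pow2E : 2 `^ (2 * H) = 2 * 2 `^ (2 * H - 1) :> R.
Proof. by rewrite mulr_powRB1// mulr_gt0//; move: H_gt => hH; lra. Qed.

(** The Brownian part of the variance is linear in the lag and cancels. The fractional part is
    homogeneous of degree [2 H] in [s], hence the factor [2^(2H)] between the limits of the
    corrected [zeta] and [eta] statistics. *)
Let v_lag s : 2^-1 * (v (s + s)%N - 2 * v s) = s%:R `^ (2 * H) * kappa.
Proof.
have hH := ltW h0.
rewrite /v /mixed_var addnn -mul2n natrM -[2 * s%:R * h]mulrA (powRM _ (ltW _)) ?mulr_ge0//.
by rewrite (powRM _ (ler0n _ s)) // pow2E /kappa; field.
Qed.

Let subject_meanD (a : nat -> R) (b : R) : subject_mean N (fun i => a i + b) = subject_mean N a + b.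
Proof.
rewrite /subject_mean big_split/= mulrDr; congr (_ + _).
by rewrite sumr_const card_ord -[X in _ * X]mulr_natl mulKf// pnatr_eq0 -lt0n.
Qed.

Let subject_meanM (c : R) (a : nat -> R) : subject_mean N (fun i => c * a i) = c * subject_mean N a.
Proof. by rewrite /subject_mean -big_distrr/= mulrCA. Qed.

Let cvg_V : V_bar h n N Y @[n --> F] --> W.
Proof.
apply: cvg_subject_mean => i iN.
by apply: cvgM; exact: (cvg_theta_hat (fun s r => M_mean s r iN)).
Qed.

Let cvg_xi_bar : xi_bar h n N Y - h ^+ 2 * V_bar h n N Y @[n --> F] --> v 1%N.
Proof.
have -> : v 1%N = (h ^+ 2 * W + v 1%N) - h ^+ 2 * W by ring.
apply: cvgB; last by apply: cvgM; [exact: cvg_cst|exact: cvg_V].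
rewrite /W -subject_meanM -subject_meanD; apply: cvg_subject_mean => i iN.
have := cvg_xi (theta := theta i) (v := v) (fun s r => M_mean s r iN) (fun s r => M_sqr s r iN).
by rewrite (_ : (theta i * h) ^+ 2 = h ^+ 2 * theta i ^+ 2)//; ring.
Qed.

Let cvg_eta_bar : eta_bar h n N Y - h ^+ 2 * V_bar h n N Y @[n --> F] --> kappa.
Proof.
have -> : kappa = (h ^+ 2 * W + 2^-1 * (v 2%N - 2 * v 1%N)) - h ^+ 2 * W.
  by rewrite (v_lag 1%N) powR1; ring.
apply: cvgB; last by apply: cvgM; [exact: cvg_cst|exact: cvg_V].
rewrite /W -subject_meanM -subject_meanD; apply: cvg_subject_mean => i iN.
have := cvg_eta (theta := theta i) (v := v) (fun s r => M_mean s r iN) (fun s r => M_sqr s r iN).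
by rewrite (_ : (theta i * h) ^+ 2 = h ^+ 2 * theta i ^+ 2)//; ring.
Qed.

Let cvg_zeta_bar : zeta_bar h n N Y - 4 * h ^+ 2 * V_bar h n N Y @[n --> F] --> 2 `^ (2 * H) * kappa.
Proof.
have -> : 2 `^ (2 * H) * kappa = (4 * h ^+ 2 * W + 2^-1 * (v 4%N - 2 * v 2%N)) - 4 * h ^+ 2 * W.
  by rewrite (v_lag 2%N); ring.
apply: cvgB; last by apply: cvgM; [exact: cvg_cst|exact: cvg_V].
rewrite /W -subject_meanM -subject_meanD; apply: cvg_subject_mean => i iN.
have := cvg_zeta (theta := theta i) (v := v) (fun s r => M_mean s r iN) (fun s r => M_sqr s r iN).
by rewrite (_ : (theta i * (2 * h)) ^+ 2 = 4 * h ^+ 2 * theta i ^+ 2)//; ring.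
Qed.

Lemma cvg_H_hat : H_hat h n N Y @[n --> F] --> H.
Proof.
have q0 : 0 < 2 `^ (2 * H) :> R by rewrite powR_gt0.
have cq : (zeta_bar h n N Y - 4 * h ^+ 2 * V_bar h n N Y) /
    (eta_bar h n N Y - h ^+ 2 * V_bar h n N Y) @[n --> F] --> 2 `^ (2 * H).
  rewrite -[X in _ --> X](mulfK (lt0r_neq0 kappa_gt0)).
  by apply: cvgM; [exact: cvg_zeta_bar|apply: cvgV; [exact: lt0r_neq0|exact: cvg_eta_bar]].
have cl : ln ((zeta_bar h n N Y - 4 * h ^+ 2 * V_bar h n N Y) /
    (eta_bar h n N Y - h ^+ 2 * V_bar h n N Y)) / ln 2 @[n --> F] --> ln (2 `^ (2 * H)) / ln 2.
  apply: cvgM; last exact: cvg_cst.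
  by apply: (continuous_cvg _ _ cq); exact: continuous_ln.
have c : 2^-1 * (ln ((zeta_bar h n N Y - 4 * h ^+ 2 * V_bar h n N Y) /
    (eta_bar h n N Y - h ^+ 2 * V_bar h n N Y)) / ln 2) @[n --> F] --> 2^-1 * (ln (2 `^ (2 * H)) / ln 2).
  by apply: cvgM => //; exact: cvg_cst.
have ln2 : ln 2 != 0 :> R by rewrite gt_eqF// ln_gt0// ltr1n.
have -> : H = 2^-1 * (ln (2 `^ (2 * H)) / ln 2) by rewrite ln_powR mulfK//; field.
apply: cvg_trans c; apply: near_eq_cvg; near=> n.
(* The limit of the ratio is positive, so the default value 0 of [log2_plus] is eventually not
   taken. *)
rewrite /H_hat /log2_plus ifT//.
by near: n; exact: (cvgr_gt _ cq).
Unshelve. all: by end_near. Qed.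

Lemma cvg_powR_exp (a : R) (e : nat -> R) (l : R) : 0 < a -> e n @[n --> F] --> l ->
  a `^ e n @[n --> F] --> a `^ l.
Proof.
move=> a0 el; rewrite /powR gt_eqF//.
have c : e n * ln a @[n --> F] --> l * ln a by apply: cvgM => //; exact: cvg_cst.
by apply: (continuous_cvg _ _ c); exact: continuous_expR.
Qed.

Lemma cvg_gamma2_hat : gamma2_hat h n N Y @[n --> F] --> gamma ^+ 2.
Proof.
have d0 : h `^ (2 * H) * (2 `^ (2 * H - 1) - 1) != 0.
  by rewrite gt_eqF// mulr_gt0 ?powR_gt0 ?subr_gt0.
have c2H : 2 * H_hat h n N Y @[n --> F] --> 2 * H.
  by apply: cvgM; [exact: cvg_cst|exact: cvg_H_hat].
rewrite -[X in _ --> X](mulfK d0); apply: cvgM; first exact: cvg_eta_bar.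
apply: cvgV => //; apply: cvgM; first exact: cvg_powR_exp.
apply: cvgB; last exact: cvg_cst.
by apply: cvg_powR_exp => //; apply: cvgB => //; exact: cvg_cst.
Qed.

Lemma cvg_sigma2_hat : sigma2_hat h n N Y @[n --> F] --> sigma ^+ 2.
Proof.
have hn : h != 0 by rewrite gt_eqF.
have -> : sigma ^+ 2 = (v 1%N - gamma ^+ 2 * h `^ (2 * H)) / h.
  by rewrite /v /mixed_var mul1r; field.
apply: cvgM; last exact: cvg_cst.
apply: cvgB; first exact: cvg_xi_bar.
apply: cvgM; first exact: cvg_gamma2_hat.
apply: cvg_powR_exp => //; apply: cvgM; first exact: cvg_cst.
exact: cvg_H_hat.
Qed.

Lemma cvg_phi_hat i : (i < N)%N -> phi_hat h n N Y i @[n --> F] --> theta i + sigma ^+ 2 / 2.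
Proof.
move=> iN; rewrite [_ / 2]mulrC; apply: cvgD.
  exact: (cvg_theta_hat (fun s r => M_mean s r iN)).
by apply: cvgM; [exact: cvg_cst|exact: cvg_sigma2_hat].
Qed.

(** No limiting effect sits at [z], so each indicator is eventually constant in [n]. *)
Lemma cvg_F_hat z : (forall i, (i < N)%N -> theta i + sigma ^+ 2 / 2 != z) ->
  F_hat h n N Y z @[n --> F] --> subject_mean N (fun i => (theta i + sigma ^+ 2 / 2 <= z)%R%:R).
Proof.
move=> tz; apply: cvg_subject_mean => i iN; apply: cvg_near_cst.
have := tz i iN; rewrite neq_lt => /orP[lt|gt].
  near=> n; rewrite (ltW lt) (_ : (_ <= z) = true)//; apply/ltW.
  by near: n; exact: (cvgr_lt _ (cvg_phi_hat iN)).
near=> n; have p : z < phi_hat h n N Y i by near: n; exact: (cvgr_gt _ (cvg_phi_hat iN)).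
by rewrite !leNgt gt p.
Unshelve. all: by end_near. Qed.

Lemma cvg_F_lagrange m x :
  (forall i j, (i < N)%N -> (0 < j <= m)%N -> theta i + sigma ^+ 2 / 2 != cheb_node R m j) ->
  F_lagrange h m n N Y x @[n --> F] --> \sum_(1 <= j < m.+1)
    subject_mean N (fun i => (theta i + sigma ^+ 2 / 2 <= cheb_node R m j)%R%:R) * lagrange_basis m j x.
Proof.
move=> tz; rewrite /F_lagrange.
suff c K : (K <= m)%N -> \sum_(1 <= j < K.+1) F_hat h n N Y (cheb_node R m j) * lagrange_basis m j x
    @[n --> F] --> \sum_(1 <= j < K.+1) subject_mean N
    (fun i => (theta i + sigma ^+ 2 / 2 <= cheb_node R m j)%R%:R) * lagrange_basis m j x by exact: c.
elim: K => [_|K IH KN].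
  by rewrite big_geq//; under eq_fun do rewrite big_geq//; exact: cvg_cst.
rewrite big_nat_recr//=; under eq_fun do rewrite big_nat_recr//=.
apply: cvgD; first by apply: IH; exact: ltnW.
by apply: cvgM; [apply: cvg_F_hat => i iN; exact: tz|exact: cvg_cst].
Qed.

End EstimatorLimits.
End PathLimits.

(** * Large-time limit *)

Section Subsequences.
Context (R : realType).

(** A failure of convergence supplies an index map [b], monotone or not, with [n <= b n] and all
    terms at distance at least some [e > 0] from [l]. *)
Lemma cvg_subseq (u : nat -> R) (l : R) :
  (forall b : nat -> nat, (forall n, (n <= b n)%N) ->
    exists2 c : nat -> nat, (forall n, (n <= c n)%N) & u (b (c n)) @[n --> \oo] --> l) ->
  u n @[n --> \oo] --> l.
Proof.
move=> h; apply: contrapT => nu.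
have [e e0 he] : exists2 e : R, 0 < e & forall N, exists n, (N <= n)%N && (e <= `|l - u n|).
  apply: contrapT => hn; apply: nu; apply/cvgrPdist_lt => e e0.
  apply: contrapT => nnear; apply: hn; exists e => // N.
  apply: contrapT => hN; apply: nnear; exists N => // n /= Nn.
  by rewrite ltNge; apply/negP => en; apply: hN; exists n; rewrite Nn.
have [b hb] := choice he.
have [|c hc ucl] := h b; first by move=> n; have /andP[] := hb n.
move/cvgrPdist_lt: ucl => /(_ _ e0) [N _ /(_ N (leqnn N)) /=].
by have /andP[_] := hb (c N); rewrite leNgt => /negP.
Qed.

Lemma cvg_ge_id (b : nat -> nat) : (forall n, (n <= b n)%N) -> b n @[n --> \oo] --> \oo.
Proof.
move=> hb; apply/cvgnyPge => A; near=> n; apply: leq_trans (hb n).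
by near: n; exact: nbhs_infty_ge.
Unshelve. all: by end_near. Qed.

Context d (T : measurableType d) (P : probability T R).
Local Notation Ex := (Ex P).
Local Notation L1 := (L1 P).
Local Notation L2to0 := (L2to0 P).

Lemma sum_geometric_half_le n : \sum_(k < n) 2^-1 ^+ k <= 2 :> R.
Proof.
suff -> : \sum_(k < n) 2^-1 ^+ k = 2 - 2 * 2^-1 ^+ n :> R.
  by rewrite gerBl mulr_ge0// exprn_ge0.
elim: n => [|n IH]; first by rewrite big_ord0 expr0; ring.
by rewrite big_ord_recr/= IH exprS; field.
Qed.

(** The sum of the squares has expectation at most 2, hence is finite almost everywhere, and the
    terms of a convergent series tend to 0. *)
Lemma ae_cvg0_geometric (V : nat -> T -> R) : (forall n, measurable_fun [set: T] (V n)) ->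
  (forall n, L1 (fun w => V n w ^+ 2)) -> (forall n, Ex (fun w => V n w ^+ 2) <= 2^-1 ^+ n) ->
  {ae P, forall w, V n w @[n --> \oo] --> (0 : R)}.
Proof.
move=> mV iV eV.
pose f w := (\sum_(n <oo) (V n w ^+ 2)%:E)%E.
have mV2 n : measurable_fun [set: T] (fun w => (V n w ^+ 2)%:E).
  by apply/measurable_EFinP; exact: measurable_funX.
have V0 n w : (0 <= (V n w ^+ 2)%:E)%E by rewrite lee_fin sqr_ge0.
have mf : measurable_fun [set: T] f by apply: ge0_emeasurable_sum => //.
have f0 w : (0 <= f w)%E by apply: nneseries_ge0.
have intf : (\int[P]_w f w <= 2%:E)%E.
  rewrite integral_nneseries//; apply: lime_le.
    by apply: is_cvg_nneseries => n _ _; exact: integral_ge0.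
  apply: nearW => n; rewrite big_mkord.
  under eq_bigr do rewrite integral_Ex//.
  rewrite sumEFin lee_fin; apply: le_trans (sum_geometric_half_le n).
  by apply: ler_sum => k _; exact: eV.
have intg : P.-integrable [set: T] f.
  apply/integrableP; split => //; under eq_integral do rewrite gee0_abs//.
  by apply: le_lt_trans intf _; rewrite ltry.
have := integrable_ae measurableT intg; apply: filterS => w /(_ I) fw.
have c : cvgn (series (fun n => V n w ^+ 2)).
  apply: nondecreasing_is_cvgn.
    by apply/nondecreasing_seqP => n; rewrite /series/= big_nat_recr//= lerDl sqr_ge0.
  exists (fine (f w)) => _ [n _ <-]; rewrite -lee_fin fineK// /series/= -sumEFin.
  exact: nneseries_lim_ge.
have c2 := cvg_series_cvg_0 c.
apply/norm_cvg0P.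
have c3 : Num.sqrt (V n w ^+ 2) @[n --> \oo] --> (Num.sqrt 0 : R).
  by apply: (continuous_cvg _ _ c2); exact: sqrt_continuous.
by rewrite sqrtr0 in c3; under eq_fun do rewrite -sqrtr_sqr.
Qed.

Lemma ae_forall_nat (Q : nat -> T -> Prop) : (forall j, {ae P, forall w, Q j w}) ->
  {ae P, forall w, forall j, Q j w}.
Proof.
move=> h; have := negligible_bigcup h; apply: negligibleS => w /= /existsNP[j nQ].
by exists j.
Qed.

(** Diagonal choice: [c n] makes the second moments of the first [n] sequences at most [2^(-n)] in
    total, so each fixed [j] has geometric second moments from [n = j + 1] on. One null set then
    serves all [j]. *)
Lemma L2to0_subseq_ae (U : nat -> nat -> T -> R) (b : nat -> nat) :
  (forall j, L2to0 (U j)) -> (forall n, (n <= b n)%N) ->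
  exists2 c : nat -> nat, (forall n, (n <= c n)%N) &
    {ae P, forall w, forall j, U j (b (c n)) w @[n --> \oo] --> (0 : R)}.
Proof.
move=> U0 hb.
have h n : exists k, (n <= k)%N && (\sum_(j < n) Ex (fun w => U j (b k) w ^+ 2) <= 2^-1 ^+ n).
  have s0 K : \sum_(j < K) Ex (fun w => U j (b k) w ^+ 2) @[k --> \oo] --> (0 : R).
    elim: K => [|K IH].
      by under eq_fun do rewrite big_ord0; exact: cvg_cst.
    have -> : (fun k => \sum_(j < K.+1) Ex (fun w => U j (b k) w ^+ 2)) =
      (fun k => \sum_(j < K) Ex (fun w => U j (b k) w ^+ 2) + Ex (fun w => U K (b k) w ^+ 2)).
      by apply/funext => k; rewrite big_ord_recr.
    rewrite -[X in _ --> X]addr0; apply: cvgD => //; have [_ _ c] := U0 K.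
    exact: (cvg_comp _ _ (cvg_ge_id hb) c).
  have e0 : 0 < 2^-1 ^+ n :> R by rewrite exprn_gt0.
  have [K _ hK] := cvgr_le _ (s0 n) _ e0.
  by exists (maxn n K); rewrite leq_maxl; apply: hK; exact: leq_maxr.
have [c hc] := choice h; exists c => [n|]; first by have /andP[] := hc n.
apply: ae_forall_nat => j; have [mU iU _] := U0 j.
have cj : {ae P, forall w, U j (b (c (n + j.+1)%N)) w @[n --> \oo] --> (0 : R)}.
  apply: ae_cvg0_geometric => // n.
  have /andP[_ hn] := hc (n + j.+1)%N.
  apply: (@le_trans _ _ (2^-1 ^+ (n + j.+1))).
    apply: le_trans hn; have jn : (j < n + j.+1)%N by rewrite addnS ltnS leq_addl.
    rewrite (bigD1 (Ordinal jn))//= lerDl; apply: sumr_ge0 => k _.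
    by apply: Ex_ge0 => w; exact: sqr_ge0.
  by rewrite ler_wiXn2l// ?leq_addr// invf_le1// ler1n.
apply: filterS cj => w cw.
by rewrite -(cvg_shiftn j.+1).
Qed.

End Subsequences.

(** * Measurability of the statistics *)

Section EstimatorMeasurability.
Context (R : realType) d (T : measurableType d).

Lemma measurable_inv : measurable_fun [set: R] (fun x : R => x^-1).
Proof.
(* Powers are measurable, and this product equals the inverse also at 0, where both vanish. *)
rewrite (_ : (fun x => _) = (fun x : R => x * (x ^+ 2) `^ (-1))).
  apply: measurable_funM => //.
  exact: (measurableT_comp (measurable_powR _) (measurable_funX _ _)).
apply/funext => x; rewrite powR_inv1 ?sqr_ge0//.
by have [->|x0] := eqVneq x 0; [rewrite invr0 mul0r|field].
Qed.

Lemma measurable_fun_div (X Y : T -> R) : measurable_fun [set: T] X -> measurable_fun [set: T] Y ->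
  measurable_fun [set: T] (fun w => X w / Y w).
Proof. by move=> mX mY; apply: measurable_funM => //; exact: measurableT_comp measurable_inv mY. Qed.

Lemma measurable_indicator_le (X : T -> R) (z : R) : measurable_fun [set: T] X ->
  measurable_fun [set: T] (fun w => (X w <= z)%R%:R : R).
Proof.
move=> mX; rewrite (_ : (fun w => _) = (fun w => if X w <= z then 1 else 0)).
  by apply: measurable_fun_ifT => //; exact: measurable_fun_ler.
by apply/funext => w; case: (_ <= _).
Qed.

Lemma measurable_subject_mean N (a : T -> nat -> R) : (forall i, measurable_fun [set: T] (a ^~ i)) ->
  measurable_fun [set: T] (fun w => subject_mean N (a w)).
Proof. by move=> ma; apply: measurable_funM => //; apply: measurable_sum => i; exact: ma. Qed.

Variables (h : R) (Y : T -> nat -> R -> R).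
Hypothesis mY : forall i t, measurable_fun [set: T] (fun w => Y w i t).

Let m_incr i k : measurable_fun [set: T] (fun w => incr h (Y w i) k).
Proof. exact: measurable_funB. Qed.

Let m_theta n i : measurable_fun [set: T] (fun w => theta_hat h n (Y w i)).
Proof. by apply: measurable_funM => //; exact: measurable_sum. Qed.

Let m_V n N : measurable_fun [set: T] (fun w => V_bar h n N (Y w)).
Proof. by apply: measurable_subject_mean => i; exact: measurable_funX. Qed.

Let m_xi n N : measurable_fun [set: T] (fun w => xi_bar h n N (Y w)).
Proof.
apply: measurable_subject_mean => i; apply: measurable_funM => //.
by apply: measurable_sum => k; exact: measurable_funX.
Qed.

Let m_eta n N : measurable_fun [set: T] (fun w => eta_bar h n N (Y w)).
Proof.
apply: measurable_subject_mean => i; apply: measurable_funM => //.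
by apply: measurable_sum => k; exact: measurable_funM.
Qed.

Let m_zeta n N : measurable_fun [set: T] (fun w => zeta_bar h n N (Y w)).
Proof.
apply: measurable_subject_mean => i; apply: measurable_funM => //.
by apply: measurable_sum => k; apply: measurable_funM; exact: measurable_funB.
Qed.

Let m_H n N : measurable_fun [set: T] (fun w => H_hat h n N (Y w)).
Proof.
apply: measurable_funM => //.
have mq : measurable_fun [set: T] (fun w =>
    (zeta_bar h n N (Y w) - 4 * h ^+ 2 * V_bar h n N (Y w)) /
    (eta_bar h n N (Y w) - h ^+ 2 * V_bar h n N (Y w))).
  apply: measurable_fun_div; apply: measurable_funB => //; exact: measurable_funM.
rewrite /log2_plus; apply: measurable_fun_ifT => //; first exact: measurable_fun_ltr.
by apply: measurable_funM => //; exact: measurableT_comp (@measurable_ln R) mq.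
Qed.

Let m_pow n N : measurable_fun [set: T] (fun w => h `^ (2 * H_hat h n N (Y w))).
Proof. by apply: (measurableT_comp (measurable_powRr h)); exact: measurable_funM. Qed.

Let m_gamma n N : measurable_fun [set: T] (fun w => gamma2_hat h n N (Y w)).
Proof.
apply: measurable_fun_div; first by apply: measurable_funB => //; exact: measurable_funM.
apply: measurable_funM; first exact: m_pow.
apply: measurable_funB => //; apply: (measurableT_comp (measurable_powRr 2)).
by apply: measurable_funB => //; exact: measurable_funM.
Qed.

Let m_phi n N i : measurable_fun [set: T] (fun w => phi_hat h n N (Y w) i).
Proof.
apply: measurable_funD => //; apply: measurable_funM => //.
apply: measurable_funM => //; apply: measurable_funB.
  by apply: measurable_funB => //; exact: measurable_funM.
by apply: measurable_funM => //; exact: m_pow.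
Qed.

Lemma measurable_F_lagrange m n N x :
  measurable_fun [set: T] (fun w => F_lagrange h m n N (Y w) x).
Proof.
apply: measurable_sum => j; apply: measurable_funM => //.
by apply: measurable_subject_mean => i; exact: measurable_indicator_le.
Qed.

End EstimatorMeasurability.

(** * The limit in [n] for a fixed number of subjects *)

Section LargeTime.
Context (R : realType) d (T : measurableType d) (P : probability T R).
Variables (sigma gamma H h : R) (B BH : nat -> R -> {RV P >-> R}) (phi : nat -> {RV P >-> R}).
Hypotheses (gamma_gt0 : 0 < gamma) (H_gt : 2^-1 < H) (H_lt1 : H < 1) (h_gt0 : 0 < h).
Hypotheses (B_bm : forall i, brownian_motion (B i))
  (BH_fbm : forall i, fractional_brownian_motion H (BH i)).
Hypothesis B_BH_indep : mutually_independent_processes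
  (fun k : nat + nat => match k with inl i => B i | inr i => BH i end).
Hypothesis phi_atomless : forall i z, P (phi i @^-1` [set z]) = 0%E.
Variables (m N : nat) (x : R).
Hypothesis N_gt0 : (0 < N)%N.

Let M (i : nat) (t : R) (w : T) := mixed_fbm sigma gamma B BH i t w.

(** All averages, over subjects [i], offsets [s], lags [r] and both kinds (linear for [q] true,
    centred quadratic for [q] false), are listed in one sequence so that a single subsequence serves
    them all; codes that decode to nothing give 0. *)
Let U (j n : nat) (w : T) : R :=
  if @unpickle (nat * nat * nat * bool)%type j is Some (i, s, r, q) then
    n%:R^-1 * \sum_(k < n) (if q then step_incr h (M i) r (k + s) w
      else step_incr h (M i) r (k + s) w ^+ 2 - mixed_var h H sigma gamma r)
  else 0.

Let U_L2 j : L2to0 P (U j).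
Proof.
rewrite /U; case: unpickle => [[[[i s] r] q]|].
  have ind X Y : sigma_measurable (sigma_family [set t | 0 <= t] (B i)) X ->
      sigma_measurable (sigma_family [set t | 0 <= t] (BH i)) Y -> indep P X Y.
    exact: (@independent_processes_indep _ _ _ _ _ _ (inl i) (inr i) _ _ B_BH_indep).
  case: q; first exact: (mixed_incr_lln h_gt0 sigma gamma H_gt H_lt1 (B_bm i) (BH_fbm i)).
  exact: (mixed_incr_sqr_lln h_gt0 sigma gamma H_gt H_lt1 (B_bm i) (BH_fbm i) ind).
apply: (@Ex_le_L2to0 _ _ _ _ _ (fun=> 0)) => //; last exact: cvg_cst.
- by move=> n; rewrite expr0n/=; exact: L1_cst.
- by move=> n; rewrite (@eq_Ex _ _ _ _ _ (fun=> 0)) ?Ex_cst// => w; rewrite expr0n.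
Qed.

(** The interpolant built from the true effects, which is the limit of [F_lagrange] as [n] tends to
    infinity. *)
Definition empirical_lagrange (w : T) : R := \sum_(1 <= j < m.+1)
  subject_mean N (fun i => (phi i w <= cheb_node R m j)%R%:R) * lagrange_basis m j x.

Let Y := log_process sigma gamma B BH phi.

Lemma measurable_log_process i t : measurable_fun [set: T] (fun w => Y w i t).
Proof.
apply: measurable_funD; first by apply: measurable_funM => //; exact: measurable_funB.
by apply: measurable_funD; exact: measurable_funM.
Qed.

Lemma measurable_empirical_lagrange : measurable_fun [set: T] empirical_lagrange.
Proof.
apply: measurable_sum => j; apply: measurable_funM => //.
by apply: measurable_subject_mean => i; exact: measurable_indicator_le.
Qed.

Let phi_ae : {ae P, forall w, forall j, forall i, phi i w != cheb_node R m j}.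
Proof.
apply: ae_forall_nat => j; apply: ae_forall_nat => i.
exists (phi i @^-1` [set cheb_node R m j]); split => //.
by move=> w /= /negP; rewrite negbK => /eqP.
Qed.

Lemma F_lagrange_subseq_ae (b : nat -> nat) : (forall n, (n <= b n)%N) ->
  exists2 c : nat -> nat, (forall n, (n <= c n)%N) & {ae P, forall w,
    F_lagrange h m (b (c n)) N (Y w) x @[n --> \oo] --> empirical_lagrange w}.
Proof.
move=> hb; have [c hc ae_c] := L2to0_subseq_ae U_L2 hb.
exists c => //; apply: filterS2 ae_c phi_ae => w Uw phiw.
(* The filter for the path limits: the image of [\oo] under the extracted indices. *)
pose Fl := (fun n => b (c n)) @ \oo.
have bc : b (c n) @[n --> \oo] --> \oo.
  by apply: cvg_ge_id => n; exact: leq_trans (hb _).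
have Fl0 : \forall n \near Fl, (0 < n)%N by apply: bc; exact: nbhs_infty_gt.
have e i : (phi i w - sigma ^+ 2 / 2) + sigma ^+ 2 / 2 = phi i w by rewrite subrK.
have := @cvg_F_lagrange R Fl _ Fl0 h h_gt0 N (fun i t => M i t w)
  (fun i => phi i w - sigma ^+ 2 / 2) sigma gamma H N_gt0 gamma_gt0 H_gt _ _ m x.
rewrite /empirical_lagrange /subject_mean.
have Us (i s r : nat) (q : bool) := Uw (pickle (i, s, r, q)).
move=> /(_ _ _ _); rewrite /Fl.
have e2 : \sum_(1 <= j < m.+1)
    (N%:R^-1 * \sum_(i < N) (phi i w - sigma ^+ 2 / 2 + sigma ^+ 2 / 2 <= cheb_node R m j)%R%:R) *
      lagrange_basis m j x = empirical_lagrange w.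
  by apply: eq_bigr => j _; congr (_ * _ * _); apply: eq_bigr => i _; rewrite e.
rewrite /subject_mean e2; apply.
- move=> i s r _; have := Us i s r true; rewrite /U pickleK; exact.
- move=> i s r _; have := Us i s r false; rewrite /U pickleK; exact.
- by move=> i j _ _; rewrite e.
Qed.

(** Every subsequence has a further one with almost sure convergence, and dominated convergence
    applies since [g] is bounded. *)
Lemma cvg_Ex_F_lagrange (g : R -> R) (a b : R) : bounded_continuous g ->
  Ex P (fun w => g (a * (F_lagrange h m n N (Y w) x - b))) @[n --> \oo] -->
  Ex P (fun w => g (a * (empirical_lagrange w - b))).
Proof.
move=> [gc [K [_ gK]]].
have gb y : `|g y| <= `|K| + 1 by apply: gK => //; rewrite (le_lt_trans (ler_norm _))// ltrDl.
have mg := continuous_measurable_fun gc.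
have mF n : measurable_fun [set: T] (fun w => g (a * (F_lagrange h m n N (Y w) x - b))).
  apply: (measurableT_comp mg); apply: measurable_funM => //; apply: measurable_funB => //.
  by apply: measurable_F_lagrange; exact: measurable_log_process.
apply: cvg_subseq => bb hb; have [c hc ae_c] := F_lagrange_subseq_ae hb.
exists c => //; apply: (@Ex_cvg _ _ _ _ _ _ (fun=> `|K| + 1)).
- by move=> n; exact: mF.
- apply: (measurableT_comp mg); apply: measurable_funM => //; apply: measurable_funB => //.
  exact: measurable_empirical_lagrange.
- apply: filterS ae_c => w cw.
  have c2 : a * (F_lagrange h m (bb (c n)) N (Y w) x - b) @[n --> \oo] --> a * (empirical_lagrange w - b).
    by apply: cvgM; [exact: cvg_cst|apply: cvgB => //; exact: cvg_cst].
  by apply: (continuous_cvg _ _ c2); exact: gc.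
- by move=> n w; exact: gb.
- exact: L1_cst.
Qed.

End LargeTime.

(** * Smooth test functions and Bernoulli sums *)

Section Smooth3.
Context (R : realType).
Implicit Types (g : R -> R) (y u a b c : R).

(** Smoothness is recorded as a second-order expansion with a cubic remainder uniform in [y]. This
    is what the comparison of steps uses, and it holds for truncated cubes, whose second derivative
    is only Lipschitz. *)
Definition smooth3 g := exists g1 g2 : R -> R, exists C : R,
  [/\ measurable_fun [set: R] g, measurable_fun [set: R] g1, measurable_fun [set: R] g2 &
  forall y u, `|g (y + u) - g y - u * g1 y - u ^+ 2 / 2 * g2 y| <= C * `|u| ^+ 3].

Lemma smooth3_cst c : smooth3 (fun=> c).
Proof.
exists (fun=> 0), (fun=> 0), 0; split => // y u.
by rewrite !mulr0 !subr0 subrr normr0 mul0r.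
Qed.

Lemma smooth3D g g' : smooth3 g -> smooth3 g' -> smooth3 (fun y => g y + g' y).
Proof.
move=> [g1 [g2 [C [m0 m1 m2 hC]]]] [g1' [g2' [C' [m0' m1' m2' hC']]]].
exists (fun y => g1 y + g1' y), (fun y => g2 y + g2' y), (C + C').
split; [exact: measurable_funD|exact: measurable_funD|exact: measurable_funD|move=> y u].
rewrite mulrDl; apply: le_trans (lerD (hC y u) (hC' y u)).
apply: le_trans (ler_normD _ _); rewrite le_eqVlt; apply/orP; left; apply/eqP; congr (`|_|); ring.
Qed.

Lemma smooth3Z c g : smooth3 g -> smooth3 (fun y => c * g y).
Proof.
move=> [g1 [g2 [C [m0 m1 m2 hC]]]].
exists (fun y => c * g1 y), (fun y => c * g2 y), (`|c| * C).
split; [exact: measurable_funM|exact: measurable_funM|exact: measurable_funM|move=> y u].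
rewrite -[leRHS]mulrA; apply: le_trans (ler_wpM2l (normr_ge0 c) (hC y u)).
by rewrite -normrM le_eqVlt; apply/orP; left; apply/eqP; congr (`|_|); ring.
Qed.

Lemma smooth3_affine a b g : smooth3 g -> smooth3 (fun y => g (a * y + b)).
Proof.
move=> [g1 [g2 [C [m0 m1 m2 hC]]]].
have ma (f : R -> R) : measurable_fun [set: R] f -> measurable_fun [set: R] (fun y => f (a * y + b)).
  by move=> mf; apply: (measurableT_comp mf); apply: measurable_funD => //; exact: measurable_funM.
exists (fun y => a * g1 (a * y + b)), (fun y => a ^+ 2 * g2 (a * y + b)), (C * `|a| ^+ 3).
split; [exact: ma|by apply: measurable_funM => //; exact: ma|by apply: measurable_funM => //; exact: ma|].
move=> y u; have := hC (a * y + b) (a * u); rewrite normrM exprMn mulrA.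
rewrite (_ : a * (y + u) + b = a * y + b + a * u); last by ring.
by congr (`|_| <= _); field.
Qed.

Lemma smooth3_sum I (s : seq I) (G : I -> R -> R) : (forall i, smooth3 (G i)) ->
  smooth3 (fun y => \sum_(i <- s) G i y).
Proof.
move=> hG; elim: s => [|i s IH].
  by under eq_fun do rewrite big_nil; exact: smooth3_cst.
by under eq_fun do rewrite big_cons; exact: smooth3D.
Qed.

Definition pos_part y : R := if 0 <= y then y else 0.

Lemma ge0_pos_part y : 0 <= y -> pos_part y = y.
Proof. by rewrite /pos_part => ->. Qed.

Lemma le0_pos_part y : y <= 0 -> pos_part y = 0.
Proof. by move=> y0; rewrite /pos_part; case: ifP => // y1; apply/eqP; rewrite eq_le y0. Qed.

Lemma measurable_pos_part : measurable_fun [set: R] pos_part.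
Proof. by apply: measurable_fun_ifT => //; exact: measurable_fun_ler. Qed.

(** When 0 separates [y] and [y + u], both are at most [|u|] in modulus and the at most three terms
    left are bounded by [1 + 3 + 3 = 7] times [|u|^3]; otherwise the remainder is [u^3] or 0. *)
Lemma smooth3_pos_cube : smooth3 (fun y => pos_part y ^+ 3).
Proof.
have mp (k : nat) c : measurable_fun [set: R] (fun y => c * pos_part y ^+ k).
  by apply: measurable_funM => //; apply: measurable_funX; exact: measurable_pos_part.
exists (fun y => 3 * pos_part y ^+ 2), (fun y => 6 * pos_part y ^+ 1), 7; split => //.
  by apply: measurable_funX; exact: measurable_pos_part.
move=> y u; have [y0|y0] := leP 0 y; have [yu|yu] := leP 0 (y + u).
- rewrite !ge0_pos_part// [X in `|X|](_ : _ = u ^+ 3); last by field.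
  by rewrite normrX ler_peMl ?exprn_ge0// ler1n.
- have u0 : u < 0 by lra.
  rewrite (ge0_pos_part y0) (le0_pos_part (ltW yu)) [`|u|]ltr0_norm//.
  rewrite ler_norml; apply/andP; split.
    have : 0 <= (- u - y) * y ^+ 2 by rewrite mulr_ge0 ?sqr_ge0//; lra.
    have : 0 <= (- u - y) * (- u) * y by rewrite !mulr_ge0//; lra.
    have : 0 <= (- u) ^+ 3 by rewrite exprn_ge0//; lra.
    have : 0 <= (- u - y) * (u ^+ 2) by rewrite mulr_ge0 ?sqr_ge0//; lra.
    have : 0 <= y ^+ 3 by rewrite exprn_ge0.
    by rewrite !exprS !expr0 !mulr1 => *; lra.
  have : 0 <= (- u - y) * y ^+ 2 by rewrite mulr_ge0 ?sqr_ge0//; lra.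
  have : 0 <= (- u - y) * (- u) * y by rewrite !mulr_ge0//; lra.
  have : 0 <= (- u) ^+ 3 by rewrite exprn_ge0//; lra.
  have : 0 <= (- u - y) * (u ^+ 2) by rewrite mulr_ge0 ?sqr_ge0//; lra.
  have : 0 <= y ^+ 3 by rewrite exprn_ge0.
  by rewrite !exprS !expr0 !mulr1 => *; lra.
- have u0 : 0 < u by lra.
  rewrite (le0_pos_part (ltW y0)) ge0_pos_part// [`|u|]gtr0_norm//.
  rewrite !expr0n/= !mulr0 !subr0 ger0_norm ?exprn_ge0//.
  apply: (@le_trans _ _ (u ^+ 3)); last by rewrite ler_peMl ?exprn_ge0 ?ler1n// ltW.
  by rewrite lerXn2r// ?nnegrE//; lra.
- rewrite (le0_pos_part (ltW y0)) (le0_pos_part (ltW yu)) !expr0n/= !mulr0 !subr0 normr0.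
  by rewrite mulr_ge0// exprn_ge0.
Qed.

(* The cubic B-spline, and its third difference whose translates telescope to [1]. *)
Let c3 y : R := pos_part y ^+ 3.
Definition bspline y : R := (c3 (y + 2) - 4 * c3 (y + 1) + 6 * c3 y - 4 * c3 (y - 1) + c3 (y - 2)) / 6.
Let diff3 y : R := (c3 (y + 2) - 3 * c3 (y + 1) + 3 * c3 y - c3 (y - 1)) / 6.

Let c3p y : 0 <= y -> c3 y = y ^+ 3. Proof. by move=> y0; rewrite /c3 ge0_pos_part. Qed.
Let c3n y : y <= 0 -> c3 y = 0. Proof. by move=> y0; rewrite /c3 le0_pos_part// expr0n. Qed.

Lemma smooth3_bspline : smooth3 bspline.
Proof.
have s b : smooth3 (fun y => c3 (1 * y + b)) := smooth3_affine 1 b smooth3_pos_cube.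
have := smooth3Z 6^-1 (smooth3D (smooth3D (smooth3D (smooth3D (s 2) (smooth3Z (-4) (s 1)))
  (smooth3Z 6 (s 0))) (smooth3Z (-4) (s (-1)))) (s (-2))).
by congr smooth3; apply/funext => y; rewrite /bspline !mul1r addr0; field.
Qed.

Lemma bspline_eq0 y : 2 <= `|y| -> bspline y = 0.
Proof.
rewrite /bspline ler_normr => /orP[y2|y2].
  by rewrite !c3p; try lra; field.
by rewrite !c3n; try lra; field.
Qed.

Lemma bspline_ge0 y : 0 <= bspline y.
Proof.
have [y2|y2] := leP 2 `|y|; first by rewrite bspline_eq0.
move: y2; rewrite ltr_norml => /andP[y1 y2]; rewrite /bspline divr_ge0//.
have [ya|ya] := leP y (-1).
  rewrite c3p; last lra; rewrite !c3n; try lra.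
  have : 0 <= (y + 2) ^+ 3 by rewrite exprn_ge0//; lra.
  by lra.
have [yb|yb] := leP y 0.
  rewrite (c3p (y := y + 2)); last lra; rewrite (c3p (y := y + 1)); last lra; rewrite !c3n; try lra.
  pose s := y + 1; have s0 : 0 <= s by rewrite /s; lra.
  have s1 : 0 <= 1 - s by rewrite /s; lra.
  have := mulr_ge0 (sqr_ge0 s) s1; rewrite (_ : y = s - 1); last by rewrite /s; ring.
  by rewrite !exprS !expr0 !mulr1 => *; lra.
have [yc|yc] := leP y 1.
  rewrite (c3n (y := y - 1)); last lra; rewrite (c3n (y := y - 2)); last lra; rewrite !c3p; try lra.
  pose s := 1 - y; have s0 : 0 <= s by rewrite /s; lra.
  have s1 : 0 <= 1 - s by rewrite /s; lra.
  have := mulr_ge0 (sqr_ge0 s) s1; rewrite (_ : y = 1 - s); last by rewrite /s; ring.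
  by rewrite !exprS !expr0 !mulr1 => *; lra.
rewrite (c3n (y := y - 2)); last lra; rewrite !c3p; try lra.
have : 0 <= (2 - y) ^+ 3 by rewrite exprn_ge0//; lra.
by rewrite !exprS !expr0 !mulr1 => *; lra.
Qed.

Let diff3_le0 y : y <= -2 -> diff3 y = 0.
Proof. by move=> y2; rewrite /diff3 !c3n; try lra; field. Qed.

Let diff3_ge1 y : 1 <= y -> diff3 y = 1.
Proof. by move=> y2; rewrite /diff3 !c3p; try lra; field. Qed.

Let bsplineE y : bspline y = diff3 y - diff3 (y - 1).
Proof.
have e1 : y - 1 + 2 = y + 1 by ring.
have e2 : y - 1 + 1 = y by ring.
have e3 : y - 1 - 1 = y - 2 by ring.
by rewrite /bspline /diff3 e1 e2 e3; field.
Qed.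

Let sum_bspline (n : nat) y : \sum_(k < n) bspline (y - k%:R) = diff3 y - diff3 (y - n%:R).
Proof.
elim: n => [|n IH]; first by rewrite big_ord0 subr0 subrr.
by rewrite big_ord_recr/= IH bsplineE -[y - n%:R - 1]addrA -opprD -[n.+1%:R]natr1; ring.
Qed.

(* [diff3 y] and [1 - diff3 y] are sums of translates of the nonnegative B-spline. *)
Let diff3_bound y : 0 <= diff3 y <= 1.
Proof.
have [n hn] : exists n : nat, `|y| + 2 <= n%:R.
  by have [n _ /(_ n (leqnn n)) hn] := nbhs_infty_ger (`|y| + 2); exists n.
have y1 := ler_norm y; have y2 := ler_norm (- y); rewrite normrN in y2.
apply/andP; split.
  have := sum_bspline n y; rewrite (diff3_le0 (y := y - n%:R)); last lra.
  by rewrite subr0 => <-; apply: sumr_ge0 => k _; exact: bspline_ge0.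
have := sum_bspline n (y + n%:R); rewrite addrK (diff3_ge1 (y := y + n%:R)); last lra.
move=> e; rewrite -subr_ge0 -e; apply: sumr_ge0 => k _; exact: bspline_ge0.
Qed.

Lemma sum_bspline_le1 (n : nat) y : \sum_(k < n) bspline (y - k%:R) <= 1.
Proof.
rewrite sum_bspline; have /andP[_ h1] := diff3_bound y.
by have /andP[h2 _] := diff3_bound (y - n%:R); lra.
Qed.

Lemma sum_bspline_eq1 (n : nat) y : 1 <= y -> y + 2 <= n%:R -> \sum_(k < n) bspline (y - k%:R) = 1.
Proof. by move=> y1 yn; rewrite sum_bspline diff3_ge1// diff3_le0 ?subr0//; lra. Qed.

(** Spline quasi-interpolation: [g'] averages values of [g] with nonnegative B-spline weights of
    total mass at most 1, so the bound [K] survives. On [[- A, A]] the mass is 1 and only nodes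
    within [2 D = d] count, where uniform continuity applies. *)
Lemma smooth3_approx g (K A e : R) : continuous g -> (forall y, `|g y| <= K) -> 0 < A -> 0 < e ->
  exists g', [/\ smooth3 g', forall y, `|g' y| <= K & forall y, `|y| <= A -> `|g' y - g y| <= e].
Proof.
move=> gc gK A0 e0; have K0 : 0 <= K by apply: le_trans (gK 0).
(* Uniform continuity around the compact interval, with [z] free to leave it. *)
have [d d0 hd] : exists2 d : R, 0 < d &
    forall y z, `|y| <= A -> `|y - z| < d -> `|g z - g y| <= e.
  have cA : compact `[- A, A] by exact: segment_compact.
  have := cA; rewrite compact_near_coveringP => /(_ _ (0^'+) (fun d y => forall z, `|y - z| < d -> `|g z - g y| <= e)).
  case.
    move=> y _; have /cvgrPdist_lt/(_ (e / 2)) := gc y; rewrite divr_gt0// => /(_ isT).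
    move=> [r /= r0 hr].
    exists (ball y (r / 2), [set d : R | d < r / 2]); first split => /=.
    - by apply: nbhsx_ballx; rewrite divr_gt0.
    - by apply: nbhs_right_lt; rewrite divr_gt0.
    - move=> [y' d] /= [yy' dr] z y'z.
      have h1 : `|g y - g y'| < e / 2 by apply: hr => /=; apply: lt_trans yy' _; lra.
      have h2 : `|g y - g z| < e / 2.
        apply: hr => /=; have := ler_normD (y - y') (y' - z); rewrite addrA subrK.
        by move/le_lt_trans; apply; move: yy'; rewrite /ball/=; lra.
      have h3 := ler_normD (g z - g y) (g y - g y').
      rewrite addrA subrK (distrC (g z) (g y)) in h3; move: h1 h2 h3 => /=.
      by move: `|_ - _| `|_ - _| `|_ - _| => p q s *; lra.
  move=> r /= r0 hr; exists (r / 2); first by rewrite divr_gt0.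
  move=> y z yA yz; apply: (hr (r / 2)) => //=.
  - by rewrite sub0r normrN gtr0_norm ?divr_gt0//; lra.
  - by rewrite divr_gt0.
  - by rewrite in_itv/= -ler_norml.
pose D := d / 2; have D0 : 0 < D by rewrite divr_gt0.
(* For [|y| <= A] the rescaled point [y / D + n] then lies in [[2, 2 n - 2]], where the [2 n]
   splines sum to 1. *)
have [n hn] : exists n : nat, A / D + 2 <= n%:R.
  by have [n _ /(_ n (leqnn n)) hn] := nbhs_infty_ger (A / D + 2); exists n.
pose t (k : nat) : R := (k%:R - n%:R) * D.
pose g' y := \sum_(k < (n + n)%N) g (t k) * bspline (D^-1 * y + n%:R - k%:R).
exists g'; split.
- apply: smooth3_sum => k; apply: smooth3Z.
  have := smooth3_affine D^-1 (n%:R - k%:R) smooth3_bspline.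
  by under eq_fun do rewrite addrA.
- move=> y; apply: le_trans (ler_norm_sum _ _ _) _.
  apply: (@le_trans _ _ (\sum_(k < n + n) K * bspline (D^-1 * y + n%:R - k%:R))).
    by apply: ler_sum => k _; rewrite normrM (ger0_norm (bspline_ge0 _)) ler_wpM2r ?bspline_ge0.
  by rewrite -big_distrr/= ler_piMr// sum_bspline_le1.
- move=> y yA.
  have : `|D^-1 * y| <= A / D.
    by rewrite normrM gtr0_norm ?invr_gt0// mulrC ler_wpM2r// invr_ge0 ltW.
  rewrite ler_norml => /andP[h1 h2].
  have s1 : \sum_(k < n + n) bspline (D^-1 * y + n%:R - k%:R) = 1.
    by apply: sum_bspline_eq1; rewrite ?natrD; lra.
  rewrite -[g y]mulr1 -[X in _ - _ * X]s1 /g' big_distrr -sumrB/=.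
  apply: le_trans (ler_norm_sum _ _ _) _; rewrite -[leRHS]mulr1 -[X in _ <= _ * X]s1 big_distrr/=.
  apply: ler_sum => k _; rewrite -mulrBl normrM (ger0_norm (bspline_ge0 _)).
  have [far|near] := leP 2 `|D^-1 * y + n%:R - k%:R|; first by rewrite bspline_eq0// !mulr0.
  rewrite ler_wpM2r ?bspline_ge0//; apply: hd => //.
  have -> : y - t k = D * (D^-1 * y + n%:R - k%:R) by rewrite /t; field; rewrite gt_eqF.
  by rewrite normrM gtr0_norm// mulrC -ltr_pdivlMr// (_ : d / D = 2)// /D; field; rewrite gt_eqF.
Qed.

End Smooth3.

(** * Comparison of Bernoulli steps with Brownian steps *)

Section BernoulliSums.
Context (R : realType) d (T : measurableType d) (P : probability T R).
Local Notation Ex := (Ex P).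
Local Notation L1 := (L1 P).
Variables (X : nat -> T -> R) (p c : R).
Hypotheses (mX : forall i, measurable_fun [set: T] (X i)) (X01 : forall i w, X i w = 0 \/ X i w = 1).
Hypothesis X_indep : forall s : seq nat, uniq s -> Ex (fun w => \prod_(i <- s) X i w) = p ^+ size s.

Let S k w := \sum_(i < k) (X i w - p) * c.

(** The transition operator of one centred Bernoulli step of size [c], iterated [k] times on [g]. *)
Fixpoint bernoulli_step (g : R -> R) k (y : R) : R :=
  if k is k'.+1 then p * bernoulli_step g k' (y + (1 - p) * c) +
    (1 - p) * bernoulli_step g k' (y - p * c) else g y.

Let mS k : measurable_fun [set: T] (S k).
Proof. by apply: measurable_sum => i; apply: measurable_funM => //; exact: measurable_funB. Qed.

Let mprod s : measurable_fun [set: T] (fun w => \prod_(i <- s) X i w).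
Proof.
elim: s => [|i s IH]; first by under eq_fun do rewrite big_nil; exact: measurable_cst.
by under eq_fun do rewrite big_cons; exact: measurable_funM.
Qed.

Let prod_le1 (s : seq nat) w : `|\prod_(i <- s) X i w| <= 1.
Proof.
elim: s => [|i s IH]; first by rewrite big_nil normr1.
by rewrite big_cons normrM; case: (X01 i w) => ->; rewrite ?normr0 ?mul0r// normr1 mul1r.
Qed.

(** Independence is given through expectations of products, so the induction carries a product of
    variables of index at least [k]: as [X k] is 0 or 1, the value of [g] after its step is [X k]
    times the value after a success plus [1 - X k] times that after a failure. *)
Lemma Ex_bernoulli_sum (g : R -> R) (K : R) k (s : seq nat) y : measurable_fun [set: R] g ->
  (forall y, `|g y| <= K) -> uniq s -> all (leq k) s ->
  Ex (fun w => g (y + S k w) * \prod_(i <- s) X i w) = bernoulli_step g k y * p ^+ size s.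
Proof.
move=> mg gK.
have iG j z r : L1 (fun w => g (z + S j w) * \prod_(i <- r) X i w).
  apply: (@L1_bounded _ _ _ P _ K) => [|w].
    by apply: measurable_funM => //; apply: (measurableT_comp mg); exact: measurable_funD.
  by rewrite normrM -[leRHS]mulr1 ler_pM.
elim: k s y => [|k IH] s y us ks /=.
  rewrite -X_indep// -ExZ; last by apply: (@L1_bounded _ _ _ P _ 1).
  by apply: eq_Ex => w; rewrite /S big_ord0 addr0.
have uks : uniq (k :: s).
  by rewrite /= us andbT; apply/negP => /(allP ks); rewrite ltnn.
have aks : all (leq k) s by apply/allP => i /(allP ks); exact: ltnW.
transitivity (Ex (fun w => g (y + (1 - p) * c + S k w) * \prod_(i <- k :: s) X i w +
  g (y - p * c + S k w) * \prod_(i <- s) X i w - g (y - p * c + S k w) * \prod_(i <- k :: s) X i w)).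
  apply: eq_Ex => w; rewrite !big_cons {1}/S big_ord_recr/= -/(S k w).
  have [->|->] := X01 k w.
    have -> : y + (S k w + (0 - p) * c) = y - p * c + S k w by ring.
    by rewrite !mul0r !mulr0 add0r subr0.
  have -> : y + (S k w + (1 - p) * c) = y + (1 - p) * c + S k w by ring.
  by rewrite !mul1r addrK.
rewrite ExB; [|exact: L1D|exact: iG].
rewrite ExD//.
by rewrite !IH//= ?leqnn//=; rewrite exprS; ring.
Qed.

Lemma Ex_bernoulli_sum0 (g : R -> R) (K : R) k y : measurable_fun [set: R] g ->
  (forall y, `|g y| <= K) -> Ex (fun w => g (y + S k w)) = bernoulli_step g k y.
Proof.
move=> mg gK; have := @Ex_bernoulli_sum g K k [::] y mg gK isT isT.
by rewrite mulr1 => <-; apply: eq_Ex => w; rewrite big_nil mulr1.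
Qed.

Section Trotter.
Variables (W : R -> {RV P >-> R}) (g g1 g2 : R -> R) (C K : R).
Hypotheses (W_bm : brownian_motion W) (p0 : 0 <= p) (p1 : p <= 1) (c0 : 0 < c).
Hypotheses (mg : measurable_fun [set: R] g) (mg1 : measurable_fun [set: R] g1)
  (mg2 : measurable_fun [set: R] g2) (gK : forall y, `|g y| <= K).
Hypothesis gC : forall y u, `|g (y + u) - g y - u * g1 y - u ^+ 2 / 2 * g2 y| <= C * `|u| ^+ 3.

Let C0 : 0 <= C.
Proof. by have := gC 0 1; rewrite normr1 !expr1n mulr1; exact: le_trans. Qed.

Let K0 : 0 <= K. Proof. by apply: le_trans (gK 0). Qed.

(** The expansions at [u = 1] and [u = -1], added and subtracted, bound both coefficients in terms
    of [K] and [C]. *)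
Let g12 y : `|g1 y| <= 4 * K + 2 * C /\ `|g2 y| <= 4 * K + 2 * C.
Proof.
have := gC y 1; have := gC y (-1); rewrite normrN normr1 !expr1n mulr1 sqrrN expr1n.
have := gK y; have := gK (y + 1); have := gK (y - 1).
by rewrite !ler_norml => /andP[? ?] /andP[? ?] /andP[? ?] /andP[? ?] /andP[? ?]; split; apply/andP; split; lra.
Qed.

Lemma smooth3_lipschitz : exists2 L : R, 0 <= L & forall y u, `|g (y + u) - g y| <= L * `|u|.
Proof.
exists (8 * K + 4 * C + C + 2 * K); first by do !apply: addr_ge0 => //; exact: mulr_ge0.
move=> y u; have [u1|u1] := leP `|u| 1.
  have [b1 b2] := g12 y; have := gC y u.
  move=> hr; have -> : g (y + u) - g y = (g (y + u) - g y - u * g1 y - u ^+ 2 / 2 * g2 y) +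
    (u * g1 y + u ^+ 2 / 2 * g2 y) by ring.
  apply: le_trans (ler_normD _ _) _; apply: le_trans (lerD hr (ler_normD _ _)) _.
  rewrite !normrM normfV (ger0_norm (ler0n _ 2)) -expr2.
  have u2 : `|u| ^+ 2 <= `|u| by rewrite expr2 ler_piMl.
  have u3 : `|u| ^+ 3 <= `|u| by rewrite exprS; apply: ler_piMr => //; apply: exprn_ile1.
  have h1 := ler_wpM2l C0 u3; have h2 := ler_wpM2l (normr_ge0 u) b1.
  have h3 : `|u| ^+ 2 * `|g2 y| <= `|u| * (4 * K + 2 * C) by rewrite ler_pM.
  have : 0 <= `|u| * K by rewrite mulr_ge0.
  have : 0 <= `|u| * C by rewrite mulr_ge0.
  have : 0 <= `|u| ^+ 2 * `|g2 y| by rewrite mulr_ge0.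
  move: h1 h2 h3; move: (`|u| ^+ 2 * `|g2 y|) (`|u| ^+ 3) (`|g1 y|) => z z3 z1; nra.
apply: le_trans (ler_normB _ _) _; have h1 := gK (y + u); have h2 := gK y.
have : 0 <= (8 * K + 4 * C + C) * `|u| by apply: mulr_ge0 => //; do !apply: addr_ge0 => //; exact: mulr_ge0.
have : 2 * K * 1 <= 2 * K * `|u| by rewrite ler_wpM2l ?mulr_ge0// ltW.
by rewrite mulrDl; lra.
Qed.

Let v := p * (1 - p).
(** The variance of one Bernoulli step, taken as the length of one Brownian time step: the first two
    moments of the steps then agree. *)
Let tau := v * c ^+ 2.
Let v0 : 0 <= v. Proof. by rewrite mulr_ge0// subr_ge0. Qed.
Let tau0 : 0 <= tau. Proof. by rewrite mulr_ge0// sqr_ge0. Qed.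
Let time_ge0 (k : nat) : 0 <= k%:R * tau. Proof. by rewrite mulr_ge0. Qed.
Let G k w := W (k%:R * tau) w - W 0 w.
Let D k w := W (k.+1%:R * tau) w - W (k%:R * tau) w.
Let b k y := Ex (fun w => g (y + G k w)).

Let mG k : measurable_fun [set: T] (G k). Proof. exact: measurable_funB. Qed.
Let mD k : measurable_fun [set: T] (D k). Proof. exact: measurable_funB. Qed.

Let iG (f : R -> R) (K' : R) (Y : T -> R) (y : R) : measurable_fun [set: R] f -> (forall y, `|f y| <= K') ->
  measurable_fun [set: T] Y -> L1 (fun w => f (y + Y w)).
Proof.
move=> mf fK mY; apply: (@L1_bounded _ _ _ P _ K') => //.
by apply: (measurableT_comp mf); exact: measurable_funD.
Qed.

Let b_expand k y u : `|b k (y + u) - b k y - u * Ex (fun w => g1 (y + G k w)) -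
  u ^+ 2 / 2 * Ex (fun w => g2 (y + G k w))| <= C * `|u| ^+ 3.
Proof.
have i0 z : L1 (fun w => g (z + G k w)) by exact: iG gK _.
have i1 : L1 (fun w => g1 (y + G k w)) by exact: iG (fun z => (g12 z).1) _.
have i2 : L1 (fun w => g2 (y + G k w)) by exact: iG (fun z => (g12 z).2) _.
rewrite -!ExZ// -ExB// -ExB; [|exact: L1B|exact: L1Z].
have i3 : L1 (fun w => g (y + u + G k w) - g (y + G k w) - u * g1 (y + G k w)).
  by apply: L1B; [exact: L1B|exact: L1Z].
rewrite -ExB//; last exact: L1Z.
have i4 : L1 (fun w => g (y + u + G k w) - g (y + G k w) - u * g1 (y + G k w) -
   u ^+ 2 / 2 * g2 (y + G k w)) by apply: L1B => //; exact: L1Z.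
apply: le_trans (normr_Ex_le i4) _; rewrite -[leRHS](Ex_cst P).
apply: Ex_le; [exact: L1_norm|exact: L1_cst|move=> w].
by rewrite [y + u + _]addrAC; exact: gC.
Qed.

(** [b k] inherits the Lipschitz bound of [g], hence is continuous; this lets [b k (y + D k)] be
    integrated. *)
Let b_measurable k : measurable_fun [set: R] (b k).
Proof.
have [L L0 gL] := smooth3_lipschitz.
apply: continuous_measurable_fun => y; apply/cvgrPdist_lt => e e0.
have L1p : 0 < L + 1 by rewrite ltr_wpDl.
exists (e / (L + 1)) => /= [|z yz]; first by rewrite divr_gt0.
have bL : `|b k y - b k z| <= L * `|y - z|.
  rewrite /b -ExB; [|exact: iG gK _|exact: iG gK _].
  apply: le_trans (normr_Ex_le _) _; first by apply: L1B; exact: iG gK _.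
  rewrite -[leRHS](Ex_cst P); apply: Ex_le; [|exact: L1_cst|move=> w].
    by apply: L1_norm; apply: L1B; exact: iG gK _.
  have := gL (z + G k w) (y - z); congr (`|g _ - _| <= _); ring.
apply: le_lt_trans bL _; move: yz; rewrite /ball_/= ltr_pdivlMr// => yz.
apply: le_lt_trans yz; rewrite mulrC ler_wpM2l// lerDl.
exact: ler01.
Qed.

Let b_bound k y : `|b k y| <= K.
Proof.
apply: le_trans (normr_Ex_le _) _; first exact: iG gK _.
rewrite -[leRHS](Ex_cst P); apply: Ex_le; [|exact: L1_cst|by move=> w; exact: gK].
by apply: L1_norm; exact: iG gK _.
Qed.

(** [D k] and [G k] are increments over adjacent intervals, hence independent, and one may be
    frozen: the Brownian averages obey a one-step recursion parallel to [bernoulli_step]. *)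
Let b_step k y : b k.+1 y = Ex (fun w => b k (y + D k w)).
Proof.
have ind : indep P (D k) (G k).
  apply: indepC; apply: (bm_indep W_bm) => //.
  by rewrite ler_wpM2r// ler_nat.
have := @indep_Ex_bounded _ _ _ P (D k) (G k) (mD k) (mG k) ind (fun z => g (y + z.1 + z.2)) K.
rewrite -/(b k) => <-.
- by apply: eq_Ex => w /=; congr g; rewrite /G /D; ring.
- by apply: (measurableT_comp mg); apply: measurable_funD => //; exact: measurable_funD.
- by move=> z; exact: gK.
Qed.

Let D_moments k : [/\ L4 P (D k), Ex (D k) = 0, Ex (fun w => D k w ^+ 2) = tau &
  Ex (fun w => D k w ^+ 4) = 3 * tau ^+ 2].
Proof.
have e : k.+1%:R * tau - k%:R * tau = tau by rewrite -[k.+1%:R]natr1; ring.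
have := bm_moments W_bm (time_ge0 k) (_ : k%:R * tau <= k.+1%:R * tau).
by rewrite e; apply; rewrite ler_wpM2r// ler_nat.
Qed.

(** Both one-step operators expand [b k] to second order with equal moments, so they differ by
    remainders only: at most [C c^3] for the Bernoulli step and [2 C c^3] for the Brownian one.
    Averaging does not enlarge the error already made, so the errors add up. *)
Lemma bernoulli_step_le k y : `|bernoulli_step g k y - b k y| <= k%:R * (3 * C * c ^+ 3).
Proof.
have v1 : v <= 1 by rewrite /v; have := mulr_ge0 p0 p0; have := p1; nra.
have c3 : 0 <= c ^+ 3 by rewrite exprn_ge0// ltW.
elim: k y => [|k IH] y.
  rewrite mul0r /b (_ : Ex _ = g y) ?subrr ?normr0//.
  by rewrite -[RHS](Ex_cst P); apply: eq_Ex => w; rewrite /G mul0r subrr addr0.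
pose m1 := Ex (fun w => g1 (y + G k w)); pose m2 := Ex (fun w => g2 (y + G k w)).
pose r u := b k (y + u) - b k y - u * m1 - u ^+ 2 / 2 * m2.
have rC u : `|r u| <= C * `|u| ^+ 3 by exact: b_expand.
have [iD eD1 eD2 eD4] := D_moments k.
have iD1 := L1_L4 iD; have iD2 := L1_sqr iD.
have ib : L1 (fun w => b k (y + D k w)) by exact: (@iG (b k) K (D k) y (b_measurable k) (b_bound k) (mD k)).
have ir : L1 (fun w => r (D k w)).
  by apply: L1B; [apply: L1B; [apply: L1B => //; exact: L1_cst|]|];
    under eq_fun do rewrite mulrC; apply: L1Z => //; under eq_fun do rewrite mulrC; exact: L1Z.
have eb : b k.+1 y = b k y + tau / 2 * m2 + Ex (fun w => r (D k w)).
  rewrite b_step -[b k y](Ex_cst P) -[tau / 2 * m2](_ : m1 * Ex (D k) + m2 / 2 * Ex (fun w => D k w ^+ 2) = _).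
    rewrite -!ExZ// -ExD//; [|exact: L1Z|exact: L1Z].
    rewrite -ExD//; [|exact: L1_cst|by apply: L1D; exact: L1Z].
    rewrite -ExD//; last by apply: L1D; [exact: L1_cst|by apply: L1D; exact: L1Z].
    by apply: eq_Ex => w; rewrite /r; ring.
  by rewrite eD1 eD2; ring.
pose a1 := (1 - p) * c; pose a2 := - (p * c).
have rD : `|Ex (fun w => r (D k w))| <= 2 * C * c ^+ 3.
  apply: le_trans (normr_Ex_le ir) _.
  (* [|z|^3 <= (z^4 / c + c z^2) / 2] replaces the absolute third moment by the known even ones. *)
  apply: (@le_trans _ _ (Ex (fun w => C / 2 * (c^-1 * D k w ^+ 4 + c * D k w ^+ 2)))).
    apply: Ex_le; [exact: L1_norm|by apply: L1Z; apply: L1D; [apply: L1Z; exact: iD.2|exact: L1Z]|].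
    move=> w; apply: le_trans (rC _) _; rewrite -mulrA ler_wpM2l// .
    have -> : D k w ^+ 4 = `|D k w| ^+ 4.
      by rewrite [LHS](exprM _ 2 2) [RHS](exprM _ 2 2) real_normK ?num_real.
    rewrite -[D k w ^+ 2]real_normK ?num_real//; move: `|D k w| => z.
    have := mulr_ge0 (sqr_ge0 z) (sqr_ge0 (z - c)); rewrite -(pmulr_rge0 _ (x := c^-1)) ?invr_gt0//.
    have -> : c^-1 * (z ^+ 2 * (z - c) ^+ 2) = c^-1 * z ^+ 4 + c * z ^+ 2 - 2 * z ^+ 3.
      by field; rewrite gt_eqF.
    lra.
  rewrite ExZ; last by apply: L1D; [apply: L1Z; exact: iD.2|exact: L1Z].
  rewrite ExD; [|by apply: L1Z; exact: iD.2|exact: L1Z].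
  rewrite (ExZ _ iD.2) (ExZ _ iD2) eD2 eD4.
  have -> : C / 2 * (c^-1 * (3 * tau ^+ 2) + c * tau) = C * c ^+ 3 * ((3 * v ^+ 2 + v) / 2).
    by rewrite /tau; field; rewrite gt_eqF.
  have -> : 2 * C * c ^+ 3 = C * c ^+ 3 * 2 by ring.
  apply: ler_wpM2l; first exact: mulr_ge0.
  have : v ^+ 2 <= 1 by exact: exprn_ile1.
  lra.
have q0 : 0 <= 1 - p by rewrite subr_ge0.
have ra1 : `|r a1| <= C * c ^+ 3.
  apply: le_trans (rC _) _; rewrite ler_wpM2l//; apply: lerXn2r; rewrite ?nnegrE ?(ltW c0)//.
  by rewrite /a1 normrM ger0_norm// gtr0_norm// ler_piMl// ?(ltW c0)// gerBl.
have ra2 : `|r a2| <= C * c ^+ 3.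
  apply: le_trans (rC _) _; rewrite ler_wpM2l//; apply: lerXn2r; rewrite ?nnegrE ?(ltW c0)//.
  by rewrite /a2 normrN normrM ger0_norm// gtr0_norm// ler_piMl// ?(ltW c0).
have -> : bernoulli_step g k.+1 y - b k.+1 y =
    p * (bernoulli_step g k (y + a1) - b k (y + a1)) +
    (1 - p) * (bernoulli_step g k (y + a2) - b k (y + a2)) +
    (p * r a1 + (1 - p) * r a2 - Ex (fun w => r (D k w))).
  by rewrite eb /= -/a1 -/a2 /r /tau /v /a1 /a2; field.
have h1 := IH (y + a1); have h2 := IH (y + a2).
have mix u1 u2 z : `|u1| <= z -> `|u2| <= z -> `|p * u1 + (1 - p) * u2| <= z.
  move=> hu1 hu2; apply: le_trans (ler_normD _ _) _; rewrite !normrM (ger0_norm p0) (ger0_norm q0).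
  by apply: le_trans (lerD (ler_wpM2l p0 hu1) (ler_wpM2l q0 hu2)) _; rewrite -mulrDl addrC subrK mul1r.
have m := mix _ _ _ h1 h2; have m' := mix _ _ _ ra1 ra2.
apply: le_trans (ler_normD _ _) _; apply: le_trans (lerD m (ler_normB _ _)) _.
rewrite -[k.+1%:R]natr1 mulrDl mul1r; lra.
Qed.

End Trotter.
End BernoulliSums.

(** * Weak limits of the empirical interpolant *)

Section WeakLimits.
Context (R : realType) d (T : measurableType d) (P : probability T R).
Local Notation Ex := (Ex P).
Local Notation L1 := (L1 P).

Let L1_comp (g : R -> R) (K : R) (Z : T -> R) : measurable_fun [set: R] g -> (forall y, `|g y| <= K) ->
  measurable_fun [set: T] Z -> L1 (fun w => g (Z w)).
Proof. by move=> mg gK mZ; apply: (@L1_bounded _ _ _ P _ K) => //; exact: measurableT_comp mg mZ. Qed.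

Lemma smooth3_measurable (g : R -> R) : smooth3 g -> measurable_fun [set: R] g.
Proof. by case=> [g1 [g2 [C []]]]. Qed.

(* Outside [[- A, A]] the error [2 K] is paid for by [2 K y^2 / A^2]. *)
Lemma Ex_approx_le (g g' : R -> R) (K A e M : R) (Z : T -> R) : 0 < A -> 0 <= e ->
  measurable_fun [set: R] g -> measurable_fun [set: R] g' ->
  (forall y, `|g y| <= K) -> (forall y, `|g' y| <= K) ->
  (forall y, `|y| <= A -> `|g' y - g y| <= e) ->
  measurable_fun [set: T] Z -> L1 (fun w => Z w ^+ 2) -> Ex (fun w => Z w ^+ 2) <= M ->
  `|Ex (fun w => g' (Z w)) - Ex (fun w => g (Z w))| <= e + 2 * K / A ^+ 2 * M.
Proof.
move=> A0 e0 mg mg' gK g'K gg' mZ iZ eZ; have K0 : 0 <= K by apply: le_trans (gK 0).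
have i : L1 (fun w => g (Z w)) by exact: L1_comp gK _.
have i' : L1 (fun w => g' (Z w)) by exact: L1_comp g'K _.
have k0 : 0 <= 2 * K / A ^+ 2 by apply: divr_ge0; [exact: mulr_ge0|exact: sqr_ge0].
rewrite -ExB//; apply: le_trans (normr_Ex_le (L1B i' i)) _.
apply: (@le_trans _ _ (Ex (fun w => e + 2 * K / A ^+ 2 * Z w ^+ 2))); last first.
  rewrite ExD; [|exact: L1_cst|exact: L1Z].
  by rewrite Ex_cst ExZ// lerD2l ler_wpM2l.
apply: Ex_le; [exact/L1_norm/L1B|by apply: L1D; [exact: L1_cst|exact: L1Z]|move=> w].
have z0 : 0 <= 2 * K / A ^+ 2 * Z w ^+ 2 by rewrite mulr_ge0// sqr_ge0.
have [ZA|ZA] := leP `|Z w| A; first by apply: le_trans (gg' _ ZA) _; rewrite lerDl.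
apply: le_trans (ler_normB _ _) _; apply: le_trans (lerD (g'K _) (gK _)) _.
apply: (@le_trans _ _ (2 * K / A ^+ 2 * Z w ^+ 2)); last by rewrite lerDr.
rewrite mulrAC -mulrA -[K + K](_ : 2 * K * 1 = _); last by ring.
rewrite ler_wpM2l ?mulr_ge0// ler_pdivlMr ?exprn_gt0// mul1r.
rewrite -[Z w ^+ 2]real_normK ?num_real//; apply: lerXn2r; rewrite ?nnegrE ?(ltW A0)//.
exact: ltW.
Qed.

(** Test functions are replaced by smooth ones close to them on [[- A, A]]; the uniform bound [M] on
    second moments controls the rest and plays the part of tightness. *)
Lemma smooth3_weak_cvg (Z : nat -> T -> R) (G : T -> R) (M : R) :
  (forall N, measurable_fun [set: T] (Z N)) -> measurable_fun [set: T] G ->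
  (forall N, L1 (fun w => Z N w ^+ 2)) -> L1 (fun w => G w ^+ 2) ->
  (\forall N \near \oo, Ex (fun w => Z N w ^+ 2) <= M) -> Ex (fun w => G w ^+ 2) <= M ->
  (forall (g : R -> R) (K : R), smooth3 g -> (forall y, `|g y| <= K) ->
    Ex (fun w => g (Z N w)) @[N --> \oo] --> Ex (fun w => g (G w))) ->
  forall g : R -> R, bounded_continuous g ->
    Ex (fun w => g (Z N w)) @[N --> \oo] --> Ex (fun w => g (G w)).
Proof.
move=> mZ mG iZ iG ZM GM h g [gc [K' [_ gK']]].
pose K := `|K'| + 1; have gK y : `|g y| <= K.
  by apply: gK' => //; rewrite (le_lt_trans (ler_norm _))// ltrDl.
have K0 : 0 < K by rewrite ltr_wpDl.
have M0 : 0 <= M by apply: le_trans GM; apply: Ex_ge0 => w; exact: sqr_ge0.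
(* Each of the two replacements costs at most [2 e1], once inside and once outside [[- A, A]], and
   the smooth comparison less than [e1], which [6 e1] covers. *)
apply/cvgrPdist_lt => e e0; pose e1 := e / 6; have e10 : 0 < e1 by rewrite divr_gt0.
pose A := Num.sqrt (2 * K * (M + 1) / e1).
have A2 : 0 < 2 * K * (M + 1) / e1 by rewrite divr_gt0// !mulr_gt0// ltr_wpDl.
have A0 : 0 < A by rewrite sqrtr_gt0.
have kA : 2 * K / A ^+ 2 * M <= e1.
  rewrite sqr_sqrtr ?(ltW A2)// invfM invrK.
  rewrite [X in X <= _](_ : _ = e1 * (M / (M + 1))); last first.
    by field; rewrite !gt_eqF// ltr_wpDl.
  by rewrite ler_piMr// ?(ltW e10)// ler_pdivrMr ?mul1r ?lerDl// ltr_wpDl.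
have [g' [g'3 g'K gg']] := smooth3_approx gc gK A0 e10.
have mg := continuous_measurable_fun gc; have mg' := smooth3_measurable g'3.
have /cvgrPdist_lt/(_ _ e10) c := h g' K g'3 g'K.
near=> N.
have d1 := Ex_approx_le A0 (ltW e10) mg mg' gK g'K gg' mG iG GM.
have ZN : Ex (fun w => Z N w ^+ 2) <= M by near: N.
have d2 := Ex_approx_le A0 (ltW e10) mg mg' gK g'K gg' (mZ N) (iZ N) ZN.
have d3 : `|Ex (fun w => g' (G w)) - Ex (fun w => g' (Z N w))| < e1 by near: N; exact: c.
move: d1 d2 d3 kA; rewrite !ler_norml !ltr_norml.
move=> /andP[? ?] /andP[? ?] /andP[? ?] ?; have -> : e = 6 * e1 by rewrite /e1; field.
by apply/andP; split; lra.
Unshelve. all: by end_near. Qed.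

(** The perturbation changes the expectation by at most [L] times the mean of [|Q|], and
    [|z| <= (dl + z^2 / dl) / 2] turns this into a second moment. *)
Lemma L2to0_slutsky (g : R -> R) (K L : R) (A Q : nat -> T -> R) (l : R) :
  measurable_fun [set: R] g -> (forall y, `|g y| <= K) -> 0 <= L ->
  (forall y u, `|g (y + u) - g y| <= L * `|u|) ->
  (forall N, measurable_fun [set: T] (A N)) -> L2to0 P Q ->
  Ex (fun w => g (A N w)) @[N --> \oo] --> l ->
  Ex (fun w => g (A N w + Q N w)) @[N --> \oo] --> l.
Proof.
move=> mg gK L0 gL mA [mQ iQ Q0] cA.
rewrite -[X in _ --> X]subr0.
have -> : (fun N => Ex (fun w => g (A N w + Q N w))) =
  (fun N => Ex (fun w => g (A N w)) - (Ex (fun w => g (A N w)) - Ex (fun w => g (A N w + Q N w)))).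
  by apply/funext => N; rewrite subKr.
apply: cvgB => //; apply/cvgrPdist_lt => e e0.
pose dl := e / (2 * (L + 1)); have Lp : 0 < L + 1 by rewrite ltr_wpDl.
have d0 : 0 < dl by rewrite divr_gt0// mulr_gt0.
have /cvgrPdist_lt/(_ _ (exprn_gt0 2 d0)) c := Q0.
near=> N; rewrite sub0r normrN distrC.
have i1 : L1 (fun w => g (A N w)) by exact: L1_comp gK _.
have i2 : L1 (fun w => g (A N w + Q N w)) by apply: L1_comp gK _ => //; exact: measurable_funD.
have q : Ex (fun w => Q N w ^+ 2) < dl ^+ 2.
  have : `|0 - Ex (fun w => Q N w ^+ 2)| < dl ^+ 2 by near: N; exact: c.
  by rewrite sub0r normrN; apply: le_lt_trans; exact: ler_norm.
rewrite -ExB//; apply: le_lt_trans (normr_Ex_le (L1B i2 i1)) _.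
apply: (@le_lt_trans _ _ (Ex (fun w => L * (dl + dl^-1 * Q N w ^+ 2) / 2 ))).
  apply: Ex_le; [exact/L1_norm/L1B| |move=> w].
    under eq_fun do rewrite mulrC; apply: L1Z; apply: L1Z; apply: L1D; [exact: L1_cst|exact: L1Z].
  apply: le_trans (gL _ _) _; rewrite -mulrA ler_wpM2l//.
  rewrite -[Q N w ^+ 2]real_normK ?num_real//; move: `|Q N w| => z.
  have := sqr_ge0 (z - dl); rewrite -(pmulr_rge0 _ (x := dl^-1)) ?invr_gt0//.
  have -> : dl^-1 * (z - dl) ^+ 2 = dl^-1 * z ^+ 2 + dl - 2 * z by field; rewrite gt_eqF.
  lra.
have -> : Ex (fun w => L * (dl + dl^-1 * Q N w ^+ 2) / 2) = L / 2 * (dl + dl^-1 * Ex (fun w => Q N w ^+ 2)).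
  rewrite -ExZ// -[X in _ * (X + _)](Ex_cst P) -ExD; [|exact: L1_cst|exact: L1Z].
  rewrite -ExZ; last by apply: L1D; [exact: L1_cst|exact: L1Z].
  by apply: eq_Ex => w; ring.
have h1 : dl^-1 * Ex (fun w => Q N w ^+ 2) <= dl.
  by rewrite ler_pdivrMl// -expr2 ltW.
apply: (@le_lt_trans _ _ (L * dl)).
  rewrite (_ : L * dl = L / 2 * (dl + dl)); last by field.
  by rewrite ler_wpM2l ?divr_ge0// lerD2l.
rewrite /dl invfM mulrA mulrA -/(e / 2) [X in X < _](_ : _ = (e / 2) * (L / (L + 1))); last first.
  by field; rewrite gt_eqF.
have : L / (L + 1) <= 1 by rewrite ler_pdivrMr// mul1r lerDl.
have e2 : 0 < e / 2 by rewrite divr_gt0.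
by move=> /(ler_wpM2l (ltW e2)) /le_lt_trans; apply; rewrite mulr1; lra.
Unshelve. all: by end_near. Qed.

Lemma eq_law_Ex (X Y : T -> R) (f : R -> R) (K : R) :
  measurable_fun [set: T] X -> measurable_fun [set: T] Y ->
  (forall A : set R, measurable A -> P (X @^-1` A) = P (Y @^-1` A)) ->
  measurable_fun [set: R] f -> (forall y, `|f y| <= K) ->
  Ex (fun w => f (X w)) = Ex (fun w => f (Y w)).
Proof.
move=> mX mY XY mf fK.
have e Z (mZ : measurable_fun [set: T] Z) (Z' := mfun_Sub (mem_set mZ) : {mfun T >-> R}) :
    (\int[P]_w (f (Z w))%:E = \int[distribution P Z']_y (f y)%:E)%E.
  rewrite (@integral_distribution _ _ _ _ _ P Z' (EFin \o f))//.
  - exact/measurable_EFinP.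
  - exact: (L1_comp mf fK mZ).
apply: (@EFin_inj R).
rewrite -(integral_Ex (L1_comp mf fK mX)) -(integral_Ex (L1_comp mf fK mY)) (e _ mX) (e _ mY).
by apply: eq_measure_integral => A mA _; exact: XY.
Qed.

Lemma integral_law_Ex (X : T -> R) (nu : probability (measurableTypeR R) R) (g : R -> R) :
  measurable_fun [set: T] X ->
  (forall A : set R, measurable A -> P (X @^-1` A) = nu A) -> bounded_continuous g ->
  (\int[nu]_y (g y)%:E = (Ex (fun w => g (X w)))%:E)%E.
Proof.
move=> mX hX [gc [K' [_ gK']]]; have mg := continuous_measurable_fun gc.
have gK y : `|g y| <= `|K'| + 1.
  by apply: gK' => //; rewrite (le_lt_trans (ler_norm _))// ltrDl.
pose X' : {mfun T >-> measurableTypeR R} := @mfun_Sub _ _ T (measurableTypeR R) X (mem_set mX).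
have iX : L1 (fun w => g (X w)) by exact: (L1_comp mg gK mX).
rewrite -(integral_Ex iX).
transitivity (\int[distribution P X']_y (g y)%:E)%E.
  by apply: eq_measure_integral => A mA _; symmetry; exact: hX.
rewrite (@integral_distribution _ _ _ _ _ P X' (EFin \o g))//.
exact/measurable_EFinP.
Qed.

End WeakLimits.

(** * Central limit theorem for the interpolated empirical distribution function *)

Section EmpiricalCLT.
Context (R : realType) d (T : measurableType d) (P : probability T R).
Local Notation Ex := (Ex P).
Local Notation L1 := (L1 P).
Variables (phi : nat -> {RV P >-> R}) (F : R -> R) (W : R -> {RV P >-> R}) (m : nat -> nat) (x : R).
Hypothesis W_bm : brownian_motion W.
Hypothesis phi_cdf : forall i y, P (phi i @^-1` `]-oo, y]) = (F y)%:E.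
Hypothesis phi_indep : mutually_independent P (fun i => g_sigma_algebra_preimage (phi i)).
Hypothesis phi_law : forall i (A : set R), measurable A -> P (phi i @^-1` A) = P (phi 0 @^-1` A).
Hypothesis phi_atomless : P (phi 0 @^-1` [set x]) = 0%E.
Hypotheses (x_in : -1 <= x <= 1) (m_ge1 : forall N, (1 <= m N)%N) (m_infty : m N @[N --> \oo] --> \oo).

Let bias N := \sum_(1 <= j < (m N).+1) F (cheb_node R (m N) j) * lagrange_basis (m N) j x - F x.
Hypothesis bias_cvg0 : Num.sqrt N%:R * bias N @[N --> \oo] --> (0 : R).

Let p := F x.
Let le_ind (y : R) i w : R := (phi i w <= y)%R%:R.
Let X := le_ind x.

Let le_ind_bound y i w : `|le_ind y i w| <= 1.
Proof. by rewrite /le_ind ger0_norm// lern1 leq_b1. Qed.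

Let m_le_ind y i : measurable_fun [set: T] (le_ind y i).
Proof. exact: measurable_indicator_le. Qed.

Let L1_le_ind y i : L1 (le_ind y i).
Proof. exact: (L1_bounded P (m_le_ind y i) (le_ind_bound y i)). Qed.

Let le_indE y i : le_ind y i = \1_(phi i @^-1` `]-oo, y]).
Proof.
apply/funext => w; rewrite /le_ind indicE; congr (nat_of_bool _)%:R.
by apply/idP/idP => [wy|/set_mem]; [apply/mem_set|]; rewrite /= in_itv.
Qed.

Let m_half_line i y : measurable (phi i @^-1` `]-oo, y]).
Proof.
have := measurable_funP (phi i) measurableT _ (measurable_itv (`]-oo, y] : interval R)).
by rewrite setTI.
Qed.

Let Ex_le_ind y i : Ex (le_ind y i) = F y.
Proof. by rewrite le_indE Ex_indic// phi_cdf. Qed.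

Let p01 : 0 <= p <= 1.
Proof.
rewrite /p -(Ex_le_ind x 0); apply/andP; split.
  by apply: Ex_ge0 => w; rewrite /le_ind ler0n.
rewrite -[leRHS](Ex_cst P); apply: Ex_le; [exact: L1_le_ind|exact: L1_cst|move=> w].
by apply: le_trans (le_ind_bound x 0 w); exact: ler_norm.
Qed.

Let X01 i w : X i w = 0 \/ X i w = 1.
Proof. by rewrite /X /le_ind; case: (_ <= _); [right|left]. Qed.

(** A product of indicators is the indicator of an intersection, whose probability mutual
    independence evaluates. *)
Let X_indep (s : seq nat) : uniq s -> Ex (fun w => \prod_(i <- s) X i w) = p ^+ size s.
Proof.
move=> us; pose A i := phi i @^-1` `]-oo, x].
have -> : (fun w => \prod_(i <- s) X i w) = \1_(\bigcap_(i in [set` s]) A i).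
  apply/funext => w; rewrite indicE.
  elim: s {us} => [|i s IH].
    by rewrite big_nil mem_set//.
  rewrite big_cons IH /X le_indE indicE -natrM mulnb; congr (nat_of_bool _)%:R.
  apply/idP/idP.
    move=> /andP[/set_mem Ai /set_mem As]; apply/mem_set => j /=.
    by rewrite inE => /orP[/eqP->//|js]; exact: As.
  move=> /set_mem h; apply/andP; split; apply/mem_set.
    by apply: h; rewrite /= inE eqxx.
  by move=> j js; apply: h; rewrite /= inE; apply/orP; right.
rewrite Ex_indic; last first.
  by rewrite bigcap_seq; apply: big_ind => //; [exact: measurableI|move=> i _; exact: m_half_line].
rewrite phi_indep//; last by move=> i _; apply: g_sigma_algebra_preimageP; exact: measurable_itv.
rewrite (eq_bigr (fun=> p%:E)); last by move=> i _; rewrite /A phi_cdf.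
rewrite prodEFin/=; elim: s {us} => [|i s IH]; first by rewrite big_nil.
by rewrite big_cons IH exprS.
Qed.

Let Hs N i w := step_interp (m N) x (phi i w).

Let m_step N : measurable_fun [set: R] (step_interp (m N) x).
Proof.
apply: measurable_funB; last exact: measurable_indicator_le.
by apply: measurable_sum => j; apply: measurable_funM => //; exact: measurable_indicator_le.
Qed.

Let step_le2 N u : `|step_interp (m N) x u| <= 2.
Proof. by have [] := normr_step_interp_le u (m_ge1 N) x_in. Qed.

Let mHs N i : measurable_fun [set: T] (Hs N i).
Proof. exact: (measurableT_comp (m_step N) (measurable_funP (phi i))). Qed.

Let L1_Hs N i : L1 (Hs N i).
Proof. by apply: (L1_bounded P (mHs N i)) => w; exact: step_le2. Qed.

Let Ex_Hs N i : Ex (Hs N i) = bias N.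
Proof.
rewrite /Hs /step_interp ExB; last exact: L1_le_ind.
  rewrite Ex_le_ind Ex_sum; last by move=> j; under eq_fun do rewrite mulrC; exact/L1Z/L1_le_ind.
  congr (_ - _); apply: eq_bigr => j _; rewrite mulrC -(Ex_le_ind _ i) -ExZ; last exact: L1_le_ind.
  by apply: eq_Ex => w; rewrite mulrC.
by apply: L1_sum => j; under eq_fun do rewrite mulrC; exact/L1Z/L1_le_ind.
Qed.

Let step2_le4 N u : `|step_interp (m N) x u ^+ 2| <= 4.
Proof.
rewrite normrX (_ : 4 = 2 ^+ 2); last by ring.
by apply: lerXn2r; rewrite ?nnegrE.
Qed.

Let e N := Ex (fun w => Hs N 0 w ^+ 2).

(** Dominated convergence with bound 4: off the null event [phi 0 = x] the bound
    [1 / (m |x - phi 0|)] tends to 0. *)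
Let e_cvg0 : e N @[N --> \oo] --> (0 : R).
Proof.
rewrite -[X in _ --> X](Ex_cst P); apply: (@Ex_cvg _ _ _ _ _ _ (fun=> 4)).
- by move=> N; apply: measurable_funX; exact: mHs.
- exact: measurable_cst.
- have ae_x : {ae P, forall w, phi 0 w != x}.
    exists (phi 0 @^-1` [set x]); split => //.
    by move=> w /= /negP; rewrite negbK => /eqP.
  apply: filterS ae_x => w wx.
  have u0 : 0 < `|x - phi 0 w| by rewrite normr_gt0 subr_eq0 eq_sym.
  suff c : Hs N 0 w @[N --> \oo] --> (0 : R).
    by rewrite -[X in _ --> X](mulr0 0); exact: (cvgM c c).
  apply/cvgrPdist_lt => t t0; near=> N.
  rewrite sub0r normrN /Hs.
  have [_ h] := normr_step_interp_le (phi 0 w) (m_ge1 N) x_in.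
  have mN : t^-1 / `|x - phi 0 w| + 1 <= (m N)%:R.
    near: N; have [K _ hK] := nbhs_infty_ger (t^-1 / `|x - phi 0 w| + 1).
    have /cvgnyPge/(_ K) := m_infty; apply: filterS => N; exact: hK.
  have q : t^-1 < (m N)%:R * `|x - phi 0 w| by rewrite -ltr_pdivrMr//; lra.
  have q0 : 0 < (m N)%:R * `|x - phi 0 w| by apply: lt_trans q; rewrite invr_gt0.
  move: h; rewrite -ler_pdivlMr// mul1r => /le_lt_trans; apply.
  by rewrite invf_plt ?posrE.
- by move=> N w; exact: step2_le4.
- exact: L1_cst.
Unshelve. all: by end_near. Qed.

Let phi_pair k j : (0 < j)%N -> indep P (phi k) (phi (k + j)%N).
Proof.
move=> j0; apply: (mutually_independent_indep phi_indep).
by rewrite -[X in X != _]addn0 eqn_add2l eq_sym -lt0n.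
Qed.

(* Pairwise independence removes the off-diagonal covariances. *)
Let Ex_centered_sum_le (f : R -> R) (K mu : R) N : measurable_fun [set: R] f ->
  (forall y, `|f y| <= K) -> (forall i, Ex (fun w => f (phi i w)) = mu) ->
  Ex (fun w => (\sum_(i < N) (f (phi i w) - mu)) ^+ 2) <=
  2 * N%:R * Ex (fun w => f (phi 0 w) ^+ 2).
Proof.
move=> mf fK fmu.
have K0 : 0 <= K by apply: le_trans (fK 0).
have mfi i : measurable_fun [set: T] (fun w => f (phi i w)) by exact: (measurableT_comp mf (measurable_funP (phi i))).
have L1f i : L1 (fun w => f (phi i w)) by exact: (L1_bounded P (mfi i) (fun w => fK (phi i w))).
have mf2 : measurable_fun [set: R] (fun u => f u ^+ 2) by exact: measurable_funX.
have fK2 u : `|f u ^+ 2| <= K ^+ 2 by rewrite normrX; apply: lerXn2r; rewrite ?nnegrE.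
have L1f2 i : L1 (fun w => f (phi i w) ^+ 2).
  by apply: (@L1_bounded _ _ _ P _ (K ^+ 2)) => //; exact: measurable_funX.
pose Z k w := f (phi k w) - mu.
have mZ k : measurable_fun [set: T] (Z k) by exact: measurable_funB.
have ZK k w : `|Z k w| <= K + `|mu| by apply: le_trans (ler_normB _ _) _; rewrite lerD2r.
have iZ k l : L1 (fun w => Z k w * Z l w).
  apply: (@L1_bounded _ _ _ P _ ((K + `|mu|) * (K + `|mu|))); first exact: measurable_funM.
  by move=> w; rewrite normrM ler_pM.
have iZ1 k : L1 (Z k) by exact: (L1_bounded P (mZ k) (ZK k)).
have EZ k : Ex (Z k) = 0 by rewrite /Z ExB ?fmu ?Ex_cst ?subrr//; exact: L1_cst.
case: N => [|N].
  rewrite mulr0 mul0r (@eq_Ex _ _ _ _ _ (fun=> 0)) ?Ex_cst// => w.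
  by rewrite big_ord0 expr0n.
pose rho j : R := (j == 0%N)%:R * Ex (fun w => f (phi 0 w) ^+ 2).
have -> : Ex (fun w => f (phi 0 w) ^+ 2) = \sum_(j < N.+1) rho j.
  by rewrite big_ord_recl/= /rho mul1r big1 ?addr0// => i _; rewrite mul0r.
apply: (Ex_sqr_sum_le (Z := Z)) => // k j; rewrite /rho.
have [->|j0] := posnP j.
  rewrite addn0 mul1r ger0_norm; last by apply: Ex_ge0 => w; rewrite -expr2 sqr_ge0.
  rewrite -(eq_law_Ex (measurable_funP (phi k)) (measurable_funP (phi 0)) (phi_law k) mf2 fK2).
  have -> : Ex (fun w => Z k w * Z k w) = Ex (fun w => f (phi k w) ^+ 2) - mu ^+ 2.
    have i3 : L1 (fun w => 2 * mu * f (phi k w)) by exact: L1Z.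
    have -> : Ex (fun w => Z k w * Z k w) = Ex (fun w => f (phi k w) ^+ 2 - 2 * mu * f (phi k w) + mu ^+ 2).
      by apply: eq_Ex => w; rewrite /Z; ring.
    rewrite ExD; [|exact: L1B|exact: L1_cst].
    by rewrite ExB// ExZ// fmu Ex_cst; ring.
  by rewrite gerBl sqr_ge0.
rewrite mul0r indep_ExM// ?EZ ?mul0r ?normr0//.
have mz : measurable_fun [set: R] (fun u => f u - mu) by exact: measurable_funB.
exact: (indep_comp mz mz (phi_pair k j0)).
Qed.

(** The normalised error is [S + Q]: a Bernoulli sum, and the centred interpolation remainder
    together with [sqrt N] times the bias. *)
Let S N w := \sum_(i < N) (X i w - p) * (Num.sqrt N%:R)^-1.
Let Q N w := (Num.sqrt N%:R)^-1 * (\sum_(i < N) (Hs N i w - bias N)) + Num.sqrt N%:R * bias N.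

Let mS N : measurable_fun [set: T] (S N).
Proof. by apply: measurable_sum => i; apply: measurable_funM => //; apply: measurable_funB => //; exact: m_le_ind. Qed.

Let sqrtN_sqr N : (0 < N)%N -> (Num.sqrt N%:R)^-1 ^+ 2 * N%:R = 1 :> R.
Proof. by move=> N0; rewrite exprVn sqr_sqrtr// mulVf// pnatr_eq0 -lt0n. Qed.

Let L1_sum_sqr (f : nat -> T -> R) (K : R) N : (forall i, measurable_fun [set: T] (f i)) ->
  (forall i w, `|f i w| <= K) -> L1 (fun w => (\sum_(i < N) f i w) ^+ 2).
Proof.
move=> mf fK; apply: (@L1_bounded _ _ _ P _ ((K *+ N) ^+ 2)).
  by apply: measurable_funX; exact: measurable_sum.
move=> w; rewrite normrX; apply: lerXn2r; rewrite ?nnegrE//.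
  by rewrite mulrn_wge0//; exact: le_trans (fK 0%N w).
apply: le_trans (ler_norm_sum _ _ _) _; rewrite -[in leRHS](card_ord N) -sumr_const.
by apply: ler_sum.
Qed.

Let SE N w : S N w = (Num.sqrt N%:R)^-1 * \sum_(i < N) (X i w - p).
Proof. by rewrite /S -big_distrl/= mulrC. Qed.

Let iS N : L1 (fun w => (\sum_(i < N) (X i w - p)) ^+ 2).
Proof.
apply: (@L1_sum_sqr (fun i w => X i w - p) (1 + `|p|) N) => [i|i w].
  by apply: measurable_funB => //; exact: m_le_ind.
by apply: le_trans (ler_normB _ _) _; rewrite lerD2r; exact: le_ind_bound.
Qed.

Let ES N : Ex (fun w => S N w ^+ 2) <= 2.
Proof.
have -> : Ex (fun w => S N w ^+ 2) = (Num.sqrt N%:R)^-1 ^+ 2 * Ex (fun w => (\sum_(i < N) (X i w - p)) ^+ 2).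
  by rewrite -ExZ//; apply: eq_Ex => w; rewrite SE exprMn.
have [->|N0] := posnP N; first by rewrite sqrtr0 invr0 expr0n mul0r.
have mx : measurable_fun [set: R] (fun u : R => (u <= x)%R%:R : R) by exact: measurable_indicator_le.
have xb (y : R) : `|(y <= x)%R%:R| <= 1 :> R by rewrite ger0_norm// lern1 leq_b1.
have h := @Ex_centered_sum_le (fun u => (u <= x)%R%:R) 1 p N mx xb (Ex_le_ind x).
have e1 : Ex (fun w => (phi 0 w <= x)%R%:R ^+ 2) <= 1.
  rewrite -[leRHS](Ex_cst P); apply: Ex_le; [|exact: L1_cst|].
    apply: (@L1_bounded _ _ _ P _ 1) => [|w]; first by apply: measurable_funX; exact: m_le_ind.
    by rewrite normrX exprn_ile1.
  by move=> w; rewrite exprn_ile1 ?ler0n ?lern1 ?leq_b1.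
apply: le_trans (ler_wpM2l (sqr_ge0 _) h) _.
have -> : (Num.sqrt N%:R)^-1 ^+ 2 * (2 * N%:R * Ex (fun w => (phi 0 w <= x)%R%:R ^+ 2)) =
   2 * ((Num.sqrt N%:R)^-1 ^+ 2 * N%:R) * Ex (fun w => (phi 0 w <= x)%R%:R ^+ 2) by ring.
by rewrite sqrtN_sqr//; lra.
Qed.

Let Q_L2 : L2to0 P Q.
Proof.
apply: L2to0D; last first.
  split => [N|N|]; [exact: measurable_cst|exact: L1_cst|].
  rewrite (_ : (fun n => _) = (fun N => (Num.sqrt N%:R * bias N) ^+ 2)); last first.
    by apply/funext => N; rewrite Ex_cst.
  by rewrite -[X in _ --> X](mulr0 0); exact: (cvgM bias_cvg0 bias_cvg0).
have iH N : L1 (fun w => (\sum_(i < N) (Hs N i w - bias N)) ^+ 2).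
  apply: (@L1_sum_sqr (fun i w => Hs N i w - bias N) (2 + `|bias N|) N) => [i|i w]; first exact: measurable_funB.
  by apply: le_trans (ler_normB _ _) _; rewrite lerD2r; exact: step_le2.
apply: (@Ex_le_L2to0 _ _ _ _ _ (fun N => 2 * e N)).
- by move=> N; apply: measurable_funM => //; apply: measurable_sum => i; exact: measurable_funB.
- by move=> N; under eq_fun do rewrite exprMn; exact: L1Z.
- move=> N; have -> : Ex (fun w => ((Num.sqrt N%:R)^-1 * \sum_(i < N) (Hs N i w - bias N)) ^+ 2) =
    (Num.sqrt N%:R)^-1 ^+ 2 * Ex (fun w => (\sum_(i < N) (Hs N i w - bias N)) ^+ 2).
    by rewrite -ExZ//; apply: eq_Ex => w; rewrite exprMn.
  have [->|N0] := posnP N.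
    by rewrite sqrtr0 invr0 expr0n mul0r mulr_ge0//; apply: Ex_ge0 => w; exact: sqr_ge0.
  have h := Ex_centered_sum_le N (m_step N) (step_le2 N) (Ex_Hs N).
  apply: le_trans (ler_wpM2l (sqr_ge0 _) h) _; rewrite -/(e N).
  have -> : (Num.sqrt N%:R)^-1 ^+ 2 * (2 * N%:R * e N) =
     2 * ((Num.sqrt N%:R)^-1 ^+ 2 * N%:R) * e N by ring.
  by rewrite sqrtN_sqr// mulr1.
- exact: cvgM_eq0.
Qed.

Let Z N w := Num.sqrt N%:R * (empirical_lagrange phi (m N) N x w - F x).

Let ZE N w : (0 < N)%N -> Z N w = S N w + Q N w.
Proof.
move=> N0; have s0 : Num.sqrt N%:R != 0 :> R by rewrite gt_eqF// sqrtr_gt0 ltr0n.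
have emp : empirical_lagrange phi (m N) N x w = N%:R^-1 * \sum_(i < N) (Hs N i w + X i w).
  rewrite /empirical_lagrange /subject_mean.
  under eq_bigr do rewrite -mulrA big_distrl/=.
  rewrite -big_distrr/= exchange_big/=; congr (_ * _); apply: eq_bigr => i _.
  by rewrite /Hs /step_interp /X /le_ind subrK.
have eX : \sum_(i < N) (X i w - p) = \sum_(i < N) X i w - N%:R * p.
  by rewrite sumrB sumr_const card_ord -[p *+ N]mulr_natl.
have eH : \sum_(i < N) (Hs N i w - bias N) = \sum_(i < N) Hs N i w - N%:R * bias N.
  by rewrite sumrB sumr_const card_ord -[bias N *+ N]mulr_natl.
rewrite /Z emp SE /Q eX eH big_split/= -/p.
have e2 : N%:R = Num.sqrt N%:R ^+ 2 :> R by rewrite sqr_sqrtr.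
move: (\sum_(i < N) Hs N i w) (\sum_(i < N) X i w) (bias N) => a b q.
by move: (Num.sqrt N%:R) s0 e2 => s s0 ->; field.
Qed.

Let v := p * (1 - p).
Let v0 : 0 <= v. Proof. by have /andP[? ?] := p01; rewrite mulr_ge0// subr_ge0. Qed.

(** With [c = N^(-1/2)] and [N] steps, [N c^2 = 1]: the Brownian time reached is exactly [v], and
    the comparison error is [3 C c]. *)
Let smooth3_clt (g : R -> R) (K : R) : smooth3 g -> (forall y, `|g y| <= K) ->
  Ex (fun w => g (S N w)) @[N --> \oo] --> Ex (fun w => g (W v w - W 0 w)).
Proof.
move=> [g1 [g2 [C [mg mg1 mg2 gC]]]] gK.
have c0 : Num.sqrt (N%:R^-1) @[N --> \oo] --> (0 : R).
  rewrite -[X in _ --> X]sqrtr0; apply: (continuous_cvg _ (@sqrt_continuous R _)).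
  by rewrite -(cvg_shiftS (fun N : nat => N%:R^-1 : R)); exact: cvg_harmonic.
have c1 : 3 * C * Num.sqrt (N%:R^-1) @[N --> \oo] --> (0 : R) by exact: cvgM_eq0.
apply/cvgrPdist_lt => t t0; move/cvgrPdist_lt: c1 => /(_ _ t0) c1.
near=> N; have N0 : (0 < N)%N by near: N; exact: nbhs_infty_gt.
have /andP[p0 p1] := p01.
pose c : R := (Num.sqrt N%:R)^-1; have cpos : 0 < c by rewrite invr_gt0 sqrtr_gt0 ltr0n.
have h := bernoulli_step_le W_bm p0 p1 cpos mg mg1 mg2 gK gC N 0.
rewrite -(Ex_bernoulli_sum0 c (m_le_ind x) X01 X_indep N 0 mg gK) in h.
have c2N : c ^+ 2 * N%:R = 1 := sqrtN_sqr N0.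
have cN : N%:R * (p * (1 - p) * c ^+ 2) = v.
  transitivity (v * (c ^+ 2 * N%:R)); first by rewrite /v; ring.
  by rewrite c2N mulr1.
rewrite /= cN in h; rewrite distrC.
rewrite (_ : Ex (fun w => g (S N w)) = Ex (fun w => g (0 + \sum_(i < N) (le_ind x i w - p) * c))); last first.
  by apply: eq_Ex => w; rewrite add0r.
rewrite (_ : Ex (fun w => g (W v w - W 0 w)) = Ex (fun w => g (0 + (W v w - W 0 w)))); last first.
  by apply: eq_Ex => w; rewrite add0r.
apply: le_lt_trans h _.
have -> : N%:R * (3 * C * c ^+ 3) = 3 * C * c * (c ^+ 2 * N%:R) by ring.
rewrite c2N mulr1 /c.
have : `|0 - 3 * C * Num.sqrt (N%:R^-1)| < t by near: N; exact: c1.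
rewrite sub0r normrN sqrtrV//; apply: le_lt_trans; exact: ler_norm.
Unshelve. all: by end_near. Qed.

Lemma empirical_clt (g : R -> R) : bounded_continuous g ->
  Ex (fun w => g (Z N w)) @[N --> \oo] --> Ex (fun w => g (W v w - W 0 w)).
Proof.
have [mQ iQ cQ] := Q_L2.
have mSQ N : measurable_fun [set: T] (fun w => S N w + Q N w) by exact: measurable_funD.
have [lG _ eG _] := bm_moments W_bm (lexx 0) v0.
have iSN N : L1 (fun w => S N w ^+ 2) by under eq_fun do rewrite SE exprMn; exact: L1Z.
have iSQ N : L1 (fun w => (S N w + Q N w) ^+ 2).
  apply: (@L1_le _ _ _ _ _ (fun w => 2 * S N w ^+ 2 + 2 * Q N w ^+ 2)).
  - exact: measurable_funX.
  - by move=> w; rewrite ger0_norm ?sqr_ge0// sqrD_le.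
  - by apply: L1D; exact: L1Z.
(* [6 = 2 * 2 + 2 * 1], from second moments at most 2 for [S] and eventually below 1 for [Q]. *)
have ev : \forall N \near \oo, Ex (fun w => (S N w + Q N w) ^+ 2) <= 6.
  have /cvgrPdist_lt/(_ 1 ltr01) c1 := cQ.
  near=> N; have q : Ex (fun w => Q N w ^+ 2) < 1.
    have : `|0 - Ex (fun w => Q N w ^+ 2)| < 1 by near: N; exact: c1.
    by rewrite sub0r normrN; apply: le_lt_trans; exact: ler_norm.
  apply: (@le_trans _ _ (Ex (fun w => 2 * S N w ^+ 2 + 2 * Q N w ^+ 2))).
    by apply: Ex_le => //; [by apply: L1D; exact: L1Z|move=> w; exact: sqrD_le].
  rewrite ExD; [|exact: L1Z|exact: L1Z].
  by rewrite !ExZ//; have := ES N; lra.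
move=> bg.
(* The decomposition divides by [N], so index 0 is left out by passing to large [N]. *)
suff c : Ex (fun w => g (S N w + Q N w)) @[N --> \oo] --> Ex (fun w => g (W v w - W 0 w)).
  apply: cvg_trans c; apply: near_eq_cvg; near=> N; apply: eq_Ex => w.
  by rewrite ZE//; near: N; exact: nbhs_infty_gt.
apply: (smooth3_weak_cvg (M := 6) mSQ _ iSQ _ ev) bg => //.
- exact: measurable_funB.
- exact: L1_sqr.
- rewrite eG subr0 /v; have /andP[? ?] := p01; nra.
- move=> h K h3 hK; have [h1 [h2 [C [mh _ _ hC]]]] := h3.
  have [L L0 hL] := smooth3_lipschitz hK hC.
  exact: (L2to0_slutsky mh hK L0 hL mS Q_L2 (smooth3_clt h3 hK)).
Unshelve. all: by end_near. Qed.

End EmpiricalCLT.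

(** * Derivatives along [[-1, 1]] and the assembly of the theorem *)

Section DerivativeOn.
Context (R : realType) (g g' : R -> R).
Hypothesis dg : derivative_on `[-1, 1] g g'.

Let quotientP x e : -1 <= x <= 1 -> 0 < e -> exists2 r : R, 0 < r &
  forall y, `|x - y| < r -> y != x -> -1 <= y <= 1 -> `|g' x - (g y - g x) / (y - x)| < e.
Proof.
move=> xI e0; have xI' : `[-1, 1]%classic x by rewrite /= in_itv.
have /cvgrPdist_lt/(_ _ e0) := dg xI'.
by move=> [r /= r0 hr]; exists r.
Qed.

Lemma derivative_on_is_derive (x : R) : -1 < x < 1 -> is_derive x 1 g (g' x).
Proof.
move=> /andP[x1 x2].
have c : h^-1 *: (g (h *: 1 + x) - g x) @[h --> 0^'] --> g' x.
  apply/cvgrPdist_lt => e e0.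
  have [|r r0 hr] := @quotientP x e _ e0; first by rewrite !ltW.
  (* The radius also keeps [x + h] inside [[-1, 1]], so the limit along the interval is a full
     limit. *)
  have d0 : 0 < Num.min r (Num.min (x + 1) (1 - x)) by rewrite !lt_min r0/=; apply/andP; split; lra.
  exists (Num.min r (Num.min (x + 1) (1 - x))) => //= h.
  rewrite /ball_/= sub0r normrN !lt_min.
  move=> /and3P[hr1 hr2 hr3] h0.
  have := hr (h + x); rewrite addrK [_ *: 1]mulr1 opprD addrCA subrr addr0 normrN => /(_ hr1).
  rewrite [h^-1 *: _]mulrC; apply.
    by rewrite -subr_eq0 addrK.
  by move: hr2 hr3; rewrite !ltr_norml => /andP[? ?] /andP[? ?]; apply/andP; split; lra.
split; first by apply: cvgP c.
exact: cvg_lim c.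
Qed.

(** Near each point the difference quotient is bounded by [|g' x| + 1], also at the end points,
    where derivatives are one-sided. *)
Lemma derivative_on_continuous : {within `[-1, 1], continuous g}.
Proof.
apply/subspace_continuousP => x; rewrite /= in_itv/= => xI.
apply/cvgrPdist_lt => e e0.
have [r r0 hr] := quotientP xI ltr01.
have k0 : 0 < `|g' x| + 1 by rewrite ltr_wpDl.
have d0 : 0 < Num.min r (e / (`|g' x| + 1)) by rewrite lt_min r0 divr_gt0.
exists (Num.min r (e / (`|g' x| + 1))) => //= y.
rewrite /ball_/= lt_min => /andP[y1 y2]; rewrite in_itv/= => yI.
have [->|yx] := eqVneq y x; first by rewrite subrr normr0.
have yx0 : y - x != 0 by rewrite subr_eq0.
have q := hr y y1 yx yI.
have q2 : `|(g y - g x) / (y - x)| <= `|g' x| + 1.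
  have := ler_normB (g' x) (g' x - (g y - g x) / (y - x)).
  by rewrite subKr => /le_trans; apply; rewrite lerD2l ltW.
rewrite distrC -[g y - g x](divfK yx0) normrM.
apply: le_lt_trans (ler_wpM2r (normr_ge0 _) q2) _.
by rewrite mulrC -ltr_pdivlMr// distrC.
Qed.

End DerivativeOn.

(** The second derivative is bounded on the compact interval by its extreme values, and
    [ln m >= ln 2] absorbs the constant term of the error bound into the logarithm. *)
Lemma class_C2_bias (R : realType) (F : R -> R) : class_C2_on `[-1, 1] F -> exists2 C : R, 0 <= C &
  forall (m : nat) (x : R), (1 < m)%N -> -1 <= x <= 1 ->
  `|\sum_(1 <= j < m.+1) F (cheb_node R m j) * lagrange_basis m j x - F x| <=
  C * (ln m%:R / m%:R ^+ 2).
Proof.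
move=> [g1 [g2 [dF dg1 cg2]]].
have le11 : -1 <= 1 :> R by lra.
have [c1 _ h1] := EVT_max le11 cg2; have [c2 _ h2] := EVT_min le11 cg2.
pose K := `|g2 c1| + `|g2 c2|; have K0 : 0 <= K by rewrite addr_ge0.
have g2K y : -1 <= y <= 1 -> `|g2 y| <= K.
  move=> yI; have yI' : y \in `[-1, 1] by rewrite in_itv.
  have := h1 y yI'; have := h2 y yI'; have := ler_norm (g2 c1); have := ler_norm (- g2 c2).
  rewrite normrN ler_norml /K; have := normr_ge0 (g2 c1); have := normr_ge0 (g2 c2).
  by move=> *; apply/andP; split; lra.
have ln2 : 0 < ln 2 :> R by rewrite ln_gt0// ltr1n.
have h500 : (0 : R) <= 500 by exact: ler0n.
have h160 : (0 : R) <= 160 by exact: ler0n.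
have D0 : 0 <= 500 / ln 2 + 160 :> R.
  by apply: addr_ge0; [apply: divr_ge0; [exact: h500|exact: ltW]|exact: h160].
exists (K * (500 / ln 2 + 160)); first exact: (mulr_ge0 K0 D0).
move=> m x m1 xI.
have := cheb_bias_le (derivative_on_is_derive dF) (derivative_on_is_derive dg1) g2K
  (derivative_on_continuous dF) (derivative_on_continuous dg1) m1 xI.
move/le_trans; apply.
have m2 : 0 <= (m%:R ^+ 2)^-1 :> R by rewrite invr_ge0 exprn_ge0.
have lnm : ln 2 <= ln m%:R :> R by rewrite ler_ln ?posrE ?ltr0n ?ler_nat// (ltn_trans _ m1).
have one : 1 <= (ln 2)^-1 * ln m%:R :> R by rewrite mulrC ler_pdivlMr// mul1r.
rewrite -[leLHS]mulrA -[leRHS]mulrA; apply: (ler_wpM2l K0).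
rewrite mulrA; apply: (ler_wpM2r m2).
have := ler_wpM2l h500 one; rewrite mulr1 mulrA.
move: (500 / ln 2) (ln m%:R) => q L; rewrite [(q + _) * L]mulrDl => h; lra.
Qed.

Theorem theorem3 (R : realType) (d : measure_display) (T : measurableType d)
    (P : probability T R) (sigma gamma H h : R)
    (B BH : nat -> R -> {RV P >-> R}) (phi : nat -> {RV P >-> R})
    (F f f' : R -> R) (m : nat -> nat)
    (sigma_gt0 : 0 < sigma) (gamma_gt0 : 0 < gamma)
    (H_gt : 2^-1 < H) (H_lt1 : H < 1) (h_gt0 : 0 < h)
    (B_bm : forall i, brownian_motion (B i))
    (BH_fbm : forall i, fractional_brownian_motion H (BH i))
    (B_BH_indep : mutually_independent_processes
      (fun k : nat + nat => match k with inl i => B i | inr i => BH i end))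
    (phi_iid : iid_with_cdf phi F)
    (phi_supp : forall i, P (phi i @^-1` `[-1, 1]) = 1%E)
    (phi_density : forall i, has_density (phi i) f)
    (phi_M_indep : independent_systems P
      (sigma_family [set: nat] phi)
      (sigma_family [set k : nat * R | 0 <= k.2]
        (fun k => mixed_fbm sigma gamma B BH k.1 k.2)))
    (A1 : forall i, ('E_P[fun w => (phi i w ^+ 4)%R] < +oo)%E)
    (A2 : class_C2_on `[-1, 1] F)
    (A3_derivative : derivative_on `[-1, 1] f f')
    (A3_f : [bounded f y | y in `[-1, 1]%classic])
    (A3_f' : [bounded f' y | y in `[-1, 1]%classic])
    (m_ge1 : forall N, (1 <= m N)%N)
    (m_infty : m N @[N --> \oo] --> \oo)
    (m_rate : Num.sqrt N%:R * (ln (m N)%:R / (m N)%:R ^+ 2) @[N --> \oo]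
      --> (0 : R))
    (x : R) (x_in : x \in `[-1, 1]) :
  seq_cvg_in_law P
    (fun n N w => Num.sqrt N%:R *
      (F_lagrange h (m N) n N (log_process sigma gamma B BH phi w) x - F x))
    (normal_law 0 (F x * (1 - F x))).
Proof.
have x1 : -1 <= x <= 1 by move: x_in; rewrite in_itv.
have phi_cdf i y : P (phi i @^-1` `]-oo, y]) = (F y)%:E := phi_iid.1 i y.
(* All effects share one density, hence one law. *)
have phi_law i (A : set R) : measurable A -> P (phi i @^-1` A) = P (phi 0%N @^-1` A).
  move=> mA; have [_ _ di] := phi_density i; have [_ _ d0] := phi_density 0%N.
  exact: etrans (di A mA) (esym (d0 A mA)).
have phi_atomless i z : P (phi i @^-1` [set z]) = 0%E.
  by have [_ _ di] := phi_density i; rewrite (di _ (measurable_set1 z)) integral_set1.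
have m_ge1' N : (0 < m N)%N := m_ge1 N.
have [C C0 biasC] := class_C2_bias A2.
have bias0 : Num.sqrt N%:R * (\sum_(1 <= j < (m N).+1)
    F (cheb_node R (m N) j) * lagrange_basis (m N) j x - F x) @[N --> \oo] --> (0 : R).
  have c0 : C * (Num.sqrt N%:R * (ln (m N)%:R / (m N)%:R ^+ 2)) @[N --> \oo] --> (0 : R).
    exact: cvgM_eq0.
  apply/norm_cvg0P; apply: (squeeze_cvgr _ (cvg_cst 0) c0); near=> N.
  rewrite normr_ge0 normrM (ger0_norm (sqrtr_ge0 _)) mulrCA ler_wpM2l ?sqrtr_ge0//.
  apply: biasC => //; near: N; have /cvgnyPge/(_ 2%N) := m_infty.
  exact.
pose Z N w := Num.sqrt N%:R * (empirical_lagrange phi (m N) N x w - F x).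
have mZ N : measurable_fun [set: T] (Z N).
  apply: measurable_funM => //; apply: measurable_funB => //.
  exact: measurable_empirical_lagrange.
pose Z' N : {mfun T >-> measurableTypeR R} := @mfun_Sub _ _ T (measurableTypeR R) (Z N) (mem_set (mZ N)).
have bounded_L1 (g : R -> R) (X : T -> R) : bounded_continuous g ->
    measurable_fun [set: T] X -> L1 P (fun w => g (X w)).
  move=> [gc [K [_ gK]]] mX; apply: (@L1_bounded _ _ _ P _ (`|K| + 1)).
    exact: (measurableT_comp (continuous_measurable_fun gc) mX).
  by move=> w; apply: gK => //; rewrite (le_lt_trans (ler_norm _))// ltrDl.
(* The intermediate laws are those of the normalised interpolant of the true effects. *)
exists (fun N => distribution P (Z' N)).
have nuE N (g : R -> R) : bounded_continuous g ->
    (\int[distribution P (Z' N)]_y (g y)%:E = (Ex P (fun w => g (Z N w)))%:E)%E.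
  by move=> bg; exact: integral_law_Ex.
split=> [N N0 g bg|g bg].
  rewrite nuE//; have mY n : measurable_fun [set: T] (fun w => Num.sqrt N%:R *
      (F_lagrange h (m N) n N (log_process sigma gamma B BH phi w) x - F x)).
    apply: measurable_funM => //; apply: measurable_funB => //.
    by apply: measurable_F_lagrange; exact: measurable_log_process.
  rewrite (_ : (fun n => _) = (fun n => (Ex P (fun w => g (Num.sqrt N%:R *
      (F_lagrange h (m N) n N (log_process sigma gamma B BH phi w) x - F x))))%:E)); last first.
    by apply/funext => n; rewrite expectation_Ex//; exact: (bounded_L1 _ _ bg (mY n)).
  apply: cvg_EFin; first exact: nearW.
  exact: (cvg_Ex_F_lagrange sigma gamma_gt0 H_gt H_lt1 h_gt0 B_bm BH_fbm B_BH_indep phi_atomless N0 bg).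
have /andP[F0 F1] : 0 <= F x <= 1.
  rewrite -!lee_fin -(phi_cdf 0%N) measure_ge0 probability_le1//.
  have := measurable_funP (phi 0%N) measurableT _ (measurable_itv (`]-oo, x] : interval R)).
  by rewrite setTI.
have v0 : 0 <= F x * (1 - F x) by rewrite mulr_ge0// subr_ge0.
(* The limit law is that of an increment of [B 0] over [[0, F x (1 - F x)]]; an interval of length
   zero gives the Dirac mass. *)
have [_ B_normal _ _] := B_bm 0%N.
have hG := B_normal 0 (F x * (1 - F x)) (lexx 0) v0; rewrite subr0 in hG.
rewrite (integral_law_Ex _ hG bg); last exact: measurable_funB.
rewrite (_ : (fun N => _) = (fun N => (Ex P (fun w => g (Z N w)))%:E)); last first.
  by apply/funext => N; exact: nuE.
apply: cvg_EFin; first exact: nearW.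
exact: (empirical_clt (B_bm 0%N) phi_cdf phi_iid.2 phi_law (phi_atomless 0%N x) x1 m_ge1 m_infty bias0 bg).
Unshelve. all: by end_near. Qed.
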